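(* Let $I(n)=\dfrac{\psi(\phi(n))}{\phi(\psi(n))}$ for positive integers $n$. Then \[ \limsup_{n\to\infty}\frac{I(n)}{(\log\log n)^2}=\frac{6}{\pi^2}e^{2\gamma}. \]
   Context: $\phi$ is Euler's totient function, $\phi(n)=n\prod_{p\mid n}(1-1/p)$, and $\psi$ is Dedekind's arithmetic function, $\psi(n)=n\prod_{p\mid n}(1+1/p)$, where $p$ runs over the prime divisors of $n$. $\gamma$ denotes the Euler–Mascheroni constant. *)

(* Defs.v *)
From Stdlib Require Import Reals.
From Coquelicot Require Import Coquelicot.
From mathcomp Require Import ssreflect ssrfun ssrbool eqtype ssrnat seq div prime bigop.

(* Dedekind's psi: psi(n) = n * prod_{p | n} (1 + 1/p)
   = (n * prod_{p|n} (p+1)) / prod_{p|n} p   (exact division). *)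
Definition dedekind_psi (n : nat) : nat :=
  ((n * \prod_(p <- primes n) p.+1) %/ \prod_(p <- primes n) p)%N.

Definition I_ratio (n : nat) : R :=
  (INR (dedekind_psi (totient n)) / INR (totient (dedekind_psi n)))%R.

Definition euler_gamma : R :=
  real (Lim_seq (fun N => (sum_f_R0 (fun k => / INR (S k)) N - ln (INR (S N)))%R)).

(* Main.v *)
(* Write I(n) = [psi(phi(n)) / phi(n)] [phi(n) / psi(n)] [psi(n) / phi(psi(n))], with outer
   factors prod (1 + 1/q) over the primes q | phi(n) and prod (1 - 1/q)^-1 over the primes
   q | psi(n).  The middle factor is at most 1, and primes dividing m contribute asymptotically no
   more than the primes up to ln m, so the upper bound follows from Mertens' third theorem and
   zeta(2) = pi^2 / 6.

   For the lower bound, n is the product of large primes p_r = 1 and q_r = -1 mod r, one of each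
   for almost every prime r <= x = 2^J: every such r divides phi(n) and psi(n), while
   phi(n) / psi(n) is close to 1.  With ln p_r, ln q_r <= J^9 one gets ln n <= x^(1 + o(1)), so
   ln ln n is asymptotically at most ln x.  Linnik's theorem would give p_r and q_r for all r, but
   it suffices that the sum of 1/r over the missing r is small.  That comes from a large sieve for
   residue classes modulo primes, proved by expanding a square without characters or exponential
   sums, and applied through Vaughan's identity to the von Mangoldt function with the weight
   n^(-1-delta), delta = j^-7, for the primes r in [2^j, 2^(j+1)).  The finitely many r below a
   fixed bound are handled in the style of Euclid: prime factors of 1 + a + ... + a^(r-1) are
   1 mod r, and the real cyclotomic polynomial serves for -1 mod r. *)
From HB Require Import structures.
Require Import Defs.
From Stdlib Require Import Reals Lra Lia.
From Coquelicot Require Import Coquelicot.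
From mathcomp Require Import ssreflect ssrfun ssrbool eqtype ssrnat seq div prime bigop.
From mathcomp Require Import fintype zify.
From mathcomp Require ssralg ssrnum ssrint intdiv zmodp poly polydiv galois finfield ring.
From Coquelicot Require Import Rbar.

Set Implicit Arguments.
Unset Strict Implicit.
Unset Printing Implicit Defensive.

(** * Primes congruent to 1 and -1 modulo a prime *)

(** The exponents come from a balance at primes r near 2^j. After summation over r, the terms d m k
    <= Y of the bilinear part cost about 2^j j^5. Each exceptional r costs the main term, about (ln
    N) / 2 where delta ln N = ln 2. With ln N of order j^7, that is delta = j^-7, at most a constant
    times 2^j / j^2 exceptional r remain, and the sum of 1/j^2 over the blocks converges. Beyond X =
    2^(j^9) the weight is at most 2^(-j^2) / n, negligible against any fixed power of 2^j. The
    weight is completely multiplicative so that, once the cut-off in the product d m k is dropped,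
    the triple sum separates and only the variances of mu and Lambda over residue classes enter. The
    large sieve bounds these, summed over r with the factor r, by a power of j, whatever the number
    of moduli; this stays below 2^j. It works for n > U = 2^(4j), where the weight is already small
    against the cube of the largest modulus. *)

Module PrimesPlusMinusOne.
Import ssralg.GRing.Theory ssrnum.Num.Theory.
Import ssralg ssrnum ssrint intdiv zmodp poly polydiv galois finfield ring.
Local Open Scope ring_scope.

Lemma dvdn_of_prime_order (F : fieldType) (x : F) r m :
  prime r -> x != 1 -> x ^+ r = 1 -> x ^+ m = 1 -> (r %| m)%N.
Proof.
move=> pr nx1 xr xm; apply: contraT; rewrite -prime_coprime // => cop.
have r0 := prime_gt0 pr; case: (egcdnP m r0) => u v; rewrite (eqP cop) => E _.
have := congr1 (fun k => x ^+ k) E; rewrite mulnC exprM xr expr1n addn1 exprS mulnC exprM xm expr1n.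
by rewrite mulr1 => /esym/eqP; rewrite (negPf nx1).
Qed.

Lemma prime_1_mod r B : prime r -> exists p, [/\ prime p, (B < p)%N & (r %| p.-1)%N].
Proof.
move=> pr; have r1 := prime_gt1 pr.
(* The factorial keeps the prime divisors of [N] above [B]; the factor [r] excludes [x = 1], where
   [N] would reduce to [r] modulo [p]. *)
pose a := (r * B`!)%N; pose N := (\sum_(i < r) a ^ i)%N.
have a0 : (0 < a)%N by rewrite muln_gt0 prime_gt0 // fact_gt0.
have [c NE c0] : exists2 c, N = (1 + a * c)%N & (0 < c)%N.
  have [k Ek] : exists k, r = k.+2 by exists r.-2; lia.
  exists (\sum_(i < r.-1) a ^ i)%N.
    rewrite /N Ek big_ord_recl expn0 big_distrr /=.
    by congr (_ + _)%N; apply: eq_bigr => i _; rewrite expnS.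
  by rewrite Ek big_ord_recl.
have N1 : (1 < N)%N by rewrite NE add1n ltnS muln_gt0 a0.
have pp := pdiv_prime N1; have pN := pdiv_dvd N; set p := pdiv N in pp pN.
have npa : ~~ (p %| a)%N.
  apply/negP => pa; move: pN; rewrite NE dvdn_addl; last exact: dvdn_mulr.
  by rewrite dvdn1 => /eqP E1; rewrite E1 in pp.
exists p; split=> //.
  rewrite ltnNge; apply: contra npa => pB; apply: dvdn_mull; apply: dvdn_fact.
  by rewrite prime_gt0.
pose x : 'F_p := a%:R.
have S0 : \sum_(i < r) x ^+ i = 0.
  have : (N%:R : 'F_p) = 0 by apply/eqP; rewrite -(dvdn_pcharf (pchar_Fp pp)).
  by rewrite /N natr_sum; under eq_bigr do rewrite natrX.
have xr : x ^+ r = 1 by apply/eqP; rewrite -subr_eq0 subrX1 S0 mulr0.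
apply: (@dvdn_of_prime_order _ x) => //.
  apply: contra npa => /eqP x1; move: S0; rewrite x1.
  under eq_bigr do rewrite expr1n.
  rewrite sumr_const card_ord => /eqP; rewrite -(dvdn_pcharf (pchar_Fp pp)) => pr'.
  exact: dvdn_mulr.
have x0 : x != 0 by rewrite -(dvdn_pcharf (pchar_Fp pp)).
apply: (mulfI x0); rewrite -exprS prednK ?prime_gt0 // mulr1.
by have := expf_card x; rewrite card_Fp.
Qed.

(* [lucas x n] takes the value t^n + t^(n-1) + ... + t^-n at x = t + t^-1. *)
Fixpoint lucas_pair (A : pzRingType) (x : A) n : A * A :=
  if n is n'.+1 then let: (u, v) := lucas_pair x n' in (v, x * v - u) else (1, x + 1).
Definition lucas (A : pzRingType) (x : A) n := (lucas_pair x n).1.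

Lemma lucas0 (A : pzRingType) (x : A) : lucas x 0 = 1. Proof. by []. Qed.
Lemma lucas1 (A : pzRingType) (x : A) : lucas x 1 = x + 1. Proof. by []. Qed.
Lemma lucasSS (A : pzRingType) (x : A) n : lucas x n.+2 = x * lucas x n.+1 - lucas x n.
Proof. by rewrite /lucas /=; case: lucas_pair. Qed.

Lemma ind2 (P : nat -> Prop) : P 0%N -> P 1%N -> (forall n, P n -> P n.+1 -> P n.+2) ->
  forall n, P n.
Proof.
move=> P0 P1 H n; suff [] : P n /\ P n.+1 by [].
by elim: n => [|n [? ?]]; split=> //; apply: H.
Qed.

Lemma lucas_morph (A B : pzRingType) (f : {rmorphism A -> B}) x n : f (lucas x n) = lucas (f x) n.
Proof.
elim/ind2: n => [||n IH0 IH1]; first by rewrite !lucas0 rmorph1.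
  by rewrite !lucas1 rmorphD rmorph1.
by rewrite !lucasSS rmorphB rmorphM IH0 IH1.
Qed.

(** This is a geometric sum cleared of denominators. For 2n + 1 = r it shows that a zero t + 1/t of
    the sequence comes from an r-th root of unity t. *)
Lemma lucas_geom (A : comPzRingType) (t s : A) n : t * s = 1 ->
  lucas (t + s) n * t ^+ n * (t - 1) = t ^+ (2 * n).+1 - 1.
Proof.
move=> ts; elim/ind2: n => [||n IH0 IH1].
- by rewrite lucas0 !mulr1 mul1r muln0.
- have -> : lucas (t + s) 1 * t ^+ 1 * (t - 1) = (t * t + t * s + t) * (t - 1).
    by rewrite lucas1 expr1; ring.
  by rewrite ts; ring.
- have -> : lucas (t + s) n.+2 * t ^+ n.+2 * (t - 1) =
    (t * t + t * s) * (lucas (t + s) n.+1 * t ^+ n.+1 * (t - 1))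
    - t ^+ 2 * (lucas (t + s) n * t ^+ n * (t - 1)) by rewrite lucasSS !exprS; ring.
  have [E1 E2] : (2 * n.+2 = (2 * n).+4 /\ 2 * n.+1 = (2 * n).+2)%N by lia.
  rewrite IH0 IH1 ts E1 E2 !exprS; ring.
Qed.

Lemma lucas_pos (a : int) n : 2 <= a -> 1 <= lucas a n.
Proof.
move=> a2; suff [] : 1 <= lucas a n /\ lucas a n <= lucas a n.+1 by [].
elim: n => [|n [IH0 IH1]]; first by rewrite lucas0 lucas1; split; lia.
split; first lia.
rewrite lucasSS; set u := lucas a n in IH0 IH1 *; set v := lucas a n.+1 in IH1 *.
nia.
Qed.

(** F_p itself may contain no t with n = t + 1/t, so a root of X^2 - nX + 1 is taken in a splitting
    field; identities in t are read back through the characteristic. *)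
Lemma sum_inverse_pair p n : prime p -> exists (L : fieldType) (t s : L),
  [/\ p \in [pchar L], t * s = 1 & n%:R = t + s].
Proof.
move=> pp; pose q : {poly 'F_p} := 'X^2 - n%:R *: 'X + 1.
have sq : size q = 3%N.
  rewrite /q -addrA size_polyDl size_polyXn // ltnS.
  apply: leq_trans (size_polyD _ _) _; rewrite geq_max size_poly1 andbT size_polyN.
  by apply: leq_trans (size_scale_leq _ _) _; rewrite size_polyX.
have q0 : q != 0 by rewrite -size_poly_eq0 sq.
have [L [rs eqrs _]] := FinSplittingFieldFor q0.
have [t rt] : exists t, root (map_poly (in_alg L) q) t.
  case: rs eqrs => [|t rs] E.
    by have := eqp_size E; rewrite size_map_poly sq big_nil size_poly1.
  by exists t; rewrite (eqp_root E) big_cons rootM root_XsubC eqxx.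
have pL : p \in [pchar L] by rewrite pchar_lalg pchar_Fp.
move: rt; rewrite /q scaler_nat rmorphD rmorphB rmorph1 rmorphMn /= map_polyXn map_polyX.
rewrite rootE !hornerE hornerMn hornerX -mulr_natl => /eqP E.
have t0 : t != 0 by apply: contra_eq_neq E => ->; rewrite expr0n /= mulr0 subr0 add0r oner_neq0.
exists L, t, t^-1; split; rewrite ?divff //.
apply: (mulfI t0); rewrite mulrDr divff //.
apply/eqP; rewrite -subr_eq0 -oppr_eq0; apply/eqP; rewrite -[RHS]E; ring.
Qed.

Lemma odd_prime_half r : prime r -> r != 2%N -> r = (2 * r./2).+1.
Proof.
move=> pr r2; have := odd_double_half r; have := even_prime pr.
by case=> [E|->]; [rewrite E in r2|rewrite mul2n => {1}<-].
Qed.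

Lemma lucas_two (A : comPzRingType) n : lucas (2 : A) n = (2 * n).+1%:R.
Proof.
elim/ind2: n => [||n IH0 IH1]; first by rewrite lucas0.
  by rewrite lucas1 -mulrSr.
rewrite lucasSS IH0 IH1 !mulnS !mulrSr; ring.
Qed.

Lemma lucas_zero (A : comPzRingType) n : lucas (0 : A) n = 1 \/ lucas (0 : A) n = -1.
Proof.
elim/ind2: n => [||n IH0 _]; rewrite ?lucas0 ?lucas1 ?add0r; [by left|by left|].
by rewrite lucasSS mul0r sub0r; case: IH0 => ->; [right|left; rewrite opprK].
Qed.

(** In characteristic r, Frobenius turns t^r - 1 into (t - 1)^r, and (n - 2) t = (t - 1)^2 when n =
    t + 1/t. So the value modulo r is the quadratic character of n - 2, which can be steered to
    -1. *)
Lemma lucas_mod_prime r n : prime r -> r != 2%N ->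
  ((lucas n%:Z r./2)%:~R : 'F_r) = (n%:R - 2) ^+ r./2.
Proof.
move=> pr r2; have rE := odd_prime_half pr r2; set k := r./2 in rE *.
have [L [t [s [rL ts nE]]]] := sum_inverse_pair n pr.
suff H : ((lucas n%:Z k - (n%:Z - 2) ^+ k)%:~R : L) = 0.
  move/eqP: H; rewrite -(dvdz_pcharf rL) (dvdz_pcharf (pchar_Fp pr)) => /eqP H.
  by apply/eqP; rewrite -subr_eq0; apply/eqP; rewrite -[RHS]H rmorphB rmorphXn rmorphB.
rewrite rmorphB rmorphXn rmorphB /= lucas_morph /= -!pmulrn nE.
(* At t = 1 the factor t - 1 cannot be cancelled, but both sides vanish: the left one is 2k + 1 =
   r. *)
case: (eqVneq t 1) => [t1|t1].
  have s1 : s = 1 by rewrite -[RHS]ts t1 mul1r.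
  have H0 := pcharf0 rL; rewrite rE in H0; rewrite t1 s1.
  rewrite (_ : 1 + 1 = 2 :> L); last by [].
  rewrite lucas_two H0 subrr expr0n; case: (posnP k) => [k0|]; last by rewrite subr0.
  by move: rE pr; rewrite k0 => ->.
have t0 : t != 0 by apply: contra_eq_neq ts => ->; rewrite mul0r eq_sym oner_neq0.
apply/eqP; rewrite subr_eq0; apply/eqP.
have t10 : t - 1 != 0 by rewrite subr_eq0.
apply: (mulIf t10); apply: (mulIf (expf_neq0 k t0)).
rewrite mulrAC lucas_geom // mulrAC -exprMn -rE.
have -> : (t + s - 2) * t = (t - 1) ^+ 2.
  by rewrite expr2 -[LHS]subr0 -(subrr (t * s)) {2}ts; ring.
rewrite -exprM -exprSr -rE.
by have := pFrobenius_autB_comm rL (mulrC t 1); rewrite !pFrobenius_autE expr1n.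
Qed.

(** X^k - 1 with k = (r - 1)/2 has at most k roots among the 2k nonzero residues, and y^k is always
    1 or -1. *)
Lemma exists_nonresidue r : prime r -> r != 2%N -> exists c : nat, (c%:R : 'F_r) ^+ r./2 = -1.
Proof.
move=> pr r2; have rE := odd_prime_half pr r2; set k := r./2 in rE *.
have k0 : (0 < k)%N by case: (posnP k) rE pr => // -> ->.
have [y y0 yk] : exists2 y : 'F_r, y != 0 & y ^+ k != 1.
  apply/exists_inP; rewrite -[X in is_true X]negbK negb_exists; apply/negP => /forallP H.
  have := @max_unity_roots 'F_r k (enum [pred y : 'F_r | y != 0]) k0.
  rewrite enum_uniq -cardE => /(_ _ isT).
  have -> : #|[pred x : 'F_r | x != 0]| = r.-1.
    by have := cardC1 (0 : 'F_r); rewrite card_Fp // => <-; apply: eq_card => x.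
  rewrite [in r.-1]rE /= => W; suff : (2 * k <= k)%N by lia.
  apply: W; apply/allP => y; rewrite mem_enum inE => y0.
  by apply/unity_rootP/eqP; have := H y; rewrite y0 /= negbK.
exists (val y); rewrite natr_Zp.
have : (y ^+ k) ^+ 2 = 1.
  rewrite -exprM mulnC; apply: (mulfI y0).
  by rewrite mulr1 -exprS -rE; have := expf_card y; rewrite card_Fp.
by move/eqP; rewrite sqrf_eq1 (negPf yk) => /eqP.
Qed.

Lemma all_primes_1_mod r N : (0 < N)%N ->
  (forall p, prime p -> (p %| N)%N -> p = 1 %[mod r]) -> N = 1 %[mod r].
Proof.
elim/ltn_ind: N => N IH N0 H; case: (leqP N 1) => [N1|N1].
  by have -> : N = 1%N by lia.
have pp := pdiv_prime N1; have pN := pdiv_dvd N.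
have N0' : (0 < N %/ pdiv N)%N by rewrite divn_gt0 ?prime_gt0 // dvdn_leq.
rewrite -(divnK pN) -modnMml (IH (N %/ pdiv N)%N) //.
- by rewrite modnMml mul1n H.
- by rewrite ltn_Pdiv // prime_gt1.
- by move=> p q d; apply: H => //; apply: dvdn_trans d (dvdn_div pN).
Qed.

(** For odd r the value [z] is -1 modulo r, so some prime factor p of [z] is not 1 modulo r. In
    characteristic p write n = t + 1/t; then t has order r. Frobenius fixes n, so it sends t to t or
    to 1/t. The first would give p = 1 mod r; the second gives that r divides p + 1. *)
Lemma prime_m1_mod r B : prime r -> exists p, [/\ prime p, (B < p)%N & (r %| p.+1)%N].
Proof.
move=> pr; case: (eqVneq r 2) => [->|r2].
  have [p [pp Bp d]] := @prime_1_mod 2 B isT; exists p; split=> //.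
  by have := prime_gt1 pp; lia.
have rE := odd_prime_half pr r2; have [c] := exists_nonresidue pr r2.
set k := r./2 in rE * => cE.
(* Only the part of the factorial prime to r is used, so that two congruences can be imposed on [n]:
   n - 2 is a nonresidue modulo r, and n is 0 modulo every prime up to [B] other than r. The summand
   2rM ensures n >= 2, hence [z] >= 1. *)
pose M := (B`!`_r^')%N; have cop : coprime r M by rewrite prime_coprime // -p'natE // part_pnat.
pose n := (chinese r M (c + 2) 0 + 2 * (r * M))%N.
have n2 : (2 <= n)%N.
  have : (0 < r * M)%N by rewrite muln_gt0 prime_gt0 // part_gt0.
  by rewrite /n; move: (r * M)%N (chinese _ _ _ _) => u v; lia.
have nr : (n%:R : 'F_r) = c%:R + 2.
  rewrite -natrD -(Fp_nat_mod pr n) -(Fp_nat_mod pr (c + 2)); congr (_%:R).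
  by rewrite /n addnC mulnCA mulnC modnMDl chinese_modl.
have nM : (M %| n)%N.
  by rewrite /n addnC mulnA /dvdn modnMDl chinese_modr // mod0n.
pose z := lucas n%:Z k; have z1 : 1 <= z by apply: lucas_pos; lia.
have [N zE] : exists N : nat, z = N%:Z by exists `|z|%N; lia.
have N0 : (0 < N)%N by lia.
have rN : (r %| N.+1)%N.
  rewrite (dvdn_pcharf (pchar_Fp pr)) -(addn1 N) natrD.
  have := lucas_mod_prime n pr r2; rewrite -/k -/z zE -pmulrn nr addrK cE => ->.
  by rewrite addNr.
have [p [pp pN p1]] : exists p, [/\ prime p, (p %| N)%N & p <> 1 %[mod r]].
  case E : (all (fun p => p == 1 %[mod r]) (primes N)).
    have N1 : N = 1 %[mod r].
      apply: all_primes_1_mod => // p pp pN; apply/eqP; apply: (allP E).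
      by rewrite mem_primes pp N0 pN.
    have : (r %| 2)%N by move: rN; rewrite /dvdn -(addn1 N) -modnDml N1 modnDml.
    by rewrite dvdn_prime2 // (negPf r2).
  move/negbT: E => /allPn[p]; rewrite mem_primes => /and3P[pp _ pN] /eqP p1.
  by exists p; split.
have pr' : p != r.
  apply: contraTneq rN => <-; rewrite -(addn1 N) dvdn_addr // dvdn1.
  by apply: contraTneq pp => ->.
exists p; split=> //.
  rewrite ltnNge; apply/negP => pB.
  (* If p <= B then p divides n, and [z] reduces modulo p to the value at 0, which is 1 or -1. *)
  have pn : (p %| n)%N.
    apply: dvdn_trans nM; have pB' : (p %| B`!)%N by rewrite dvdn_fact // prime_gt0.
    move: pB'; rewrite -(partnC r (fact_gt0 B)) Gauss_dvdr // prime_coprime //.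
    apply/negP => /pnat_dvd/(_ (part_pnat r _)); rewrite pnatE // => /eqP E.
    by rewrite E eqxx in pr'.
  have n0 : (n%:R : 'F_p) = 0 by apply/eqP; rewrite -(dvdn_pcharf (pchar_Fp pp)).
  have : (N%:R : 'F_p) = lucas 0 k by rewrite pmulrn -zE /z lucas_morph /= -pmulrn n0.
  have -> : (N%:R : 'F_p) = 0 by apply/eqP; rewrite -(dvdn_pcharf (pchar_Fp pp)).
  case: (lucas_zero 'F_p k) => -> /eqP; rewrite eq_sym ?oppr_eq0 oner_eq0 //.
have [L [t [s [pL ts nE]]]] := sum_inverse_pair n pp.
have l0 : lucas (t + s) k = 0.
  rewrite -nE (_ : lucas n%:R k = (lucas n%:Z k)%:~R); last by rewrite lucas_morph.
  by rewrite -/z zE -pmulrn; apply/eqP; rewrite -(dvdn_pcharf pL).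
have tr : t ^+ r = 1.
  have := lucas_geom k ts; rewrite l0 !mul0r -rE => /esym/eqP.
  by rewrite subr_eq0 => /eqP.
have t1 : t != 1.
  apply/eqP => t1; move: l0; have -> : t + s = 2.
    by have s1 : s = 1 by [rewrite -[RHS]ts t1 mul1r]; rewrite t1 s1.
  rewrite lucas_two -rE => /eqP; rewrite -(dvdn_pcharf pL) dvdn_prime2 //.
  by rewrite (negPf pr').
have t0 : t != 0 by apply: contra_eq_neq ts => ->; rewrite mul0r eq_sym oner_neq0.
have Fr : t ^+ p + s ^+ p = t + s.
  have := pFrobenius_aut_nat pL n; rewrite pFrobenius_autE nE.
  by have := pFrobenius_autD_comm pL (mulrC t s); rewrite !pFrobenius_autE => ->.
have ts' : t ^+ p * s ^+ p = 1 by rewrite -exprMn ts expr1n.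
have : (t ^+ p - t) * (t ^+ p - s) = 0.
  have -> : (t ^+ p - t) * (t ^+ p - s) = t ^+ p * (t ^+ p - (t + s)) + t * s by ring.
  by rewrite -Fr ts -[X in _ + X]ts'; ring.
move/eqP; rewrite mulf_eq0 !subr_eq0 => /orP[] /eqP E.
  case: p1; have : (r %| p.-1)%N.
    apply: (dvdn_of_prime_order pr t1 tr); apply: (mulfI t0).
    by rewrite -exprS prednK ?prime_gt0 // mulr1.
  by move=> d; rewrite -(prednK (prime_gt0 pp)) -(addn1 p.-1) -modnDml (eqP d).
apply: (dvdn_of_prime_order pr t1 tr).
by rewrite exprS E ts.
Qed.
End PrimesPlusMinusOne.

Local Open Scope R_scope.

(** * Finite sums and products of real numbers *)

Arguments INR : simpl never.
Arguments pow : simpl never.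

HB.instance Definition _ := Monoid.isComLaw.Build R 0 Rplus
  (fun x y z => esym (Rplus_assoc x y z)) Rplus_comm Rplus_0_l.
HB.instance Definition _ := Monoid.isComLaw.Build R 1 Rmult
  (fun x y z => esym (Rmult_assoc x y z)) Rmult_comm Rmult_1_l.
HB.instance Definition _ := Monoid.isMulLaw.Build R 0 Rmult Rmult_0_l Rmult_0_r.
HB.instance Definition _ := Monoid.isAddLaw.Build R Rmult Rplus
  Rmult_plus_distr_r Rmult_plus_distr_l.

Notation "\sum_ ( i <- r | P ) F" := (\big[Rplus/0%R]_(i <- r | P%B) F%R) : R_scope.
Notation "\sum_ ( i <- r ) F" := (\big[Rplus/0%R]_(i <- r) F%R) : R_scope.
Notation "\sum_ ( m <= i < n | P ) F" :=
  (\big[Rplus/0%R]_(m%N <= i < n%N | P%B) F%R) : R_scope.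
Notation "\sum_ ( m <= i < n ) F" := (\big[Rplus/0%R]_(m%N <= i < n%N) F%R) : R_scope.
Notation "\prod_ ( i <- r | P ) F" := (\big[Rmult/1%R]_(i <- r | P%B) F%R) : R_scope.
Notation "\prod_ ( i <- r ) F" := (\big[Rmult/1%R]_(i <- r) F%R) : R_scope.
Notation "\prod_ ( m <= i < n | P ) F" :=
  (\big[Rmult/1%R]_(m%N <= i < n%N | P%B) F%R) : R_scope.

Lemma sumR_opp (I : Type) (s : seq I) (P : pred I) (F : I -> R) :
  \sum_(i <- s | P i) (- F i) = - \sum_(i <- s | P i) F i.
Proof. by elim/big_ind2: _ => [|x y z t -> ->|]; [lra|lra|]. Qed.

Lemma sumR_sub (I : Type) (s : seq I) (P : pred I) (F G : I -> R) :
  \sum_(i <- s | P i) (F i - G i) = \sum_(i <- s | P i) F i - \sum_(i <- s | P i) G i.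
Proof. by rewrite big_split sumR_opp. Qed.

Lemma sumR_scal (I : Type) (s : seq I) (P : pred I) (F : I -> R) c :
  \sum_(i <- s | P i) (c * F i) = c * \sum_(i <- s | P i) F i.
Proof. by rewrite big_distrr. Qed.

Lemma sumR_const (I : Type) (s : seq I) (P : pred I) c :
  \sum_(i <- s | P i) c = INR (count P s) * c.
Proof.
rewrite big_const_seq; elim: (count P s) => [|n IH]; first by rewrite INR_0 /=; lra.
rewrite S_INR /= IH; lra.
Qed.

Lemma prodR_inv (I : Type) (s : seq I) (P : pred I) (F : I -> R) :
  / (\prod_(i <- s | P i) F i) = \prod_(i <- s | P i) / F i.
Proof.
elim/big_ind2: _ => [|x y z t <- <-|//]; first by rewrite Rinv_1.
exact: Rinv_mult.
Qed.

Section RealSums.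
Variables (I : eqType) (s : seq I).
Implicit Types (P Q : pred I) (F G : I -> R).

Lemma sumR_le P F G : (forall i, i \in s -> P i -> F i <= G i) ->
  \sum_(i <- s | P i) F i <= \sum_(i <- s | P i) G i.
Proof.
move=> H; rewrite big_seq_cond [X in _ <= X]big_seq_cond.
by elim/big_ind2: _ => [|x y z t ? ?|i /andP[]]; [lra|lra|exact: H].
Qed.

Lemma sumR_ge0 P F : (forall i, i \in s -> P i -> 0 <= F i) -> 0 <= \sum_(i <- s | P i) F i.
Proof.
move=> H; rewrite big_seq_cond.
by elim/big_ind: _ => [|x y ? ?|i /andP[]]; [lra|lra|exact: H].
Qed.

Lemma sumR_abs P F : Rabs (\sum_(i <- s | P i) F i) <= \sum_(i <- s | P i) Rabs (F i).
Proof.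
elim/big_ind2: _ => [|x y z t ? ?|i _]; [rewrite Rabs_R0; lra| |lra].
have := Rabs_triang y t; have := Rabs_triang x z; lra.
Qed.

Lemma sumR_subset P Q F : (forall i, i \in s -> Q i -> 0 <= F i) ->
  (forall i, i \in s -> P i -> Q i) ->
  \sum_(i <- s | P i) F i <= \sum_(i <- s | Q i) F i.
Proof.
move=> F0 PQ; rewrite big_mkcond [X in _ <= X]big_mkcond.
apply: sumR_le => i si _; case Pi: (P i); case Qi: (Q i); try lra.
- by rewrite (PQ _ si Pi) in Qi.
- exact: F0.
Qed.

Lemma sumR_term P F i : (forall i, i \in s -> P i -> 0 <= F i) -> uniq s -> i \in s -> P i ->
  F i <= \sum_(i <- s | P i) F i.
Proof.
move=> F0 us si Pi; rewrite big_mkcond (bigD1_seq i) //= Pi.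
suff : 0 <= \sum_(j <- s | j != i) (if P j then F j else 0) by lra.
by apply: sumR_ge0 => j sj _; case: ifP => [|_]; [exact: F0|lra].
Qed.

Lemma prodR_gt0 P F : (forall i, i \in s -> P i -> 0 < F i) -> 0 < \prod_(i <- s | P i) F i.
Proof.
move=> H; rewrite big_seq_cond; elim/big_ind: _ => [|x y ? ?|i /andP[]]; [lra| |exact: H].
exact: Rmult_lt_0_compat.
Qed.

Lemma ln_prodR P F : (forall i, i \in s -> P i -> 0 < F i) ->
  ln (\prod_(i <- s | P i) F i) = \sum_(i <- s | P i) ln (F i).
Proof.
move=> H; rewrite big_seq_cond [RHS]big_seq_cond.
suff [] : 0 < \prod_(i <- s | (i \in s) && P i) F i /\
  ln (\prod_(i <- s | (i \in s) && P i) F i) = \sum_(i <- s | (i \in s) && P i) ln (F i) by [].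
elim/big_ind2: _ => [|x y z t [? <-] [? <-]|i /andP[] ? ?]; first by rewrite ln_1; lra.
  by split; [exact: Rmult_lt_0_compat|exact: ln_mult].
by split; [exact: H|].
Qed.

End RealSums.

Lemma INR_prod (I : Type) (s : seq I) P (F : I -> nat) :
  INR (\prod_(i <- s | P i) F i)%N = \prod_(i <- s | P i) INR (F i).
Proof. by rewrite (big_morph INR mult_INR INR_1). Qed.

Lemma leq_INR m n : (m <= n)%N -> INR m <= INR n.
Proof. by move=> ?; apply: le_INR; lia. Qed.

Lemma ltn_INR m n : (m < n)%N -> INR m < INR n.
Proof. by move=> ?; apply: lt_INR; lia. Qed.

Lemma INR_ge1 n : (0 < n)%N -> 1 <= INR n.
Proof. by move=> ?; rewrite -INR_1; apply: leq_INR. Qed.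

Lemma INR_gt0 n : (0 < n)%N -> 0 < INR n.
Proof. by move/INR_ge1; lra. Qed.

Lemma expn_INR m n : INR (m ^ n)%N = INR m ^ n.
Proof. by elim: n => [|n IH]; [rewrite INR_1|rewrite expnS mult_INR IH]. Qed.

Lemma Rinv_ge0 x : 0 < x -> 0 <= / x.
Proof. by move=> x0; apply: Rlt_le; exact: Rinv_0_lt_compat. Qed.

Lemma inv_INR_ge0 n : 0 <= / INR n.
Proof.
case: n => [|n]; first by rewrite INR_0 Rinv_0; lra.
by apply: Rinv_ge0; exact: INR_gt0.
Qed.

#[local] Hint Resolve inv_INR_ge0 : core.

Lemma ln_le_sub1 x : 0 < x -> ln x <= x - 1.
Proof. by move=> x0; have := exp_ineq1_le (ln x); rewrite exp_ln //; lra. Qed.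

Lemma ln_ge_sub1 x : 0 < x -> 1 - / x <= ln x.
Proof.
move=> x0; have := ln_le_sub1 (Rinv_0_lt_compat _ x0); rewrite ln_Rinv //; lra.
Qed.

Lemma ln_mono x y : 0 < x -> x <= y -> ln x <= ln y.
Proof. by move=> x0 [/(ln_increasing _ _ x0)|->]; lra. Qed.

Lemma ln_INR_ge0 n : 0 <= ln (INR n).
Proof.
case: n => [|n]; first by rewrite /ln; case: Rlt_dec => [H|_]; [case: (Rlt_irrefl _ H)|lra].
by have := @ln_mono 1 (INR n.+1); rewrite ln_1; apply; [lra|exact: INR_ge1].
Qed.

Lemma leq_ln_INR m n : (0 < m)%N -> (m <= n)%N -> ln (INR m) <= ln (INR n).
Proof. by move=> m0 mn; apply: ln_mono; [exact: INR_gt0|exact: leq_INR]. Qed.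

Lemma exp_mono x y : x <= y -> exp x <= exp y.
Proof. by case=> [/exp_increasing|->]; lra. Qed.

Lemma sumR_le_nat m n (P : pred nat) (F G : nat -> R) :
  (forall i, (m <= i)%N -> (i < n)%N -> P i -> F i <= G i) ->
  \sum_(m <= i < n | P i) F i <= \sum_(m <= i < n | P i) G i.
Proof. by move=> H; apply: sumR_le => i; rewrite mem_index_iota => /andP[]; exact: H. Qed.

Lemma sum_telescope (f : nat -> R) m n : (m <= n)%N ->
  \sum_(m <= i < n) (f i.+1 - f i) = f n - f m.
Proof.
move=> /subnK <-; elim: (n - m)%N => [|k IH]; first by rewrite add0n big_geq //; lra.
by rewrite addSn big_nat_recr ?leq_addl //= IH; lra.
Qed.

Lemma sum_split (f : nat -> R) (P : pred nat) m n p : (m <= n)%N -> (n <= p)%N ->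
  \sum_(m <= i < p | P i) f i = \sum_(m <= i < n | P i) f i + \sum_(n <= i < p | P i) f i.
Proof. by move=> mn np; rewrite (big_cat_nat mn np). Qed.

Lemma sum_shift (f : nat -> R) m n : \sum_(m <= i < m + n) f i = \sum_(0 <= i < n) f (m + i)%N.
Proof. by rewrite -{1}[m]add0n big_addn addKn; apply: eq_bigr => i _; rewrite addnC. Qed.

Lemma sum_range_le (f : nat -> R) (P : pred nat) m n m' n' : (m' <= m)%N -> (n <= n')%N ->
  (forall i, (m' <= i < n')%N -> P i -> 0 <= f i) ->
  \sum_(m <= i < n | P i) f i <= \sum_(m' <= i < n' | P i) f i.
Proof.
move=> mm nn f0; case: (leqP m n) => mn; last first.
  rewrite big_geq; last by apply: ltnW.
  by apply: sumR_ge0 => i; rewrite mem_index_iota; exact: f0.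
rewrite (sum_split f P mm (leq_trans mn nn)) (sum_split f P mn nn).
have : 0 <= \sum_(m' <= i < m | P i) f i.
  by apply: sumR_ge0 => i; rewrite mem_index_iota => ?; apply: f0; lia.
have : 0 <= \sum_(n <= i < n' | P i) f i.
  by apply: sumR_ge0 => i; rewrite mem_index_iota => ?; apply: f0; lia.
lra.
Qed.

(** * Summation by parts against periodic functions *)

Lemma abel_bound (w g : nat -> R) n B : (forall i, 0 <= w i) ->
  (forall i, (i < n)%N -> w i.+1 <= w i) ->
  (forall t, (t <= n.+1)%N -> Rabs (\sum_(0 <= i < t) g i) <= B) ->
  Rabs (\sum_(0 <= i < n.+1) (w i * g i)) <= B * w 0%N.
Proof.
move=> w0 wd HB.
have E k : \sum_(0 <= i < k.+1) (w i * g i) =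
   \sum_(0 <= i < k) ((w i - w i.+1) * \sum_(0 <= j < i.+1) g j) +
   w k * \sum_(0 <= j < k.+1) g j.
  elim: k => [|k IH]; first by rewrite !big_nat1 big_geq //; lra.
  rewrite big_nat_recr //= IH [X in _ = X + _]big_nat_recr //=.
  rewrite (big_nat_recr k.+1) //=; lra.
rewrite E; apply: Rle_trans (Rabs_triang _ _) _.
have H1 : Rabs (\sum_(0 <= i < n) ((w i - w i.+1) * \sum_(0 <= j < i.+1) g j)) <=
   B * (w 0%N - w n).
  apply: Rle_trans (sumR_abs _ _ _) _.
  have -> : w 0%N - w n = \sum_(0 <= i < n) (w i - w i.+1).
    rewrite -[RHS]Ropp_involutive -sumR_opp.
    rewrite (eq_bigr (fun i => w i.+1 - w i)) => [|i _]; last lra.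
    by rewrite sum_telescope //; lra.
  rewrite -sumR_scal; apply: sumR_le_nat => i _ ni _.
  have := wd _ ni; have := HB i.+1 (ltnW ni : (i.+1 <= n.+1)%N) => h1 h2.
  rewrite Rabs_mult Rabs_pos_eq; last lra.
  by rewrite Rmult_comm; apply: Rmult_le_compat_r; lra.
have H2 : Rabs (w n * \sum_(0 <= j < n.+1) g j) <= B * w n.
  rewrite Rabs_mult Rabs_pos_eq // Rmult_comm.
  exact: Rmult_le_compat_r (w0 n) (HB _ (leqnn _)).
lra.
Qed.

Lemma sum_residues (phi : nat -> R) q b e : (0 < q)%N -> coprime b q ->
  (forall n, phi (n %% q)%N = phi n) ->
  \sum_(0 <= i < q) phi (b * i + e)%N = \sum_(0 <= i < q) phi i.
Proof.
case: q => // q _ cbq per; rewrite !big_mkord.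
pose h (i : 'I_q.+1) : 'I_q.+1 := Ordinal (ltn_pmod (b * i + e) (ltn0Sn q)).
have hI : injective h.
  move=> i j /(congr1 val) /= /eqP; rewrite eqn_modDr.
  wlog ij : i j / (j <= i)%N => [W|].
    case: (leqP j i) => [|/ltnW] H; first exact: W.
    by rewrite eq_sym => /(W _ _ H).
  rewrite eqn_mod_dvd ?leq_mul2l ?ij ?orbT // -mulnBr Gauss_dvdr; last by rewrite coprime_sym.
  move=> d; apply: val_inj => /=; have := ltn_ord i.
  by case: (posnP (i - j)) d => [|H /dvdn_leq -/(_ H)]; lia.
rewrite [RHS](reindex_inj hI) /=; apply: eq_bigr => i _.
by rewrite per.
Qed.

Section Periodic.
Variables (g : nat -> R) (q : nat).
Hypotheses (q0 : (0 < q)%N) (per : forall n, g (n %% q)%N = g n).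

Lemma sum_period_shift K : \sum_(0 <= i < q) g (K + i)%N = \sum_(0 <= i < q) g i.
Proof.
rewrite -[RHS](@sum_residues g q 1 K) ?coprime1n //.
by apply: eq_bigr => i _; rewrite mul1n addnC.
Qed.

Lemma sum_periods K k : \sum_(0 <= i < k * q) g (K + i)%N = INR k * \sum_(0 <= i < q) g i.
Proof.
elim: k => [|k IH]; first by rewrite mul0n big_geq // INR_0; lra.
rewrite mulSn addnC (@sum_split _ _ _ (k * q)) ?leq_addr // IH (sum_shift _ (k * q)) S_INR.
under [X in _ + X = _]eq_bigr do rewrite addnA.
by rewrite sum_period_shift; lra.
Qed.

Lemma periodic_partial_sums K n : \sum_(0 <= i < q) g i = 0 ->
  Rabs (\sum_(0 <= i < n) g (K + i)%N) <= \sum_(0 <= i < q) Rabs (g i).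
Proof.
move=> g0; rewrite (divn_eq n q) (@sum_split _ _ _ (n %/ q * q)) ?leq_addr // sum_periods g0.
rewrite Rmult_0_r Rplus_0_l (sum_shift _ (n %/ q * q)); apply: Rle_trans (sumR_abs _ _ _) _.
set K' := (K + n %/ q * q)%N.
have -> : \sum_(0 <= i < q) Rabs (g i) = \sum_(0 <= i < q) Rabs (g (K' + i)%N).
  rewrite -(@sum_residues (fun n => Rabs (g n)) q 1 K') ?coprime1n //; last by move=> m; rewrite per.
  by apply: eq_bigr => i _; rewrite mul1n addnC.
under [X in X <= _]eq_bigr do rewrite addnA.
apply: sum_range_le => //; first by rewrite ltnW // ltn_pmod.
by move=> i _ _; exact: Rabs_pos.
Qed.

(** Zero mean over a period bounds every partial sum by one period of absolute values, so Abel
    summation leaves only the first weight, however long the range. The type I sums and the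
    correlations in the large sieve both rest on this. *)
Lemma periodic_weighted (w : nat -> R) K N : (forall i, 0 <= w i) ->
  (forall i, (K < i)%N -> (i < N)%N -> w i.+1 <= w i) ->
  \sum_(0 <= i < q) g i = 0 ->
  Rabs (\sum_(K.+1 <= i < N.+1) (w i * g i)) <= w K.+1 * \sum_(0 <= i < q) Rabs (g i).
Proof.
move=> w0 wd g0; case: (leqP N K) => NK.
  rewrite big_geq // Rabs_R0; apply: Rmult_le_pos => //.
  by apply: sumR_ge0 => *; exact: Rabs_pos.
have [n E] : exists n, N = (K + n.+1)%N by exists (N - K.+1)%N; lia.
move: wd; rewrite E => wd.
rewrite -addSn (sum_shift _ K.+1) Rmult_comm.
have := @abel_bound (fun i => w (K.+1 + i)%N) (fun i => g (K.+1 + i)%N) n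
  (\sum_(0 <= i < q) Rabs (g i)); rewrite addn0; apply.
- by move=> i.
- by move=> i ni; rewrite addnS; apply: wd; lia.
- by move=> t _; exact: periodic_partial_sums.
Qed.

End Periodic.

(** * The von Mangoldt and Moebius functions *)

Lemma sum_multiples (F : nat -> R) m X : (0 < m)%N ->
  \sum_(1 <= n < X.+1 | (m %| n)%N) F n = \sum_(1 <= k < X.+1 | (m * k <= X)%N) F (m * k)%N.
Proof.
move=> m0; pose G n k := if n == (m * k)%N then F n else 0.
transitivity (\sum_(1 <= n < X.+1) \sum_(1 <= k < X.+1) G n k).
  rewrite big_mkcond; apply: eq_big_nat => n /andP[n1 nX].
  rewrite -big_mkcond /=; case: ifP => [/dvdnP[q E]|d].
    rewrite (eq_bigl (fun k => k == q)) => [|k]; last first.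
      by rewrite E mulnC eqn_pmul2l // eq_sym.
    rewrite big_nat1_eq; suff -> : (1 <= q < X.+1)%N by [].
    by move: n1 nX; rewrite E; nia.
  rewrite big1 // => k /eqP E; by rewrite E dvdn_mulr in d.
rewrite exchange_big /= [RHS]big_mkcond; apply: eq_big_nat => k /andP[k1 _].
rewrite -big_mkcond big_nat1_eq ltnS muln_gt0 m0 k1 /=; by case: ifP.
Qed.

Lemma dirichlet_sum (g F : nat -> R) X : (forall n, (X < n)%N -> F n = 0) ->
  \sum_(1 <= m < X.+1) \sum_(1 <= k < X.+1) (g m * F (m * k)%N) =
  \sum_(1 <= n < X.+1) (F n * \sum_(1 <= m < X.+1 | (m %| n)%N) g m).
Proof.
move=> F0.
transitivity (\sum_(1 <= m < X.+1) \sum_(1 <= n < X.+1 | (m %| n)%N) (g m * F n)).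
  apply: eq_big_nat => m /andP[m1 _]; rewrite sum_multiples // [RHS]big_mkcond.
  by apply: eq_bigr => k _; case: leqP => // /F0 ->; lra.
under eq_bigr do rewrite big_mkcond.
rewrite exchange_big /=; apply: eq_bigr => n _.
rewrite big_distrr [RHS]big_mkcond /=; apply: eq_bigr => m _.
by case: ifP => _; rewrite // Rmult_comm.
Qed.

Definition mangoldt n : R := if size (primes n) == 1%N then ln (INR (pdiv n)) else 0.

Definition mobius n : R :=
  if (0 < n)%N && all (fun p => logn p n == 1%N) (primes n) then (- 1) ^ size (primes n) else 0.

Lemma mangoldt_ge0 n : 0 <= mangoldt n.
Proof. by rewrite /mangoldt; case: ifP => _; [exact: ln_INR_ge0|lra]. Qed.

Lemma mangoldt1 : mangoldt 1 = 0.
Proof. by []. Qed.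

Lemma mangoldt_pow p k : prime p -> (0 < k)%N -> mangoldt (p ^ k) = ln (INR p).
Proof.
move=> pp k0; rewrite /mangoldt primesX // (primes_prime pp) /=.
by rewrite /pdiv primesX // (primes_prime pp).
Qed.

Lemma mangoldt_neq0 n : mangoldt n <> 0 ->
  exists p k, [/\ prime p, (0 < k)%N & n = (p ^ k)%N].
Proof.
rewrite /mangoldt; case: ifP => // /eqP s1 _.
case: n s1 => // n s1.
have pp : prime (pdiv n.+1) by apply: pdiv_prime; case: n s1.
exists (pdiv n.+1), (logn (pdiv n.+1) n.+1); split=> //.
  by rewrite logn_gt0 mem_primes pp pdiv_dvd.
rewrite [LHS]prod_prime_decomp // prime_decompE big_map /=.
by move: s1; rewrite /pdiv; case: (primes n.+1) => // p [] // _; rewrite big_seq1.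
Qed.

(** Induction on n by removing its least prime p: the divisors of n = pm that do not divide m carry
    the full power of p, and the only prime power among them is that power itself, which contributes
    ln p. *)
Lemma mangoldt_sum n X : (0 < n)%N -> (n <= X)%N ->
  \sum_(1 <= d < X.+1 | (d %| n)%N) mangoldt d = ln (INR n).
Proof.
elim/ltn_ind: n => n IH n0 nX; case: (leqP n 1) => n1.
  have -> : n = 1%N by lia.
  by rewrite (eq_bigl _ _ dvdn1) big_nat1_eq mangoldt1 ln_1; case: ifP.
have pp := pdiv_prime n1; case/dvdnP: (pdiv_dvd n) => m.
move: (pdiv n) pp => p pp E.
have m0 : (0 < m)%N by move: n0; rewrite E; case: (m).
have p1 := prime_gt1 pp.
have mn : (m < n)%N by rewrite E -[X in (X < _)%N]muln1 ltn_pmul2l.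
have mX := leq_trans (ltnW mn) nX.
rewrite (bigID (fun d => d %| m)) /=.
rewrite (eq_bigl (fun d => d %| m)) => [|d]; last first.
  by case: (boolP (d %| m)) => dm; rewrite ?andbF // andbT E dvdn_mulr.
rewrite IH // E mult_INR ln_mult; [|exact: INR_gt0|exact: INR_gt0 (prime_gt0 pp)].
congr (_ + _); set v := logn p n.
have v0 : (0 < v)%N by rewrite /v logn_gt0 mem_primes pp n0 E dvdn_mull.
have vE : v = (logn p m).+1 by rewrite /v E lognM // ?prime_gt0 // (logn_prime _ pp) eqxx addn1.
have dn : (p ^ v %| n)%N by apply: pfactor_dvdnn.
rewrite big_mkcond (bigD1_seq (p ^ v)%N) ?iota_uniq //=; last first.
  rewrite mem_index_iota expn_gt0 prime_gt0 //= ltnS; apply: leq_trans nX.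
  exact: dvdn_leq.
rewrite big1 ?Rplus_0_r => [|d dv].
  by rewrite -E dn pfactor_dvdn // vE ltnn -vE mangoldt_pow.
case: ifP => // /andP[dn' dm].
case: (Req_dec (mangoldt d) 0) => // /mangoldt_neq0[q [k [pq k0 dE]]].
exfalso; move: dv dn' dm; rewrite {}dE -E !pfactor_dvdn //.
rewrite E lognM // ?prime_gt0 // (logn_prime _ pp).
case: (eqVneq q p) => [->|_]; last by rewrite addn0 => _ ->.
by rewrite addn1 -vE -ltnNge => nq kv vk; case/eqP: nq; congr (_ ^ _)%N; lia.
Qed.

Lemma mangoldt_le n : (0 < n)%N -> mangoldt n <= ln (INR n).
Proof.
move=> n0; rewrite -(mangoldt_sum n0 (leqnn n)).
apply: (sumR_term (P := fun d => d %| n)) => //; rewrite ?iota_uniq ?mem_index_iota ?n0 ?ltnSn //.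
by move=> i _ _; exact: mangoldt_ge0.
Qed.

Lemma mobius_abs n : Rabs (mobius n) <= 1.
Proof.
rewrite /mobius; case: ifP => _; last by rewrite Rabs_R0; lra.
by rewrite -RPow_abs Rabs_Ropp Rabs_R1 pow1; lra.
Qed.

Lemma mobius_mul p e : prime p -> (0 < e)%N ->
  mobius (p * e) = if (p %| e)%N then 0 else - mobius e.
Proof.
move=> pp e0; have p0 := prime_gt0 pp; rewrite /mobius muln_gt0 p0 e0 /=.
have lE q : prime q -> logn q (p * e) = ((q == p) + logn q e)%N.
  by move=> pq; rewrite lognM // logn_prime.
case pe: (p %| e)%N.
  case: ifP => // /allP/(_ p); rewrite mem_primes pp muln_gt0 p0 e0 dvdn_mulr // => /(_ isT).
  rewrite lE // eqxx => /eqP[] /eqP; rewrite -leqn0 leqNgt logn_gt0 mem_primes pp e0 pe //.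
have pP : perm_eq (primes (p * e)) (p :: primes e).
  apply: uniq_perm; rewrite /= ?primes_uniq // ?mem_primes ?pe ?andbF // => q.
  by rewrite primesM // inE primes_prime // inE.
have pnot : p \notin primes e by rewrite mem_primes pe !andbF.
rewrite (perm_all _ pP) (perm_size pP) /= lE // eqxx (_ : logn p e = 0%N) /=; last first.
  by apply/eqP; rewrite -leqn0 leqNgt logn_gt0.
have -> : all (fun q => logn q (p * e) == 1%N) (primes e) = all (fun q => logn q e == 1%N) (primes e).
  apply: eq_in_all => q qe; rewrite lE; last by move: qe; rewrite mem_primes => /and3P[].
  by case: (eqVneq q p) => // E; rewrite -E qe in pnot.
case: ifP => _; rewrite -?tech_pow_Rmult; lra.
Qed.

(** With p the least prime of n, the multiples of p among the divisors are written pe. The terms at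
    e and pe cancel when p does not divide e, and the term at pe vanishes otherwise. *)
Lemma mobius_sum n X : (0 < n)%N -> (n <= X)%N ->
  \sum_(1 <= d < X.+1 | (d %| n)%N) mobius d = if n == 1%N then 1 else 0.
Proof.
move=> n0 nX; case: eqP => [->|n1].
  by rewrite (eq_bigl _ _ dvdn1) big_nat1_eq /mobius /=; move: (leq_trans n0 nX); case: (X).
have pp : prime (pdiv n) by apply: pdiv_prime; lia.
have pn := pdiv_dvd n; set p := pdiv n in pp pn; have p0 := prime_gt0 pp.
rewrite (bigID (fun d => p %| d)) /= [X in X + _]big_mkcondl /=.
rewrite (@sum_multiples (fun d => if d %| n then mobius d else 0) p X p0).
rewrite [X in X + _]big_mkcond [X in _ + X]big_mkcond -big_split /=.
rewrite big_nat big1 // => e /andP[e1 eX].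
rewrite mobius_mul //; case: (boolP (p %| e)%N) => pe; first by rewrite andbF; do 2?case: ifP => _; lra.
have -> : (p * e %| n) = (e %| n).
  by rewrite Gauss_dvd ?pn // prime_coprime.
case: (boolP (e %| n)) => en /=; last by case: ifP => _; lra.
suff -> : (p * e <= X)%N by lra.
by apply: leq_trans nX; apply: dvdn_leq => //; rewrite Gauss_dvd ?pn // prime_coprime.
Qed.

(** * An elementary large sieve for prime moduli *)

Section ResidueClasses.
Variable X : nat.
Implicit Types (f g : nat -> R) (r : nat).

Definition class_sum f r b := \sum_(1 <= n < X.+1 | (n %% r == b)%N) f n.

(** By Parseval, r times this is the classical large sieve quantity: the sum over 0 < a < r of the
    squared modulus of the exponential sum of f at a/r. *)
Definition class_var f r :=
  \sum_(0 <= b < r) (class_sum f r b - (\sum_(1 <= n < X.+1) f n) / INR r) ^ 2.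

Lemma sum_by_class f r (phi : nat -> R) : (0 < r)%N -> (forall n, phi (n %% r)%N = phi n) ->
  \sum_(1 <= n < X.+1) (f n * phi n) = \sum_(0 <= b < r) (class_sum f r b * phi b).
Proof.
move=> r0 per.
transitivity (\sum_(0 <= b < r) \sum_(1 <= n < X.+1 | (n %% r == b)%N) (f n * phi n)).
  under [RHS]eq_bigr do rewrite big_mkcond.
  rewrite exchange_big /=; apply: eq_bigr => n _.
  rewrite -big_mkcond (eq_bigl (fun b => b == n %% r)%N) => [|b]; last by rewrite eq_sym.
  by rewrite big_nat1_eq /= ltn_pmod.
apply: eq_bigr => b _; rewrite /class_sum big_distrl /=.
by apply: eq_bigr => n /eqP <-; rewrite per.
Qed.

Lemma class_var_ge0 f r : 0 <= class_var f r.
Proof. by apply: sumR_ge0 => i _ _; exact: pow2_ge_0. Qed.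

Lemma sum_class_dev f r : (0 < r)%N ->
  \sum_(0 <= b < r) (class_sum f r b - (\sum_(1 <= n < X.+1) f n) / INR r) = 0.
Proof.
move=> r0; rewrite sumR_sub sumR_const count_predT size_iota subn0.
have := @sum_by_class f r (fun _ => 1) r0 (fun _ => erefl).
rewrite -!big_distrl /= !Rmult_1_r => ->.
by field; have := INR_gt0 r0; lra.
Qed.

Section TypeII.
Variables (r : nat) (chi : nat -> R).
Hypotheses (r0 : (0 < r)%N) (per : forall n, chi (n %% r)%N = chi n).
Hypothesis chi_sum : forall b, \sum_(0 <= c < r) chi (b * c)%N = 0.
Hypothesis chi_abs : forall b, \sum_(0 <= c < r) Rabs (chi (b * c)%N) <= 2.

(** [chi] has zero sum in each variable, so the class sums of f and g may be replaced by their
    deviations from the mean. Then |xy| <= x^2/2 + y^2/2, with absolute row and column sums at most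
    2, leaves the two variances. The fixed factor k is harmless because the hypotheses on [chi] hold
    for every multiplier. *)
Lemma bilinear_bound f g k :
  Rabs (\sum_(1 <= d < X.+1) \sum_(1 <= m < X.+1) (f d * g m * chi (d * m * k)%N)) <=
  class_var f r + class_var g r.
Proof.
have chi_mod n z : chi (n %% r * z)%N = chi (n * z)%N by rewrite -per modnMml per.
pose A := (\sum_(1 <= n < X.+1) f n) / INR r; pose B := (\sum_(1 <= n < X.+1) g n) / INR r.
pose x b := class_sum f r b - A; pose y c := class_sum g r c - B.
have chi_sum' c : \sum_(0 <= b < r) chi (b * c * k)%N = 0.
  rewrite -[RHS](chi_sum (c * k)); apply: eq_bigr => b _; congr (chi _); lia.
have chi_sum'' b : \sum_(0 <= c < r) chi (b * c * k)%N = 0.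
  rewrite -[RHS](chi_sum (b * k)); apply: eq_bigr => c _; congr (chi _); lia.
have chi_abs' c : \sum_(0 <= b < r) Rabs (chi (b * c * k)%N) <= 2.
  apply: Rle_trans (chi_abs (c * k)); right.
  by apply: eq_bigr => b _; congr (Rabs (chi _)); lia.
have chi_abs'' b : \sum_(0 <= c < r) Rabs (chi (b * c * k)%N) <= 2.
  apply: Rle_trans (chi_abs (b * k)); right.
  by apply: eq_bigr => c _; congr (Rabs (chi _)); lia.
have -> : \sum_(1 <= d < X.+1) \sum_(1 <= m < X.+1) (f d * g m * chi (d * m * k)%N) =
   \sum_(0 <= b < r) \sum_(0 <= c < r) (x b * y c * chi (b * c * k)%N).
  transitivity (\sum_(0 <= b < r) \sum_(0 <= c < r)
     (class_sum f r b * class_sum g r c * chi (b * c * k)%N)).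
    transitivity (\sum_(1 <= d < X.+1) (f d *
        \sum_(0 <= c < r) (class_sum g r c * chi (d * c * k)%N))).
      apply: eq_bigr => d _; rewrite -(@sum_by_class g r (fun m => chi (d * m * k)%N)) //.
        by rewrite big_distrr; apply: eq_bigr => m _ /=; lra.
      by move=> n; rewrite !(mulnC d) -!mulnA chi_mod.
    rewrite (@sum_by_class f r
       (fun d => \sum_(0 <= c < r) (class_sum g r c * chi (d * c * k)%N))) //.
      by apply: eq_bigr => b _; rewrite big_distrr; apply: eq_bigr => c _ /=; lra.
    move=> n; apply: eq_bigr => c _; congr (_ * _).
    by rewrite -!mulnA chi_mod.
  transitivity (\sum_(0 <= b < r) (\sum_(0 <= c < r) (x b * y c * chi (b * c * k)%N)
     + B * class_sum f r b * \sum_(0 <= c < r) chi (b * c * k)%N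
     + A * \sum_(0 <= c < r) (y c * chi (b * c * k)%N))).
    apply: eq_bigr => b _; rewrite !big_distrr -!big_split /=.
    by apply: eq_bigr => c _; rewrite -big_distrr -/(class_sum f r b) /x /y /=; ring.
  rewrite big_split /= [X in _ + X = _]sumR_scal exchange_big /=.
  under [X in _ + A * X]eq_bigr do rewrite -big_distrr chi_sum' /= Rmult_0_r.
  rewrite [X in _ + A * X]big1 // Rmult_0_r Rplus_0_r.
  apply: eq_bigr => b _; rewrite chi_sum''; lra.
apply: Rle_trans (sumR_abs _ _ _) _.
apply: (Rle_trans _ (\sum_(0 <= b < r) \sum_(0 <= c < r)
    ((x b ^ 2 / 2 + y c ^ 2 / 2) * Rabs (chi (b * c * k)%N)))).
  apply: sumR_le => b _ _; apply: Rle_trans (sumR_abs _ _ _) _.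
  apply: sumR_le => c _ _; rewrite Rabs_mult; apply: Rmult_le_compat_r; first exact: Rabs_pos.
  rewrite Rabs_mult -(Rsqr_pow2 (x b)) -(Rsqr_pow2 (y c)) (Rsqr_abs (x b)) (Rsqr_abs (y c)) /Rsqr.
  have := pow2_ge_0 (Rabs (x b) - Rabs (y c)); lra.
under eq_bigr do under eq_bigr do rewrite Rmult_plus_distr_r.
under eq_bigr do rewrite big_split /=.
rewrite big_split /=; apply: Rplus_le_compat.
  apply: sumR_le => b _ _; rewrite -big_distrr /= -/(x b).
  by have := chi_abs'' b; have := pow2_ge_0 (x b); nra.
rewrite exchange_big /=; apply: sumR_le => c _ _; rewrite -big_distrr /= -/(y c).
by have := chi_abs' c; have := pow2_ge_0 (y c); nra.
Qed.

End TypeII.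

Section LargeSieve.
Variables (s : seq nat) (T U : nat) (w c : nat -> R).
Hypotheses (us : uniq s) (sP : forall r, r \in s -> prime r && (r <= T)%N) (sT : (size s <= T)%N).
Hypotheses (w0 : forall n, 0 <= w n)
  (wd : forall n, (U < n)%N -> (n < X)%N -> w n.+1 <= w n)
  (wT : w U.+1 * (2 * INR T + INR T ^ 3) <= 1).
Hypothesis c0 : forall n, (n <= U)%N -> c n = 0.

Let f n := w n * c n.
Let mean r := (\sum_(1 <= n < X.+1) f n) / INR r.
Let h r n := INR r * (class_sum f r (n %% r)%N - mean r).
Let D r := INR r * class_var f r.
Let W := \sum_(1 <= n < X.+1) w n.

Let s_gt0 r : r \in s -> (0 < r)%N.
Proof. by case/sP/andP => /prime_gt0. Qed.

Let W_ge0 : 0 <= W.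
Proof. exact: sumR_ge0. Qed.

Let D_ge0 r : 0 <= D r.
Proof. by apply: Rmult_le_pos; [exact: pos_INR|exact: class_var_ge0]. Qed.

Let h_per r n : h r (n %% r)%N = h r n.
Proof. by rewrite /h modn_mod. Qed.

Let h_sum0 r : (0 < r)%N -> \sum_(0 <= i < r) h r i = 0.
Proof.
move=> r0; rewrite /h sumR_scal.
have := sum_class_dev f r0; rewrite -/(mean r) => E.
rewrite (_ : \sum_(0 <= i < r) _ = 0) ?Rmult_0_r // -[RHS]E.
by apply: eq_big_nat => i /andP[_ ir]; rewrite modn_small.
Qed.

Let h_sum2 r : (0 < r)%N -> \sum_(0 <= i < r) h r i ^ 2 = INR r * D r.
Proof.
move=> r0; rewrite /D /class_var -Rmult_assoc -sumR_scal; apply: eq_big_nat => i /andP[_ ir].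
by rewrite /h modn_small // Rpow_mult_distr /mean; ring.
Qed.

Let D_sum r : (0 < r)%N -> D r = \sum_(1 <= n < X.+1) (f n * h r n).
Proof.
move=> r0; rewrite (sum_by_class f r0 (h_per r)) /D /class_var -sumR_scal.
have := h_sum0 r0; move/(congr1 (Rmult (mean r))); rewrite Rmult_0_r -sumR_scal => E.
transitivity (\sum_(0 <= b < r) (class_sum f r b * h r b)
  - \sum_(0 <= i < r) (mean r * h r i)); last by rewrite E Rminus_0_r.
rewrite -sumR_sub; apply: eq_big_nat => i /andP[_ ir].
by rewrite /h modn_small // /mean; ring.
Qed.

Let sum_grid (F : nat -> R) r r' :
  \sum_(0 <= n < r * r') F n = \sum_(0 <= i < r) \sum_(0 <= j < r') F (r * j + i)%N.
Proof.
rewrite exchange_big /=; elim: r' => [|k IH]; first by rewrite muln0 !big_geq.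
rewrite mulnS addnC (@sum_split _ _ _ (r * k)) ?leq_addr // IH big_nat_recr //=.
by congr (_ + _); rewrite (sum_shift _ (r * k)).
Qed.

(** [h r] has period r, mean 0 and mean square [D r]. The diagonal therefore gives W times [D r], up
    to a boundary term. For distinct primes the product has mean zero over the period r r', by the
    Chinese remainder theorem, so only the boundary weight times an absolute sum over one period
    survives. *)
Let cross r r' : r \in s -> r' \in s ->
  \sum_(U.+1 <= n < X.+1) (w n * (h r n * h r' n)) <=
  (if r == r' then (W + w U.+1 * (2 * INR T)) * D r else 0)
  + w U.+1 * INR T ^ 2 * ((D r + D r') / 2).
Proof.
move=> sr sr'; have r0 := s_gt0 sr; have r0' := s_gt0 sr'.
have [pr rT] := andP (sP sr); have [pr' rT'] := andP (sP sr').
have wU := w0 U.+1; have T0 : 0 <= INR T by exact: pos_INR.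
have Dr := D_ge0 r; have Dr' := D_ge0 r'.
have rT1 := leq_INR rT; have rT1' := leq_INR rT'.
have P1 := pos_INR r; have P1' := pos_INR r'.
case: eqP => [E|/eqP ne].
  rewrite -{}E in sr' r0' pr' rT' Dr' rT1' P1' *.
  pose g n := h r n * h r n - D r.
  have gper n : g (n %% r)%N = g n by rewrite /g h_per.
  have g0 : \sum_(0 <= i < r) g i = 0.
    rewrite sumR_sub sumR_const count_predT size_iota subn0.
    rewrite (eq_bigr (fun i => h r i ^ 2)) => [|i _]; last by ring.
    by rewrite h_sum2 //; lra.
  have gabs : \sum_(0 <= i < r) Rabs (g i) <= 2 * INR T * D r.
    apply: (Rle_trans _ (\sum_(0 <= i < r) (h r i ^ 2 + D r))).
      apply: sumR_le => i _ _; apply: Rle_trans (Rabs_triang _ _) _.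
      rewrite Rabs_Ropp (Rabs_pos_eq (D r)) // Rabs_pos_eq; first by right; ring.
      by have := pow2_ge_0 (h r i); rewrite -Rsqr_pow2 /Rsqr.
    rewrite big_split /= h_sum2 // sumR_const count_predT size_iota subn0.
    by nra.
  have := periodic_weighted r0 gper w0 (K := U) (N := X) wd g0.
  move/Rabs_le_between => [_ B1].
  have -> : \sum_(U.+1 <= n < X.+1) (w n * (h r n * h r n)) =
    \sum_(U.+1 <= n < X.+1) (w n * g n) + D r * \sum_(U.+1 <= n < X.+1) w n.
    rewrite -sumR_scal -big_split /=; apply: eq_bigr => n _; rewrite /g; ring.
  have WU : \sum_(U.+1 <= n < X.+1) w n <= W.
    by apply: (@sum_range_le w predT) => //.
  have H1 := Rmult_le_compat_l _ _ _ wU gabs.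
  have H2 := Rmult_le_compat_l _ _ _ Dr WU.
  have H3 : 0 <= w U.+1 * INR T ^ 2 * ((D r + D r) / 2).
    by apply: Rmult_le_pos; [apply: Rmult_le_pos; [|apply: pow2_ge_0]|lra].
  lra.
pose g n := h r n * h r' n.
have q0 : (0 < r * r')%N by rewrite muln_gt0 r0.
have gper n : g (n %% (r * r'))%N = g n.
  rewrite /g -[in RHS](h_per r) -[in RHS](h_per r').
  by rewrite -(modn_dvdm n (dvdn_mulr r' (dvdnn r))) -(modn_dvdm n (dvdn_mull r (dvdnn r'))) !h_per.
(* At r j + i the first factor depends on i alone, while j moves the second through all residues
   modulo r'. *)
have g0 : \sum_(0 <= i < r * r') g i = 0.
  rewrite sum_grid big1 // => i _; rewrite /g.
  rewrite (eq_bigr (fun j => h r i * h r' (r * j + i)%N)) => [|j _]; last first.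
    by rewrite -(h_per r (r * j + i)) mulnC modnMDl h_per.
  rewrite sumR_scal (sum_residues (phi := h r')) // ?h_sum0 ?Rmult_0_r //.
  by rewrite prime_coprime // dvdn_prime2 // ne.
have period2 a b : (0 < a)%N -> (0 < b)%N ->
    \sum_(0 <= i < b * a) h a i ^ 2 = INR b * (INR a * D a).
  move=> a0 b0; rewrite -h_sum2 //; have := @sum_periods (fun n => h a n ^ 2) a a0 _ 0 b.
  by apply=> n; rewrite h_per.
have gabs : \sum_(0 <= i < r * r') Rabs (g i) <= INR T ^ 2 * ((D r + D r') / 2).
  apply: (Rle_trans _ (\sum_(0 <= i < r * r') (h r i ^ 2 / 2 + h r' i ^ 2 / 2))).
    apply: sumR_le => i _ _; rewrite Rabs_mult.
    rewrite -(Rsqr_pow2 (h r i)) -(Rsqr_pow2 (h r' i)) (Rsqr_abs (h r i)) (Rsqr_abs (h r' i)) /Rsqr.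
    have := pow2_ge_0 (Rabs (h r i) - Rabs (h r' i)); lra.
  rewrite big_split /= -!big_distrl /=.
  rewrite -/(h r _ ^ 2).
  rewrite period2 // mulnC period2 //.
  have : INR r * INR r' <= INR T ^ 2 by nra.
  nra.
have := periodic_weighted q0 gper w0 (K := U) (N := X) wd g0.
move/Rabs_le_between => [_ B1].
have H1 := Rmult_le_compat_l _ _ _ wU gabs.
rewrite Rplus_0_l; apply: Rle_trans B1 _; lra.
Qed.

(** Duality: the left side is the pairing of f with H, the sum of all [h r], and [cross] bounds the
    weighted square sum of H by t = W + 1 times the same left side. From 2ab <= t a^2 + b^2 / t one
    copy of the left side is absorbed. Because c vanishes up to U, correlations are needed only
    beyond U, where [wT] makes the boundary terms cost at most 1 in t. *)
Lemma large_sieve :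
  \sum_(r <- s) (INR r * class_var f r) <= (W + 1) * \sum_(1 <= n < X.+1) (w n * c n ^ 2).
Proof.
rewrite -/(D _); pose t := W + 1; have t1 : 1 <= t by rewrite /t; have := W_ge0; lra.
pose H n := \sum_(r <- s) h r n; pose S := \sum_(1 <= n < X.+1) (w n * c n ^ 2).
set DD := \sum_(r <- s) D r.
have DE : DD = \sum_(1 <= n < X.+1) (f n * H n).
  rewrite /DD (eq_big_seq (fun r => \sum_(1 <= n < X.+1) (f n * h r n))) => [|r sr]; last first.
    by rewrite D_sum // s_gt0.
  by rewrite exchange_big; apply: eq_bigr => n _; rewrite /H sumR_scal.
have H2 : \sum_(U.+1 <= n < X.+1) (w n * H n ^ 2) <= t * DD.
  have -> : \sum_(U.+1 <= n < X.+1) (w n * H n ^ 2) =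
    \sum_(r <- s) \sum_(r' <- s) \sum_(U.+1 <= n < X.+1) (w n * (h r n * h r' n)).
    under [RHS]eq_bigr do rewrite exchange_big /=.
    rewrite exchange_big /=; apply: eq_bigr => n _.
    under [RHS]eq_bigr do rewrite !sumR_scal.
    rewrite sumR_scal -big_distrl /= -/(H n); ring.
  apply: (Rle_trans _ (\sum_(r <- s) \sum_(r' <- s)
    ((if r == r' then (W + w U.+1 * (2 * INR T)) * D r else 0)
     + w U.+1 * INR T ^ 2 * ((D r + D r') / 2)))).
    by apply: sumR_le => r sr _; apply: sumR_le => r' sr' _; exact: cross.
  under eq_bigr do rewrite big_split /= sumR_scal.
  rewrite big_split /= sumR_scal.
  have -> : \sum_(r <- s) \sum_(r' <- s)
     (if r == r' then (W + w U.+1 * (2 * INR T)) * D r else 0) =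
     (W + w U.+1 * (2 * INR T)) * DD.
    rewrite /DD -sumR_scal; apply: eq_big_seq => r sr.
    rewrite (bigD1_seq r) //= eqxx big1 ?Rplus_0_r // => r'.
    by rewrite eq_sym => /negPf ->.
  have -> : \sum_(r <- s) \sum_(r' <- s) ((D r + D r') / 2) = INR (size s) * DD.
    transitivity (\sum_(r <- s) (INR (size s) / 2 * D r + DD / 2)).
      apply: eq_bigr => r _; rewrite -big_distrl big_split /= sumR_const count_predT -/DD; lra.
    rewrite big_split /= sumR_const count_predT sumR_scal -/DD; lra.
  have DD0 : 0 <= DD by apply: sumR_ge0.
  have sT' := leq_INR sT; have T0 := pos_INR T; have wU := w0 U.+1.
  have : w U.+1 * INR T ^ 2 * (INR (size s) * DD) <= w U.+1 * INR T ^ 3 * DD.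
    have -> : w U.+1 * INR T ^ 3 * DD = w U.+1 * INR T ^ 2 * (INR T * DD) by ring.
    apply: Rmult_le_compat_l; first by apply: Rmult_le_pos => //; exact: pow2_ge_0.
    exact: Rmult_le_compat_r.
  have := Rmult_le_compat_r _ _ _ DD0 wT; rewrite /t; lra.
have : 2 * DD <= t * S + / t * \sum_(U.+1 <= n < X.+1) (w n * H n ^ 2).
  rewrite DE -!sumR_scal.
  rewrite (@big_nat_widenl _ _ _ U.+1 1) //= [X in _ <= _ + X]big_mkcond -big_split /=.
  apply: sumR_le => n _ _.
  have tV : 0 < / t by apply: Rinv_0_lt_compat; lra.
  case: leqP => nU; first by rewrite /f c0 //; right; ring.
  have := w0 n; rewrite /f; move: (w n) (c n) (H n) => a b d a0.
  have E : t * (a * b ^ 2) + / t * (a * d ^ 2) - 2 * (a * b * d) = a * / t * (t * b - d) ^ 2.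
    by field; lra.
  have : 0 <= a * / t * (t * b - d) ^ 2.
    apply: Rmult_le_pos; last exact: pow2_ge_0.
    by apply: Rmult_le_pos; lra.
  lra.
have : / t * \sum_(U.+1 <= n < X.+1) (w n * H n ^ 2) <= DD.
  apply: (Rmult_le_reg_l t); first lra.
  by rewrite -Rmult_assoc Rinv_r ?Rmult_1_l //; lra.
rewrite -/t -/S; lra.
Qed.

End LargeSieve.
End ResidueClasses.

(** The indicator of the class a minus its mean over the reduced classes, for 0 < a < r a
    combination of the nonprincipal characters modulo r. It then vanishes at multiples of r, so its
    sum over c of the values at b c is zero for every b, also when r divides b. *)
Definition class_char (r a n : nat) : R :=
  (if (n %% r == a)%N then 1 else 0) - (if (r %| n)%N then 0 else / INR r.-1).

Section ClassChar.
Variables (r a : nat).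
Hypotheses (pr : prime r) (a0 : (0 < a)%N) (ar : (a < r)%N).

Lemma class_char_mod n : class_char r a (n %% r)%N = class_char r a n.
Proof. by rewrite /class_char modn_mod /dvdn modn_mod. Qed.

Lemma INR_pred_prime : 1 <= INR r.-1.
Proof. by apply: INR_ge1; have := prime_gt1 pr; case: (r) => [|[]]. Qed.

Let sum1 : \sum_(0 <= c < r) (if (c %% r == a)%N then 1 else 0) = 1.
Proof.
rewrite (eq_big_nat _ _ (F2 := fun c => if c == a then 1 else 0)) => [|c /andP[_ cr]].
  by rewrite -big_mkcond big_nat1_eq /= ar.
by rewrite modn_small.
Qed.

Let sum2 : \sum_(0 <= c < r) (if (r %| c)%N then 0 else / INR r.-1) = 1.
Proof.
rewrite -{1}(prednK (prime_gt0 pr)) big_nat_recl // dvdn0 Rplus_0_l.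
rewrite (eq_big_nat _ _ (F2 := fun _ => / INR r.-1)) => [|c /andP[_ cr]].
  rewrite sumR_const count_predT size_iota subn0 Rinv_r //.
  by have := INR_pred_prime; lra.
by rewrite gtnNdvd //; have := prime_gt1 pr; lia.
Qed.

Lemma class_char_dvd b : (r %| b)%N -> class_char r a b = 0.
Proof.
move=> rb; rewrite /class_char rb.
by have /eqP -> := rb; rewrite eq_sym -leqn0 leqNgt a0 /=; lra.
Qed.

Lemma class_char_sum b : \sum_(0 <= c < r) class_char r a (b * c)%N = 0.
Proof.
case: (boolP (r %| b)) => rb.
  by rewrite big1 // => c _; rewrite class_char_dvd // dvdn_mulr.
have := sum_residues (phi := class_char r a) (b := b) 0 (prime_gt0 pr).
rewrite coprime_sym prime_coprime // => /(_ rb class_char_mod).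
under eq_bigr do rewrite addn0.
by move=> ->; rewrite sumR_sub sum1 sum2; lra.
Qed.

Lemma class_char_abs b : \sum_(0 <= c < r) Rabs (class_char r a (b * c)%N) <= 2.
Proof.
case: (boolP (r %| b)) => rb.
  by rewrite big1; [lra|move=> c _; rewrite class_char_dvd ?dvdn_mulr // Rabs_R0].
have := sum_residues (phi := fun n => Rabs (class_char r a n)) (b := b) 0 (prime_gt0 pr).
rewrite coprime_sym prime_coprime // => /(_ rb (fun n => congr1 Rabs (class_char_mod n))).
under eq_bigr do rewrite addn0.
move=> ->; rewrite (_ : 2 = 1 + 1) //; rewrite -{1}sum1 -sum2 -big_split /=.
apply: sumR_le => c _ _; rewrite /class_char.
have := Rinv_0_lt_compat _ (Rlt_le_trans _ _ _ Rlt_0_1 INR_pred_prime).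
by case: ifP => _; case: ifP => _ ?; apply: Rabs_le; lra.
Qed.

Lemma class_char_bound n : Rabs (class_char r a n) <= 1.
Proof.
rewrite /class_char; have := INR_pred_prime => H.
have := Rinv_0_lt_compat _ (Rlt_le_trans _ _ _ Rlt_0_1 H).
have := Rinv_le_contravar _ _ Rlt_0_1 H; rewrite Rinv_1.
by case: ifP => _; case: ifP => _ ? ?; apply: Rabs_le; lra.
Qed.

End ClassChar.

(** * Vaughan's identity *)

(** Moebius inversion writes F(m) as the sum over d of mu(d) S(d, m), where S sums F over the
    multiples of d m. For d <= U the complete sum over m collapses, since Lambda summed over
    divisors is ln, and the terms m <= U are taken back; d > U is the bilinear part. The vanishing
    of F beyond X lets all variables run up to X. *)
Lemma vaughan (F : nat -> R) U X : (U <= X)%N -> (forall n, (X < n)%N -> F n = 0) ->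
  \sum_(U.+1 <= m < X.+1) (mangoldt m * F m) =
  \sum_(1 <= d < U.+1) (mobius d * \sum_(1 <= k < X.+1) (ln (INR k) * F (d * k)%N))
  - \sum_(1 <= d < U.+1) \sum_(1 <= m < U.+1)
      (mobius d * mangoldt m * \sum_(1 <= k < X.+1) F (d * m * k)%N)
  + \sum_(U.+1 <= d < X.+1) \sum_(U.+1 <= m < X.+1) \sum_(1 <= k < X.+1)
      (mobius d * mangoldt m * F (d * m * k)%N).
Proof.
move=> UX F0; have F0' e : (0 < e)%N -> forall n, (X < n)%N -> F (e * n)%N = 0.
  by move=> e0 n nX; apply: F0; apply: leq_trans nX _; rewrite leq_pmull.
pose S d m := \sum_(1 <= k < X.+1) F (d * m * k)%N.
have E1 m : (0 < m)%N -> (m <= X)%N -> F m = \sum_(1 <= d < X.+1) (mobius d * S d m).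
  move=> m0 mX.
  transitivity (\sum_(1 <= d < X.+1) \sum_(1 <= k < X.+1) (mobius d * F (m * (d * k))%N)).
    rewrite (@dirichlet_sum mobius (fun n => F (m * n)%N)); last exact: F0'.
    rewrite (eq_big_nat _ _ (F2 := fun n => if n == 1%N then F (m * n)%N else 0)).
      by rewrite -big_mkcond big_nat1_eq /= muln1 ltnS (leq_trans m0 mX).
    by move=> n /andP[n0 nX]; rewrite mobius_sum //; case: eqP => _; lra.
  apply: eq_bigr => d _; rewrite sumR_scal; congr (_ * _); apply: eq_bigr => k _.
  by rewrite mulnA (mulnC m).
have E2 d : (0 < d)%N -> \sum_(1 <= m < X.+1) (mangoldt m * S d m) =
    \sum_(1 <= k < X.+1) (ln (INR k) * F (d * k)%N).
  move=> d0; transitivity (\sum_(1 <= m < X.+1) \sum_(1 <= k < X.+1) (mangoldt m * F (d * (m * k))%N)).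
    apply: eq_bigr => m _; rewrite sumR_scal; congr (_ * _); apply: eq_bigr => k _.
    by rewrite mulnA.
  rewrite (@dirichlet_sum mangoldt (fun n => F (d * n)%N)); last exact: F0'.
  by apply: eq_big_nat => n /andP[n0 nX]; rewrite mangoldt_sum // Rmult_comm.
transitivity (\sum_(U.+1 <= m < X.+1) \sum_(1 <= d < X.+1) (mobius d * mangoldt m * S d m)).
  apply: eq_big_nat => m /andP[Um mX]; rewrite E1 //; last by apply: leq_trans Um.
  by rewrite -sumR_scal; apply: eq_bigr => d _; ring.
rewrite exchange_big /= (@sum_split _ _ 1 U.+1) //.
congr (_ + _); last first.
  by apply: eq_bigr => d _; apply: eq_bigr => m _; rewrite /S sumR_scal.
rewrite -sumR_sub; apply: eq_big_nat => d /andP[d0 _].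
rewrite -E2 // -sumR_scal.
have -> : \sum_(1 <= m < X.+1) (mobius d * (mangoldt m * S d m)) =
  \sum_(1 <= m < X.+1) (mobius d * mangoldt m * S d m) by apply: eq_bigr => m _; ring.
rewrite [X in _ = X - _](@sum_split _ _ 1 U.+1) // /S; lra.
Qed.

Lemma type_one_bound (r a e X Y : nat) (v : nat -> R) :
  prime r -> (0 < a)%N -> (a < r)%N -> (0 < e)%N -> (Y <= X)%N ->
  (forall k, 0 <= v k) -> (forall k, (Y %/ e < k)%N -> v k.+1 <= v k) ->
  Rabs (\sum_(1 <= k < X.+1) (v k *
    (if (Y < e * k)%N && (e * k <= X)%N then class_char r a (e * k) else 0))) <=
  2 * v (Y %/ e).+1.
Proof.
move=> pr a0 ar e0 YX v0 vd.
have -> : \sum_(1 <= k < X.+1) (v k *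
    (if (Y < e * k)%N && (e * k <= X)%N then class_char r a (e * k) else 0)) =
  \sum_((Y %/ e).+1 <= k < (X %/ e).+1) (v k * class_char r a (e * k)).
  transitivity (\sum_(1 <= k < X.+1 | (Y %/ e < k)%N && (k < (X %/ e).+1)%N)
     (v k * class_char r a (e * k))).
    rewrite [RHS]big_mkcond; apply: eq_bigr => k _.
    rewrite ltn_divLR // mulnC ltnS leq_divRL // (mulnC k).
    by case: ifP => _; rewrite ?Rmult_0_r.
  rewrite [RHS](@big_nat_widenl _ _ _ _ 1) //= [RHS](@big_nat_widen _ _ _ _ _ X.+1) //.
  by rewrite ltnS leq_div.
rewrite Rmult_comm.
have per n : class_char r a (e * (n %% r))%N = class_char r a (e * n).
  by rewrite -class_char_mod modnMmr class_char_mod.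
have := @periodic_weighted (fun k => class_char r a (e * k)) r (prime_gt0 pr) per v (Y %/ e) (X %/ e) v0.
rewrite class_char_sum // => H.
apply: Rle_trans (H _ erefl) _; first by move=> i Yi _; exact: vd.
by apply: Rmult_le_compat_l (v0 _) _; exact: class_char_abs.
Qed.

(** * Harmonic sums, higher prime powers and averages of the von Mangoldt function *)

Definition harmonic n := \sum_(1 <= k < n.+1) / INR k.

Lemma harmonic_le n : harmonic n <= 1 + ln (INR n).
Proof.
case: n => [|n]; first by rewrite /harmonic big_geq //; have := ln_INR_ge0 0; lra.
elim: n => [|n IH]; first by rewrite /harmonic big_nat1 INR_1 ln_1; lra.
rewrite /harmonic big_nat_recr //= -/(harmonic n.+1).
have P1 := INR_gt0 (ltn0Sn n); have P2 := INR_gt0 (ltn0Sn n.+1).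
have H := ln_ge_sub1 (Rdiv_lt_0_compat _ _ P2 P1).
move: H; rewrite ln_div // Rinv_div.
have -> : 1 - INR n.+1 / INR n.+2 = / INR n.+2 by rewrite (S_INR n.+1); field; rewrite -S_INR; lra.
lra.
Qed.

Lemma harmonic_ge0 n : 0 <= harmonic n.
Proof.
apply: sumR_ge0 => k; rewrite mem_index_iota => /andP[k0 _] _.
by [].
Qed.

Definition nonprime_powers Y X := \sum_(Y.+1 <= n < X.+1 | ~~ prime n) (mangoldt n / INR n).

Lemma sum_nonprime_powers (G : nat -> R) X K : (forall n, 0 <= G n) -> (X < 2 ^ K)%N ->
  \sum_(1 <= n < X.+1 | ~~ prime n) (mangoldt n * G n) <=
  \sum_(1 <= p < X.+1 | prime p) \sum_(2 <= k < K) (ln (INR p) * G (p ^ k)%N).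
Proof.
move=> G0 XK; pose E p k n := if n == (p ^ k)%N then ln (INR p) * G (p ^ k)%N else 0.
have E0 p k n : 0 <= E p k n.
  rewrite /E; case: ifP => _; last lra.
  by apply: Rmult_le_pos => //; exact: ln_INR_ge0.
apply: (Rle_trans _ (\sum_(1 <= n < X.+1) \sum_(1 <= p < X.+1 | prime p) \sum_(2 <= k < K) E p k n)).
  rewrite big_mkcond; apply: sumR_le_nat => n n0 nX _.
  have R0 : 0 <= \sum_(1 <= p < X.+1 | prime p) \sum_(2 <= k < K) E p k n.
    by apply: sumR_ge0 => p _ _; apply: sumR_ge0 => k _ _.
  case: ifP => // np; case: (Req_dec (mangoldt n) 0) => [->|/mangoldt_neq0[p [k [pp k0 nE]]]]; first lra.
  have k1 : (1 < k)%N by case: (k) k0 nE np => [|[]] // _; rewrite expn1 => ->; rewrite pp.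
  have pn : (p <= n)%N by rewrite nE -{1}(expn1 p) leq_exp2l ?prime_gt1.
  have kK : (k < K)%N.
    rewrite -(ltn_exp2l k K (ltnSn 1)); apply: leq_ltn_trans XK; apply: (@leq_trans n) => //.
    by rewrite nE leq_exp2r // prime_gt1.
  apply: Rle_trans (sumR_term (i := p) (P := prime) _ _ _ _) => //.
  - apply: Rle_trans (sumR_term (i := k) (P := predT) _ _ _ _) => //.
    + by rewrite /E nE eqxx mangoldt_pow //; right.
    + exact: iota_uniq.
    + by rewrite mem_index_iota k1.
  - by move=> q _ _; apply: sumR_ge0.
  - exact: iota_uniq.
  - by rewrite mem_index_iota prime_gt0 //= (leq_ltn_trans pn).
rewrite exchange_big /=; apply: sumR_le => p _ pp.
rewrite exchange_big /=; apply: sumR_le => k _ _.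
rewrite /E -big_mkcond big_nat1_eq; case: ifP => _; first by right.
by apply: Rmult_le_pos => //; exact: ln_INR_ge0.
Qed.

Lemma harmonic_prime_sum_le (P : pred nat) X :
  \sum_(1 <= p < X.+1 | P p) / INR p <= harmonic X.
Proof.
apply: sumR_subset => // p; rewrite mem_index_iota => /andP[p0 _] _.
Qed.

(** A power p^k with k >= 2 exceeding y^2 is at least p y, whether or not p < y. Each exponent thus
    contributes at most 1/(p y), and fewer than K exponents occur. *)
Lemma nonprime_powers_tail y X K : (0 < y)%N -> (0 < X)%N -> (X < 2 ^ K)%N ->
  nonprime_powers (y * y) X <= INR K * ln (INR X) * harmonic X / INR y.
Proof.
move=> y0 X0 XK; have y0' := INR_gt0 y0.
pose G n := if (y * y < n)%N then / INR n else 0.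
have G0 n : 0 <= G n.
  by rewrite /G; case: ifP => // _; lra.
have -> : nonprime_powers (y * y) X = \sum_(1 <= n < X.+1 | ~~ prime n) (mangoldt n * G n).
  rewrite /nonprime_powers (@big_nat_widenl _ _ _ (y * y).+1 1) //= big_mkcondr /=.
  by apply: eq_bigr => n _; rewrite /G; case: ifP => _; rewrite ?Rmult_0_r.
apply: Rle_trans (sum_nonprime_powers G0 XK) _.
apply: (Rle_trans _ (\sum_(1 <= p < X.+1 | prime p) (INR K * ln (INR X) / INR y * / INR p))).
  apply: sumR_le_nat => p p0 pX pp.
  have p0' := INR_gt0 p0.
  apply: (Rle_trans _ (\sum_(2 <= k < K) (ln (INR X) * (/ INR y * / INR p)))); last first.
    rewrite sumR_const count_predT size_iota.
    have L0 := ln_INR_ge0 X.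
    have H : INR (K - 2) <= INR K by apply: leq_INR; rewrite leq_subr.
    have I0 : 0 <= ln (INR X) * (/ INR y * / INR p).
      by apply: Rmult_le_pos => //; apply: Rmult_le_pos; apply: Rinv_ge0.
    by have := Rmult_le_compat_r _ _ _ I0 H; lra.
  apply: sumR_le_nat => k k2 _ _.
  apply: Rmult_le_compat => //; first exact: ln_INR_ge0.
    by apply: ln_mono => //; apply: leq_INR.
  rewrite /G -Rinv_mult -mult_INR; case: ifP => yp; last first.
    by [].
  apply: Rinv_le_contravar; first by apply: INR_gt0; rewrite muln_gt0 y0.
  apply: leq_INR; case: (leqP y p) => yp'.
    apply: (@leq_trans (p ^ 2)); first by rewrite expnS expn1 leq_mul2r yp' orbT.
    by rewrite leq_exp2l // prime_gt1.
  apply: leq_trans (ltnW yp); by rewrite leq_mul2l ltnW ?orbT.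
rewrite sumR_scal.
have := harmonic_prime_sum_le prime X; have := ln_INR_ge0 X; have := pos_INR K => K0 L0 H.
have C0 : 0 <= INR K * ln (INR X) / INR y.
  by apply: Rmult_le_pos; [exact: Rmult_le_pos|apply: Rinv_ge0].
apply: Rle_trans (Rmult_le_compat_l _ _ _ C0 H) _; right; field; lra.
Qed.

(** Legendre's formula for ln N!. *)
Lemma sum_mangoldt_floor N : \sum_(1 <= d < N.+1) (mangoldt d * INR (N %/ d)) =
  \sum_(1 <= n < N.+1) ln (INR n).
Proof.
pose F n : R := if (n <= N)%N then 1 else 0.
have := @dirichlet_sum mangoldt F N; rewrite /F => E.
transitivity (\sum_(1 <= m < N.+1) \sum_(1 <= k < N.+1) (mangoldt m * F (m * k)%N)).
  apply: eq_big_nat => m /andP[m0 mN]; rewrite sumR_scal; congr (_ * _).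
  rewrite /F -big_mkcond.
  rewrite (eq_bigl (fun k => k < (N %/ m).+1)%N) => [|k]; last by rewrite ltnS leq_divRL // mulnC.
  rewrite -(@big_nat_widen _ _ _ 1 (N %/ m).+1 N.+1 predT); last by rewrite ltnS leq_div.
  by rewrite sumR_const count_predT size_iota subn1 Rmult_1_r.
rewrite /F E; last by move=> n; case: leqP.
apply: eq_big_nat => n /andP[n0 nN]; rewrite mangoldt_sum // -ltnS nN; lra.
Qed.

Lemma ln_succ_sub n : (0 < n)%N -> ln (INR n.+1) - ln (INR n) <= / INR n.
Proof.
move=> n0; have P1 := INR_gt0 n0; have P2 := INR_gt0 (ltn0Sn n).
rewrite -ln_div //; have := ln_le_sub1 (Rdiv_lt_0_compat _ _ P2 P1).
rewrite S_INR; have -> : (INR n + 1) / INR n - 1 = / INR n by field; lra.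
by [].
Qed.

Lemma ln_succ_sub_ge n : (0 < n)%N -> / INR n.+1 <= ln (INR n.+1) - ln (INR n).
Proof.
move=> n0; have P1 := INR_gt0 n0; have P2 := INR_gt0 (ltn0Sn n).
rewrite -ln_div //; have := ln_ge_sub1 (Rdiv_lt_0_compat _ _ P2 P1).
rewrite Rinv_div {1}S_INR; have -> : 1 - INR n / (INR n + 1) = / (INR n + 1) by field; rewrite -S_INR; lra.
by rewrite -S_INR.
Qed.

Lemma sum_ln_ge N : INR N * ln (INR N) - INR N <= \sum_(1 <= n < N.+1) ln (INR n).
Proof.
case: N => [|N]; first by rewrite big_geq // INR_0; lra.
elim: N => [|N IH]; first by rewrite big_nat1 INR_1 ln_1; lra.
rewrite big_nat_recr //=; move: IH; have := ln_succ_sub (ltn0Sn N).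
have P1 := INR_gt0 (ltn0Sn N); rewrite (S_INR N.+1); move: (INR N.+1) P1 => x x0 H.
have : x * (ln (x + 1) - ln x) <= 1.
  by have := Rmult_le_compat_l x _ _ (Rlt_le _ _ x0) H; rewrite Rinv_r; lra.
lra.
Qed.

Lemma sum_ln_le N : \sum_(1 <= n < N.+1) ln (INR n) <= INR N * ln (INR N).
Proof.
apply: (Rle_trans _ (\sum_(1 <= n < N.+1) ln (INR N))).
  apply: sumR_le_nat => n n0 nN _.
  by exact: leq_ln_INR.
rewrite sumR_const count_predT size_iota subn1 /=; lra.
Qed.

Lemma sum_mangoldt_div_ge N : (0 < N)%N ->
  ln (INR N) - 1 <= \sum_(1 <= n < N.+1) (mangoldt n / INR n).
Proof.
move=> N0; have N0' := INR_gt0 N0; apply: (Rmult_le_reg_l (INR N)) => //.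
apply: (Rle_trans _ (\sum_(1 <= d < N.+1) (mangoldt d * INR (N %/ d)))).
  by rewrite sum_mangoldt_floor; have := sum_ln_ge N; lra.
rewrite -sumR_scal; apply: sumR_le_nat => d d0 _ _.
have -> : INR N * (mangoldt d / INR d) = mangoldt d * (INR N / INR d).
  by field; have := INR_gt0 d0; lra.
apply: Rmult_le_compat_l; first exact: mangoldt_ge0.
apply: (Rmult_le_reg_r (INR d)); first exact: INR_gt0.
rewrite -mult_INR /Rdiv Rmult_assoc Rinv_l ?Rmult_1_r; last by have := INR_gt0 d0; lra.
by apply: leq_INR; exact: leq_divM.
Qed.

(** * Few primes r without a moderately small prime congruent to 1 or -1 mod r *)

Lemma expn2_size_primes_le (s : seq nat) N : (0 < N)%N -> uniq s ->
  (forall r, r \in s -> prime r && (r %| N)%N) -> (2 ^ size s <= N)%N.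
Proof.
elim: s N => [|r s IH] N N0 //= /andP[rs us] H.
have /andP[pr /dvdnP[M NE]] : prime r && (r %| N)%N by apply: H; rewrite inE eqxx.
have M0 : (0 < M)%N by move: N0; rewrite NE; case: (M).
rewrite expnS NE mulnC; apply: leq_mul (prime_gt1 pr); apply: IH => // q qs.
have /andP[pq] : prime q && (q %| N)%N by apply: H; rewrite inE qs orbT.
rewrite pq NE Gauss_dvdl // prime_coprime // dvdn_prime2 //.
by apply: contraNneq rs => <-.
Qed.

Section BadPrimes.
Variables (t : bool) (s : seq nat) (T U Y X L : nat) (w : nat -> R) (tau M0 : R).
Let a r := if t then r.-1 else 1%N.
Hypotheses (us : uniq s) (sP : forall r, r \in s -> prime r && (r <= T)%N) (sT : (2 * size s <= T)%N).
Hypotheses (U0 : (0 < U)%N) (UY : (3 * U <= Y)%N) (YX : (Y <= X)%N) (YL : (Y.+1 < 2 ^ L)%N).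
Hypotheses (w0 : forall n, 0 <= w n) (wM : forall m n, (0 < m)%N -> (0 < n)%N -> w (m * n)%N = w m * w n)
  (wle : forall n, (0 < n)%N -> w n <= / INR n)
  (wd : forall n, (0 < n)%N -> w n.+1 <= w n)
  (wlnd : forall n, (3 <= n)%N -> ln (INR n.+1) * w n.+1 <= ln (INR n) * w n)
  (wtail : forall n, (X < n)%N -> w n <= tau / INR n)
  (wT : w U.+1 * (2 * INR T + INR T ^ 3) <= 1).
Hypothesis bad : forall r p, r \in s -> prime p -> (Y < p)%N -> (p <= X)%N -> (p %% r)%N != a r.
Hypothesis HM : forall r, r \in s ->
  M0 <= \sum_(Y.+1 <= n < X.+1) (if (r %| n)%N then 0 else mangoldt n * w n).

Let chi r := class_char r (a r).
Let F r n := if (Y < n)%N && (n <= X)%N then w n * chi r n else 0.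
Let W := \sum_(1 <= n < X.+1) w n.
Let f n := w n * (if (U < n)%N then mobius n else 0).
Let g n := w n * (if (U < n)%N then mangoldt n else 0).

Let aP r : r \in s -> [/\ prime r, (0 < a r)%N & (a r < r)%N].
Proof.
by case/sP/andP => pr _; split=> //; rewrite /a; case: t; have := prime_gt1 pr; lia.
Qed.

Let Y0 : (0 < Y)%N. Proof. lia. Qed.
Let UX : (U <= X)%N. Proof. lia. Qed.

Let range_pos m n i : i \in index_iota m.+1 n -> (0 < i)%N.
Proof. by rewrite mem_index_iota; case/andP => /(leq_ltn_trans (leq0n m)). Qed.

Let w_ceil e : (0 < e)%N -> w e * w (Y %/ e).+1 <= / INR Y.
Proof.
move=> e0; rewrite -wM //; apply: Rle_trans (wle _) _; first by rewrite muln_gt0 e0.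
apply: Rinv_le_contravar; first exact: INR_gt0.
by apply: leq_INR; rewrite mulnC ltnW // ltn_ceil.
Qed.

Let bound1 r : r \in s ->
  Rabs (\sum_(1 <= d < U.+1) (mobius d * \sum_(1 <= k < X.+1) (ln (INR k) * F r (d * k)%N)))
  <= 2 * INR U * ln (INR Y.+1) / INR Y.
Proof.
move=> /aP[pr a0 ar]; apply: Rle_trans (sumR_abs _ _ _) _.
apply: (Rle_trans _ (\sum_(1 <= d < U.+1) (2 * ln (INR Y.+1) / INR Y))); last first.
  rewrite sumR_const count_predT size_iota subn1 /=; right; field.
  by have := INR_gt0 Y0; lra.
apply: sumR_le_nat => d d0 dU _.
(* ln k / k decreases only from k = 3 on; this is the purpose of 3 U <= Y. *)
have K3 : (3 <= Y %/ d)%N by rewrite leq_divRL //; apply: leq_trans UY; rewrite leq_mul2l -ltnS dU.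
rewrite Rabs_mult; apply: Rle_trans (Rmult_le_compat_r _ _ _ (Rabs_pos _) (mobius_abs d)) _.
rewrite Rmult_1_l.
have -> : \sum_(1 <= k < X.+1) (ln (INR k) * F r (d * k)%N) =
  w d * \sum_(1 <= k < X.+1) (ln (INR k) * w k *
    (if (Y < d * k)%N && (d * k <= X)%N then class_char r (a r) (d * k) else 0)).
  rewrite -sumR_scal; apply: eq_big_nat => k /andP[k0 _]; rewrite /F wM //.
  by case: ifP => _; rewrite /chi; lra.
have V0 k : 0 <= ln (INR k) * w k by apply: Rmult_le_pos => //; exact: ln_INR_ge0.
rewrite Rabs_mult (Rabs_pos_eq _ (w0 d)).
have := type_one_bound (v := fun k => ln (INR k) * w k) pr a0 ar d0 YX V0.
move=> /(_ (fun k Kk => wlnd (leq_trans K3 (ltnW Kk)))) H.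
apply: Rle_trans (Rmult_le_compat_l _ _ _ (w0 d) H) _.
have H1 := w_ceil d0.
have H2 : ln (INR (Y %/ d).+1) <= ln (INR Y.+1).
  by apply: ln_mono; [exact: INR_gt0|apply: leq_INR; rewrite ltnS leq_div].
have H3 : 0 <= w d * w (Y %/ d).+1 by apply: Rmult_le_pos.
have := Rmult_le_compat _ _ _ _ H3 (ln_INR_ge0 _) H1 H2; rewrite /Rdiv; lra.
Qed.

Let bound2 r : r \in s ->
  Rabs (\sum_(1 <= d < U.+1) \sum_(1 <= m < U.+1)
      (mobius d * mangoldt m * \sum_(1 <= k < X.+1) F r (d * m * k)%N))
  <= 2 * INR U ^ 2 * ln (INR U) / INR Y.
Proof.
move=> /aP[pr a0 ar]; apply: Rle_trans (sumR_abs _ _ _) _.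
apply: (Rle_trans _ (\sum_(1 <= d < U.+1) \sum_(1 <= m < U.+1) (2 * ln (INR U) / INR Y))); last first.
  rewrite !sumR_const !count_predT !size_iota subn1 /=; right; field.
  by have := INR_gt0 Y0; lra.
apply: sumR_le_nat => d d0 dU _.
apply: Rle_trans (sumR_abs _ _ _) _.
apply: sumR_le_nat => m m0 mU _.
have e0 : (0 < d * m)%N by rewrite muln_gt0 d0.
have -> : \sum_(1 <= k < X.+1) F r (d * m * k)%N =
  w (d * m)%N * \sum_(1 <= k < X.+1) (w k *
    (if (Y < d * m * k)%N && (d * m * k <= X)%N then class_char r (a r) (d * m * k) else 0)).
  rewrite -sumR_scal; apply: eq_big_nat => k /andP[k0 _]; rewrite /F (wM e0) //.
  by case: ifP => _; rewrite /chi; lra.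
have H := type_one_bound pr a0 ar e0 YX w0 (fun k Kk => wd (leq_ltn_trans (leq0n _) Kk)).
have H1 := w_ceil e0.
rewrite !Rabs_mult (Rabs_pos_eq _ (w0 _)) (Rabs_pos_eq _ (mangoldt_ge0 _)).
have H2 := Rmult_le_compat_l _ _ _ (w0 (d * m)) H.
have H3 : mangoldt m <= ln (INR U).
  apply: Rle_trans (mangoldt_le m0) _; apply: ln_mono; first exact: INR_gt0.
  exact: leq_INR.
have H4 : Rabs (mobius d) * mangoldt m <= 1 * ln (INR U).
  by apply: Rmult_le_compat => //; [exact: Rabs_pos|exact: mangoldt_ge0|exact: mobius_abs].
apply: (Rle_trans _ (1 * ln (INR U) * (2 * / INR Y))); last by right; rewrite /Rdiv; ring.
apply: Rmult_le_compat => //.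
- by apply: Rmult_le_pos; [exact: Rabs_pos|exact: mangoldt_ge0].
- by apply: Rmult_le_pos => //; exact: Rabs_pos.
- lra.
Qed.

(** The terms with d m k <= Y, which enter when the cut-off is dropped. They are controlled only on
    average over r, in [small_sum]. *)
Let small r := \sum_(1 <= d < X.+1) \sum_(1 <= m < X.+1) \sum_(1 <= k < X.+1)
  (if (d * m * k <= Y)%N && (U < m)%N then
     mangoldt m * / INR d * / INR m * / INR k * Rabs (chi r (d * m * k)) else 0).

(** Since w is multiplicative, dropping the cut-off Y < d m k <= X produces [box], which is for each
    k a bilinear sum covered by [bilinear_bound]. The correction [er] consists of products up to Y,
    kept in [small r], and of products beyond X, where [wtail] supplies the factor tau. *)
Let bound3 r : r \in s ->
  Rabs (\sum_(U.+1 <= d < X.+1) \sum_(U.+1 <= m < X.+1) \sum_(1 <= k < X.+1)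
      (mobius d * mangoldt m * F r (d * m * k)%N))
  <= W * (class_var X f r + class_var X g r) + small r + tau * ln (INR X) * harmonic X ^ 3.
Proof.
move=> /aP[pr a0 ar].
have -> : \sum_(U.+1 <= d < X.+1) \sum_(U.+1 <= m < X.+1) \sum_(1 <= k < X.+1)
    (mobius d * mangoldt m * F r (d * m * k)%N) =
  \sum_(1 <= d < X.+1) \sum_(1 <= m < X.+1) \sum_(1 <= k < X.+1)
   ((if (U < d)%N then mobius d else 0) * (if (U < m)%N then mangoldt m else 0) * F r (d * m * k)%N).
  rewrite (@big_nat_widenl _ _ _ U.+1 1) //= big_mkcond; apply: eq_bigr => d _.
  case: ifP => _; last by rewrite big1 // => m _; rewrite big1 // => k _; lra.
  rewrite (@big_nat_widenl _ _ _ U.+1 1) //= big_mkcond; apply: eq_bigr => m _.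
  by case: ifP => _ //; rewrite big1 // => k _; lra.
pose box d m k := f d * g m * w k * chi r (d * m * k).
pose er d m k := (if (U < d)%N then mobius d else 0) * (if (U < m)%N then mangoldt m else 0)
   * (if (Y < d * m * k)%N && (d * m * k <= X)%N then 0 else w (d * m * k)%N * chi r (d * m * k)).
have -> : \sum_(1 <= d < X.+1) \sum_(1 <= m < X.+1) \sum_(1 <= k < X.+1)
   ((if (U < d)%N then mobius d else 0) * (if (U < m)%N then mangoldt m else 0) * F r (d * m * k)%N) =
   \sum_(1 <= d < X.+1) \sum_(1 <= m < X.+1) \sum_(1 <= k < X.+1) box d m k
   - \sum_(1 <= d < X.+1) \sum_(1 <= m < X.+1) \sum_(1 <= k < X.+1) er d m k.
  rewrite -sumR_sub; apply: eq_big_nat => d /andP[d0 _].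
  rewrite -sumR_sub; apply: eq_big_nat => m /andP[m0 _].
  rewrite -sumR_sub; apply: eq_big_nat => k /andP[k0 _].
  rewrite /box /er /F /f /g (wM (m := d * m)) ?muln_gt0 ?d0 // (wM d0 m0).
  by case: (_ && _); ring.
apply: Rle_trans (Rabs_triang _ _) _; rewrite Rabs_Ropp Rplus_assoc; apply: Rplus_le_compat.
  have -> : \sum_(1 <= d < X.+1) \sum_(1 <= m < X.+1) \sum_(1 <= k < X.+1) box d m k =
    \sum_(1 <= k < X.+1) (w k * \sum_(1 <= d < X.+1) \sum_(1 <= m < X.+1)
       (f d * g m * chi r (d * m * k))).
    under eq_bigr do rewrite exchange_big /=.
    rewrite exchange_big /=; apply: eq_bigr => k _; rewrite -sumR_scal; apply: eq_bigr => d _.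
    by rewrite -sumR_scal; apply: eq_bigr => m _; rewrite /box; ring.
  apply: Rle_trans (sumR_abs _ _ _) _; rewrite /W big_distrl /=; apply: sumR_le => k _ _.
  rewrite Rabs_mult (Rabs_pos_eq _ (w0 k)); apply: Rmult_le_compat_l => //.
  apply: bilinear_bound; first exact: prime_gt0.
  - exact: class_char_mod.
  - exact: class_char_sum.
  - exact: class_char_abs.
have -> : tau * ln (INR X) * harmonic X ^ 3 =
  \sum_(1 <= d < X.+1) \sum_(1 <= m < X.+1) \sum_(1 <= k < X.+1)
    (tau * ln (INR X) * (/ INR d * / INR m * / INR k)).
  have -> : tau * ln (INR X) * harmonic X ^ 3 =
    \sum_(1 <= d < X.+1) (tau * ln (INR X) * harmonic X ^ 2 * / INR d).
    by rewrite sumR_scal -/(harmonic X); ring.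
  apply: eq_bigr => d _.
  transitivity (\sum_(1 <= m < X.+1) (tau * ln (INR X) * harmonic X * / INR d * / INR m)).
    by rewrite sumR_scal -/(harmonic X); ring.
  apply: eq_bigr => m _; rewrite !sumR_scal -/(harmonic X); ring.
rewrite /small -big_split /=; apply: Rle_trans (sumR_abs _ _ _) _; apply: sumR_le_nat => d d0 dX _.
rewrite -big_split /=; apply: Rle_trans (sumR_abs _ _ _) _; apply: sumR_le_nat => m m0 mX _.
rewrite -big_split /=; apply: Rle_trans (sumR_abs _ _ _) _; apply: sumR_le_nat => k k0 kX _.
have dmk0 : (0 < d * m * k)%N by rewrite !muln_gt0 d0 m0.
have tau0 : 0 <= tau.
  have := wtail (ltnSn X); have := w0 X.+1; have := INR_gt0 (ltn0Sn X) => P H1 H2.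
  have := Rmult_le_compat_r _ _ _ (Rlt_le _ _ P) (Rle_trans _ _ _ H1 H2).
  by rewrite Rmult_0_l /Rdiv Rmult_assoc Rinv_l ?Rmult_1_r; lra.
have L0 := mangoldt_ge0 m.
have Lm : mangoldt m <= ln (INR X).
  by apply: Rle_trans (mangoldt_le m0) _; exact: leq_ln_INR.
have iE : / INR (d * m * k) = / INR d * / INR m * / INR k by rewrite !mult_INR !Rinv_mult.
have i0 := inv_INR_ge0 (d * m * k).
have chi1 := class_char_bound (a r) pr (d * m * k); rewrite -/(chi r _) in chi1.
have T1 : 0 <= tau * ln (INR X) * (/ INR d * / INR m * / INR k).
  by rewrite -iE; apply: Rmult_le_pos => //; apply: Rmult_le_pos => //; exact: ln_INR_ge0.
have T2 : 0 <= mangoldt m * / INR d * / INR m * / INR k * Rabs (chi r (d * m * k)).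
  by do ![apply: Rmult_le_pos]=> //; exact: Rabs_pos.
rewrite /er !Rabs_mult.
have mu1 : Rabs (if (U < d)%N then mobius d else 0) <= 1.
  by case: ifP => _; [exact: mobius_abs|rewrite Rabs_R0; lra].
case: (leqP m U) => mU.
  by rewrite Rabs_R0 Rmult_0_r Rmult_0_l andbF; lra.
rewrite andbT (Rabs_pos_eq _ L0).
have L1 : Rabs (if (U < d)%N then mobius d else 0) * mangoldt m <= mangoldt m.
  by rewrite -[X in _ <= X]Rmult_1_l; apply: Rmult_le_compat_r.
have L2 : 0 <= Rabs (if (U < d)%N then mobius d else 0) * mangoldt m.
  by apply: Rmult_le_pos => //; exact: Rabs_pos.
case: (leqP (d * m * k) Y) => dY /=.
  rewrite Rabs_mult (Rabs_pos_eq _ (w0 _)).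
  apply: (Rle_trans _ (mangoldt m * (/ INR (d * m * k) * Rabs (chi r (d * m * k))))).
    apply: Rmult_le_compat => //.
      by apply: Rmult_le_pos => //; exact: Rabs_pos.
    by apply: Rmult_le_compat_r; [exact: Rabs_pos|exact: wle].
  rewrite iE; lra.
case: (leqP (d * m * k) X) => dX' /=; first by rewrite Rabs_R0 Rmult_0_r; lra.
rewrite Rplus_0_l Rabs_mult (Rabs_pos_eq _ (w0 _)).
apply: (Rle_trans _ (ln (INR X) * (tau * / INR (d * m * k) * 1))); last by rewrite iE; lra.
apply: Rmult_le_compat => //.
- by apply: Rmult_le_pos => //; exact: Rabs_pos.
- lra.
- by apply: Rmult_le_compat => //; [exact: Rabs_pos|exact: wtail].
Qed.

(** For a fixed product n, the primes r with n in the class [a r] divide n + 1 or n - 1, so there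
    are at most L of them; the mean part costs at most 2 per prime after multiplication by r.
    Averaging in this way saves nearly a factor T over a separate bound for each r. *)
Let small_sum : \sum_(r <- s) (INR r * small r) <=
  INR T * (INR L + 1) * ln (INR Y) * harmonic Y ^ 3.
Proof.
pose G d m k := if (d * m * k <= Y)%N && (U < m)%N then
  mangoldt m * / INR d * / INR m * / INR k * (INR T * (INR L + 1)) else 0.
have TL : 0 <= INR T * (INR L + 1) by apply: Rmult_le_pos; have := pos_INR T; have := pos_INR L; lra.
apply: (Rle_trans _ (\sum_(1 <= d < X.+1) \sum_(1 <= m < X.+1) \sum_(1 <= k < X.+1) G d m k)).
  under eq_bigr do rewrite -sumR_scal.
  rewrite exchange_big /=; apply: sumR_le => d dr _.
  under eq_bigr do rewrite -sumR_scal.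
  rewrite exchange_big /=; apply: sumR_le => m mr _.
  under eq_bigr do rewrite -sumR_scal.
  rewrite exchange_big /=; apply: sumR_le => k kr _.
  rewrite /G; case: ifP => [/andP[nY mU]|_]; last by rewrite big1 => [|r _]; lra.
  (* n > 1 because m > U >= 1; for n = 1 every r would divide n - 1 = 0. *)
  have n2 : (1 < d * m * k)%N.
    apply: leq_trans (_ : 1 * m * 1 <= _)%N; first by rewrite mul1n muln1; lia.
    by rewrite leq_mul // ?leq_mul2r ?(range_pos dr) ?orbT // (range_pos kr).
  set n := (d * m * k)%N in nY n2 *.
  have -> : \sum_(r <- s) (INR r * (mangoldt m * / INR d * / INR m * / INR k * Rabs (chi r n))) =
    mangoldt m * / INR d * / INR m * / INR k * \sum_(r <- s) (INR r * Rabs (chi r n)).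
    by rewrite -sumR_scal; apply: eq_bigr => r _; ring.
  apply: Rmult_le_compat_l; first by do ![apply: Rmult_le_pos] => //; exact: mangoldt_ge0.
  apply: (Rle_trans _ (\sum_(r <- s) (INR T * (if (n %% r == a r)%N then 1 else 0) + 2))).
    apply: sumR_le => r rs _; have [pr a0 ar] := aP rs.
    have rT : INR r <= INR T by apply: leq_INR; case/andP: (sP rs).
    have r1 := INR_pred_prime pr.
    have rE : INR r = INR r.-1 + 1 by rewrite -{1}(prednK (prime_gt0 pr)) S_INR.
    rewrite /chi /class_char; have i0 := Rinv_0_lt_compat _ (Rlt_le_trans _ _ _ Rlt_0_1 r1).
    have i1 : INR r * / INR r.-1 <= 2.
      apply: (Rmult_le_reg_r (INR r.-1)); first lra.
      by rewrite Rmult_assoc Rinv_l; lra.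
    have r0 := pos_INR r.
    apply: (Rle_trans _ (INR r * ((if (n %% r)%N == a r then 1 else 0) +
       (if r %| n then 0 else / INR r.-1)))).
      apply: Rmult_le_compat_l => //; apply: Rabs_le.
      by case: ifP => _; case: ifP => _; lra.
    by case: ifP => _; case: ifP => _; lra.
  rewrite big_split /= sumR_scal sumR_const count_predT -big_mkcond sumR_const /=.
  have c1 : (count (fun r => n %% r == a r)%N s <= L)%N.
    rewrite -size_filter; rewrite -(leq_exp2l _ L (ltnSn 1)).
    apply: leq_trans (ltnW YL).
    apply: leq_trans (_ : (if t then n.+1 else n.-1) <= _)%N; last by case: t; lia.
    apply: expn2_size_primes_le; [by case: t; lia|exact: filter_uniq|move=> r].
    rewrite mem_filter => /andP[/eqP nr rs]; have [pr a0 ar] := aP rs; rewrite pr /=.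
    move: nr; rewrite /a; case: t => nr.
      by rewrite /dvdn -addn1 -modnDml nr addn1 prednK ?modnn // prime_gt0.
    rewrite -subn1 -eqn_mod_dvd ?(ltnW n2) //.
    by rewrite nr modn_small // prime_gt1.
  have c1' := leq_INR c1.
  have sT' := leq_INR sT; rewrite mult_INR in sT'.
  have -> : INR T * (INR L + 1) = INR T * (INR L * 1) + INR T by ring.
  apply: Rplus_le_compat; last by move: sT'; rewrite -[INR 2]/(1 + 1); lra.
  apply: Rmult_le_compat_l; first exact: pos_INR.
  lra.
apply: (Rle_trans _ (\sum_(1 <= d < Y.+1) \sum_(1 <= m < Y.+1) \sum_(1 <= k < Y.+1)
    (ln (INR Y) * (INR T * (INR L + 1)) * (/ INR d * / INR m * / INR k)))); last first.
  have -> : INR T * (INR L + 1) * ln (INR Y) * harmonic Y ^ 3 =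
    \sum_(1 <= d < Y.+1) (INR T * (INR L + 1) * ln (INR Y) * harmonic Y ^ 2 * / INR d).
    by rewrite sumR_scal -/(harmonic Y); ring.
  right; apply: eq_bigr => d _.
  transitivity (\sum_(1 <= m < Y.+1) (INR T * (INR L + 1) * ln (INR Y) * harmonic Y * / INR d * / INR m)).
    by apply: eq_bigr => m _; rewrite !sumR_scal -/(harmonic Y); ring.
  by rewrite sumR_scal -/(harmonic Y); ring.
have I0 d m k : 0 <= ln (INR Y) * (INR T * (INR L + 1)) * (/ INR d * / INR m * / INR k).
  by do ![apply: Rmult_le_pos] => //; [exact: ln_INR_ge0|exact: pos_INR|have := pos_INR L; lra].
have cutY (P Q : nat -> R) : (forall n, (Y < n)%N -> P n = 0) ->
    (forall n, (0 < n)%N -> (n <= Y)%N -> P n <= Q n) ->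
    \sum_(1 <= n < X.+1) P n <= \sum_(1 <= n < Y.+1) Q n.
  move=> PY PQ; rewrite (@sum_split _ _ 1 Y.+1) // [X in _ + X](_ : _ = 0) ?Rplus_0_r; last first.
    by rewrite big_nat big1 // => n /andP[nY _]; exact: PY.
  by apply: sumR_le_nat => n n0 nY _; exact: PQ.
apply: (cutY _ _) => [d dY|d d0 dY].
  rewrite big_nat big1 // => m /andP[m0 _]; rewrite big_nat big1 // => k /andP[k0 _].
  rewrite /G leqNgt (_ : (Y < d * m * k)%N) //; apply: leq_trans dY _.
  by rewrite -mulnA leq_pmulr // muln_gt0 m0.
apply: (cutY _ _) => [m mY|m m0 mY].
  rewrite big_nat big1 // => k /andP[k0 _].
  rewrite /G leqNgt (_ : (Y < d * m * k)%N) //; apply: leq_trans mY _.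
  by rewrite mulnAC leq_pmull // muln_gt0 d0.
apply: (cutY _ _) => [k kY|k k0 kY].
  rewrite /G leqNgt (_ : (Y < d * m * k)%N) //; apply: leq_trans kY _.
  by rewrite leq_pmull // muln_gt0 d0.
rewrite /G; case: ifP => _; last exact: I0.
have Lm : mangoldt m <= ln (INR Y).
  by apply: Rle_trans (mangoldt_le m0) _; exact: leq_ln_INR.
have P0 : 0 <= / INR d * / INR m * / INR k * (INR T * (INR L + 1)).
  by do ![apply: Rmult_le_pos] => //; [exact: pos_INR|have := pos_INR L; lra].
have := Rmult_le_compat_r _ _ _ P0 Lm; lra.
Qed.

(** For a bad r only higher prime powers lie in the class [a r], so the sum of Lambda F is almost
    minus the main term divided by r - 1, and its absolute value cannot be small. *)
Let lower r : r \in s ->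
  M0 / INR r.-1 <= nonprime_powers Y X
   + Rabs (\sum_(U.+1 <= m < X.+1) (mangoldt m * F r m)).
Proof.
move=> rs; have [pr a0 ar] := aP rs; have r1 := INR_pred_prime pr.
have UY' : (U <= Y)%N by lia.
have Z : \sum_(U.+1 <= m < Y.+1) (mangoldt m * F r m) = 0.
  by rewrite big_nat big1 // => n /andP[_ nY]; rewrite /F ltnNge -ltnS nY /=; lra.
rewrite (@sum_split _ _ U.+1 Y.+1) // Z Rplus_0_l.
have -> : \sum_(Y.+1 <= n < X.+1) (mangoldt n * F r n) =
  \sum_(Y.+1 <= n < X.+1) (mangoldt n * w n * (if (n %% r)%N == a r then 1 else 0))
  - / INR r.-1 * \sum_(Y.+1 <= n < X.+1) (if (r %| n)%N then 0 else mangoldt n * w n).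
  rewrite -sumR_scal -sumR_sub; apply: eq_big_nat => n /andP[Yn nX].
  by rewrite /F Yn -ltnS nX /chi /class_char /=; case: ifP => _; case: ifP => _; lra.
set S1 := \sum_(_ <= _ < _) (_ * _ * _); set S2 := \sum_(_ <= _ < _) _.
have H1 : S1 <= nonprime_powers Y X.
  rewrite /S1 /nonprime_powers [X in _ <= X]big_mkcond; apply: sumR_le_nat => n Yn nX _; have n0 := leq_ltn_trans (leq0n _) Yn.
  have L0 := mangoldt_ge0 n.
  case: (boolP (prime n)) => pn /=.
    by rewrite (negPf (bad rs pn Yn _)) //; lra.
  have H := Rmult_le_compat_l _ _ _ L0 (wle n0).
  have := w0 n; have := inv_INR_ge0 n => i0 W0.
  by case: ifP => _; rewrite /Rdiv; nra.
have H2 : M0 / INR r.-1 <= / INR r.-1 * S2.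
  rewrite /Rdiv Rmult_comm; apply: Rmult_le_compat_l (HM rs).
  by exact: inv_INR_ge0.
have := Rle_abs (- (S1 - / INR r.-1 * S2)); rewrite Rabs_Ropp; lra.
Qed.

(** Each bad r forces M0 below r times the errors of Vaughan's decomposition. Summed over [s], the
    variances carry the factor r that the large sieve allows; it is applied to mu and to Lambda
    restricted to n > U, and its bound does not grow with the number of moduli. *)
Lemma bad_primes_bound : 0 <= M0 -> INR (size s) * M0 <=
  INR (size s) * INR T * (nonprime_powers Y X + 2 * INR U * ln (INR Y.+1) / INR Y
    + 2 * INR U ^ 2 * ln (INR U) / INR Y + tau * ln (INR X) * harmonic X ^ 3)
  + INR T * (INR L + 1) * ln (INR Y) * harmonic Y ^ 3
  + W * (W + 1) * W * (1 + ln (INR X) ^ 2).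
Proof.
move=> M00.
set E := nonprime_powers Y X + _ + _ + _.
have R1 r : r \in s -> M0 <= INR T * E + INR r * small r
    + W * (INR r * class_var X f r + INR r * class_var X g r).
  move=> rs; have := lower rs; rewrite (vaughan UX); last first.
    by move=> n nX; rewrite /F [(n <= X)%N]leqNgt nX andbF.
  have := bound1 rs; have := bound2 rs; have := bound3 rs.
  move: (\sum_(1 <= d < U.+1) _) => A2; move: (\sum_(1 <= d < U.+1) _) => A1.
  move: (\sum_(U.+1 <= d < X.+1) _) => A3 b3 b2 b1 H.
  have [pr a0 ar] := aP rs; have r1 := INR_pred_prime pr.
  have rT : INR r <= INR T by apply: leq_INR; case/andP: (sP rs).
  have rr : INR r.-1 <= INR r by apply: leq_INR; rewrite leq_pred.
  have H' : M0 / INR r.-1 <= E + small r + W * (class_var X f r + class_var X g r).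
    have T1 := Rabs_triang (A1 - A2) A3.
    have T2 : Rabs (A1 - A2) <= Rabs A1 + Rabs A2 by rewrite -(Rabs_Ropp A2); exact: Rabs_triang.
    rewrite /E; lra.
  have E0 : 0 <= E.
    rewrite /E; have Z : 0 <= nonprime_powers Y X.
      apply: sumR_ge0 => n nr _; apply: Rmult_le_pos; [exact: mangoldt_ge0|exact: inv_INR_ge0].
    have := Rabs_pos A1; have := Rabs_pos A2.
    have tau0 : 0 <= tau * ln (INR X) * harmonic X ^ 3.
      have := wtail (ltnSn X); have := w0 X.+1; have := INR_gt0 (ltn0Sn X) => P G1 G2.
      have := Rmult_le_compat_r _ _ _ (Rlt_le _ _ P) (Rle_trans _ _ _ G1 G2).
      rewrite Rmult_0_l /Rdiv Rmult_assoc Rinv_l ?Rmult_1_r; last lra.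
      move=> t0; apply: Rmult_le_pos; first by apply: Rmult_le_pos => //; exact: ln_INR_ge0.
      by apply: pow_le; exact: harmonic_ge0.
    lra.
  have small0 : 0 <= small r.
    apply: sumR_ge0 => d _ _; apply: sumR_ge0 => m _ _; apply: sumR_ge0 => k _ _.
    case: ifP => _; last lra.
    by do ![apply: Rmult_le_pos] => //; [exact: mangoldt_ge0|exact: Rabs_pos].
  have W0 : 0 <= W by apply: sumR_ge0.
  have V1 := class_var_ge0 X f r; have V2 := class_var_ge0 X g r.
  have WV : 0 <= W * (class_var X f r + class_var X g r) by apply: Rmult_le_pos; lra.
  have : M0 = INR r.-1 * (M0 / INR r.-1) by field; lra.
  have := Rmult_le_compat_l _ _ _ (Rle_trans _ _ _ Rle_0_1 r1) H'.
  have : INR r.-1 * (E + small r + W * (class_var X f r + class_var X g r)) <=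
    INR r * (E + small r + W * (class_var X f r + class_var X g r)).
    by apply: Rmult_le_compat_r; lra.
  have : INR r * E <= INR T * E by apply: Rmult_le_compat_r.
  lra.
have wdU n : (U < n)%N -> (n < X)%N -> w n.+1 <= w n by move=> Un _; apply: wd; lia.
have sT' : (size s <= T)%N by lia.
have D1 := @large_sieve X s T U w (fun n => if (U < n)%N then mobius n else 0) us sP sT' w0 wdU wT.
have D2 := @large_sieve X s T U w (fun n => if (U < n)%N then mangoldt n else 0) us sP sT' w0 wdU wT.
rewrite -/f -/W in D1; rewrite -/g -/W in D2.
have {}D1 := D1 (fun n nU => ltac:(by rewrite ltnNge nU)).
have {}D2 := D2 (fun n nU => ltac:(by rewrite ltnNge nU)).
have W0 : 0 <= W by apply: sumR_ge0.
have S1 : \sum_(1 <= n < X.+1) (w n * (if (U < n)%N then mobius n else 0) ^ 2) <= W.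
  apply: sumR_le => n _ _; rewrite -[X in _ <= X]Rmult_1_r; apply: Rmult_le_compat_l => //.
  rewrite -Rsqr_pow2 -Rsqr_1; apply: Rsqr_le_abs_1; rewrite Rabs_R1.
  by case: ifP => _; [exact: mobius_abs|rewrite Rabs_R0; lra].
have S2 : \sum_(1 <= n < X.+1) (w n * (if (U < n)%N then mangoldt n else 0) ^ 2) <=
    W * ln (INR X) ^ 2.
  rewrite /W big_distrl; apply: sumR_le_nat => n n0 nX _.
  apply: Rmult_le_compat_l => //; apply: pow_incr.
  case: ifP => _; last by split; [lra|exact: ln_INR_ge0].
  split; first exact: mangoldt_ge0.
  by apply: Rle_trans (mangoldt_le n0) _; exact: leq_ln_INR.
apply: (Rle_trans _ (\sum_(r <- s) (INR T * E + INR r * small r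
    + W * (INR r * class_var X f r + INR r * class_var X g r)))).
  rewrite -(count_predT s) -sumR_const; apply: sumR_le => r rs _; exact: R1.
clearbody E; rewrite !big_split /= sumR_const count_predT [X in _ + _ + X]sumR_scal big_split /=.
have C1 : W * (\sum_(r <- s) (INR r * class_var X f r) + \sum_(r <- s) (INR r * class_var X g r)) <=
   W * (W + 1) * W * (1 + ln (INR X) ^ 2).
  have -> : W * (W + 1) * W * (1 + ln (INR X) ^ 2) =
    W * ((W + 1) * W + (W + 1) * (W * ln (INR X) ^ 2)) by ring.
  apply: Rmult_le_compat_l => //; apply: Rplus_le_compat.
    by apply: Rle_trans D1 _; apply: Rmult_le_compat_l => //; lra.
  by apply: Rle_trans D2 _; apply: Rmult_le_compat_l => //; lra.
have := small_sum; lra.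
Qed.

End BadPrimes.

(** * The weight n^(-1-delta) and the choice of the sieve parameters *)

Lemma INR_lit n : INR n = IZR (Z.of_nat n).
Proof. exact: INR_IZR_INZ. Qed.

(** Induction on k by halving: with i = j/2 rounded down, 2^j >= 2^i 2^i, where one factor absorbs
    the extra power of i and the other the inductive bound. *)
Lemma pow_le_exp2 (C : R) k : exists j0, forall j, (j0 <= j)%N -> C * INR j ^ k <= 2 ^ j.
Proof.
have le2 n : INR n <= 2 ^ n.
  by rewrite -(INR_lit 2) -expn_INR; apply: leq_INR; rewrite ltnW // ltn_expl.
elim: k C => [|k IH] C.
  have [n nC] := INR_unbounded C; exists n => j nj; rewrite pow_O.
  by have := le2 j; have := leq_INR nj; lra.
have [i0 H] := IH (Rabs C * 3 ^ k.+1).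
exists (2 * i0 + 2)%N => j jj; pose i := (j./2).
have ii : (i0 <= i)%N by rewrite /i; lia.
have i1 : (0 < i)%N by rewrite /i; lia.
have j3 : INR j <= 3 * INR i by rewrite -(INR_lit 3) -mult_INR; apply: leq_INR; rewrite /i; lia.
have jE : 2 ^ i * 2 ^ i <= 2 ^ j.
  by rewrite -pow_add; apply: Rle_pow; [lra|rewrite /i; lia].
apply: Rle_trans jE; apply: (Rle_trans _ (Rabs C * (3 * INR i) ^ k.+1)).
  apply: (Rle_trans _ (Rabs C * INR j ^ k.+1)).
    by apply: Rmult_le_compat_r; [apply: pow_le; exact: pos_INR|exact: Rle_abs].
  apply: Rmult_le_compat_l; first exact: Rabs_pos.
  by apply: pow_incr; split; [exact: pos_INR|].
rewrite Rpow_mult_distr -(tech_pow_Rmult (INR i)).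
have -> : Rabs C * (3 ^ k.+1 * (INR i * INR i ^ k)) = INR i * (Rabs C * 3 ^ k.+1 * INR i ^ k) by ring.
apply: Rmult_le_compat; [exact: pos_INR| |exact: le2|exact: H].
apply: Rmult_le_pos; last by apply: pow_le; exact: pos_INR.
by apply: Rmult_le_pos; [exact: Rabs_pos|apply: pow_le; lra].
Qed.

Lemma ln2_bounds : / 2 < ln 2 < 1.
Proof.
split; first exact: ln_lt_2.
by have := ln_increasing 2 (exp 1); rewrite ln_exp; apply; [lra|have := exp_ineq1 1; lra].
Qed.

Lemma ln_exp2 e : ln (INR (2 ^ e)) = INR e * ln 2.
Proof. by rewrite expn_INR (INR_lit 2) ln_pow //=; lra. Qed.

Section PowerWeight.
Variable delta : R.
Hypothesis delta0 : 0 <= delta.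

Definition power_weight n := exp (- (1 + delta) * ln (INR n)).

Lemma power_weight_ge0 n : 0 <= power_weight n.
Proof. exact: Rlt_le (exp_pos _). Qed.

Lemma power_weightM m n : (0 < m)%N -> (0 < n)%N ->
  power_weight (m * n) = power_weight m * power_weight n.
Proof.
move=> m0 n0; rewrite /power_weight mult_INR ln_mult; [|exact: INR_gt0|exact: INR_gt0].
by rewrite -exp_plus; congr exp; ring.
Qed.

Lemma power_weightE n : (0 < n)%N -> power_weight n = exp (- delta * ln (INR n)) / INR n.
Proof.
move=> n0; rewrite /Rdiv; have -> : / INR n = exp (- ln (INR n)) by rewrite exp_Ropp exp_ln //; exact: INR_gt0.
by rewrite -exp_plus /power_weight; congr exp; ring.
Qed.

Lemma power_weight_le n : (0 < n)%N -> power_weight n <= / INR n.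
Proof.
move=> n0; rewrite power_weightE //; have := Rinv_0_lt_compat _ (INR_gt0 n0) => H.
rewrite -[X in _ <= X]Rmult_1_l; apply: Rmult_le_compat_r; first lra.
by rewrite -exp_0; apply: exp_mono; have := ln_INR_ge0 n; nra.
Qed.

Lemma power_weight_decr n : (0 < n)%N -> power_weight n.+1 <= power_weight n.
Proof.
move=> n0; apply: exp_mono.
have : ln (INR n) <= ln (INR n.+1) by exact: leq_ln_INR.
nra.
Qed.

Lemma ln_power_weight_decr n : (3 <= n)%N ->
  ln (INR n.+1) * power_weight n.+1 <= ln (INR n) * power_weight n.
Proof.
move=> n3; have n0 : (0 < n)%N by lia.
have P := INR_gt0 n0; have L1 : 1 <= ln (INR n).
  rewrite -[X in X <= _]ln_exp; apply: ln_mono; first exact: exp_pos.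
  by apply: Rle_trans exp_le_3 _; rewrite -(INR_lit 3); apply: leq_INR.
rewrite !power_weightE //.
have -> : ln (INR n.+1) * (exp (- delta * ln (INR n.+1)) / INR n.+1) =
  ln (INR n.+1) / INR n.+1 * exp (- delta * ln (INR n.+1)) by rewrite /Rdiv; ring.
have -> : ln (INR n) * (exp (- delta * ln (INR n)) / INR n) =
  ln (INR n) / INR n * exp (- delta * ln (INR n)) by rewrite /Rdiv; ring.
apply: Rmult_le_compat.
- apply: Rmult_le_pos; first exact: ln_INR_ge0.
  by [].
- exact: Rlt_le (exp_pos _).
- have H := ln_succ_sub n0.
  apply: (Rmult_le_reg_r (INR n * INR n.+1)); first by apply: Rmult_lt_0_compat => //; exact: INR_gt0.
  have -> : ln (INR n.+1) / INR n.+1 * (INR n * INR n.+1) = INR n * ln (INR n.+1).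
    by field; have := INR_gt0 (ltn0Sn n); lra.
  have -> : ln (INR n) / INR n * (INR n * INR n.+1) = INR n.+1 * ln (INR n) by field; lra.
  have := Rmult_le_compat_l _ _ _ (Rlt_le _ _ P) H; rewrite Rinv_r; last lra.
  rewrite S_INR; lra.
- apply: exp_mono; have : ln (INR n) <= ln (INR n.+1) by apply: ln_mono => //; exact: leq_INR.
  nra.
Qed.

Lemma power_weight_tail X n : (0 < X)%N -> (X < n)%N ->
  power_weight n <= exp (- delta * ln (INR X)) / INR n.
Proof.
move=> X0 Xn; have n0 : (0 < n)%N by lia.
rewrite power_weightE //; apply: Rmult_le_compat_r.
  by [].
apply: exp_mono; have : ln (INR X) <= ln (INR n).
  by apply: leq_ln_INR => //; exact: ltnW.
nra.
Qed.

End PowerWeight.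

Lemma mangoldt_multiple r k : prime r -> mangoldt (r * k) <= ln (INR r).
Proof.
move=> pr; case: (Req_dec (mangoldt (r * k)) 0) => [->|]; first exact: ln_INR_ge0.
case/mangoldt_neq0 => p [e [pp e0 E]]; rewrite E mangoldt_pow //.
have : (r %| p ^ e)%N by rewrite -E dvdn_mulr.
by rewrite Euclid_dvdX // e0 andbT dvdn_prime2 // => /eqP ->; right.
Qed.

(** The condition delta ln N = ln 2 means that n^-delta >= 1/2 for all n <= N, so half of the lower
    bound for the sum of Lambda(n)/n up to N survives. The range n <= Y and the multiples of r are
    then subtracted. *)
Lemma mangoldt_main_term delta r Y X N : 0 <= delta -> prime r -> (Y <= X)%N -> (0 < Y)%N ->
  (0 < N)%N -> (N <= X)%N -> delta * ln (INR N) = ln 2 ->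
  (ln (INR N) - 1) / 2 - ln (INR Y) * harmonic Y - ln (INR r) / INR r * harmonic X <=
  \sum_(Y.+1 <= n < X.+1) (if (r %| n)%N then 0 else mangoldt n * power_weight delta n).
Proof.
move=> d0 pr YX Y0 N0 NX dN; set w := power_weight delta.
have r0 := prime_gt0 pr; have w0 n : 0 <= w n := power_weight_ge0 delta n.
have LW n : 0 <= mangoldt n * w n by apply: Rmult_le_pos => //; exact: mangoldt_ge0.
have inv0 n : (0 < n)%N -> 0 <= / INR n.
  by move=> n0; exact: inv_INR_ge0.
have H1 : (ln (INR N) - 1) / 2 <= \sum_(1 <= n < X.+1) (mangoldt n * w n).
  apply: (Rle_trans _ (\sum_(1 <= n < N.+1) (mangoldt n * w n))); last first.
    exact: (sum_range_le (P := predT)).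
  apply: (Rle_trans _ (\sum_(1 <= n < N.+1) (/ 2 * (mangoldt n / INR n)))).
    by rewrite sumR_scal; have := sum_mangoldt_div_ge N0; lra.
  apply: sumR_le_nat => n n0 nN _.
  rewrite /w power_weightE //.
  have -> : / 2 * (mangoldt n / INR n) = mangoldt n * (/ 2 / INR n) by rewrite /Rdiv; ring.
  apply: Rmult_le_compat_l; first exact: mangoldt_ge0.
  apply: Rmult_le_compat_r; first exact: inv0.
  have -> : / 2 = exp (- delta * ln (INR N)).
    by rewrite Ropp_mult_distr_l_reverse dN exp_Ropp exp_ln //; lra.
  apply: exp_mono; have : ln (INR n) <= ln (INR N) by exact: leq_ln_INR.
  nra.
have H2 : \sum_(1 <= n < Y.+1) (mangoldt n * w n) <= ln (INR Y) * harmonic Y.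
  rewrite -sumR_scal; apply: sumR_le_nat => n n0 nY _.
  apply: Rmult_le_compat => //; [exact: mangoldt_ge0| |exact: power_weight_le].
  by apply: Rle_trans (mangoldt_le n0) _; exact: leq_ln_INR.
have H3 : \sum_(1 <= n < X.+1 | (r %| n)%N) (mangoldt n * w n) <= ln (INR r) / INR r * harmonic X.
  rewrite sum_multiples // -sumR_scal big_mkcond; apply: sumR_le_nat => k k0 _ _.
  have B : 0 <= ln (INR r) / INR r * / INR k.
    by do ![apply: Rmult_le_pos]; [exact: ln_INR_ge0|exact: inv0|exact: inv0].
  case: ifP => // _; have -> : ln (INR r) / INR r * / INR k = ln (INR r) * / INR (r * k).
    by rewrite mult_INR Rinv_mult; rewrite /Rdiv; ring.
  apply: Rmult_le_compat => //; [exact: mangoldt_ge0|exact: mangoldt_multiple|].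
  by apply: power_weight_le => //; rewrite muln_gt0 r0.
have E : \sum_(1 <= n < X.+1) (mangoldt n * w n) =
  \sum_(1 <= n < X.+1 | (r %| n)%N) (mangoldt n * w n) +
  \sum_(1 <= n < X.+1) (if (r %| n)%N then 0 else mangoldt n * w n).
  rewrite big_mkcond [X in _ = X + _]big_mkcond -big_split /=; apply: eq_bigr => n _.
  by case: ifP => _; lra.
have E2 := @sum_split (fun n => if (r %| n)%N then 0 else mangoldt n * w n) predT 1 Y.+1 X.+1 isT YX.
have H4 : \sum_(1 <= n < Y.+1) (if (r %| n)%N then 0 else mangoldt n * w n) <=
   \sum_(1 <= n < Y.+1) (mangoldt n * w n).
  by apply: sumR_le => n _ _; case: ifP => _ //; lra.
rewrite /predT /= in E2; lra.
Qed.

(* The lower end 2^(10 j) makes the sum of 1/p over the chosen primes small and dominates the type II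
   errors of the sieve; the upper end 2^(j^9) keeps ln n below x^(1 + o(1)). *)
Definition has_large_prime (t : bool) r j :=
  has (fun p => prime p && (p %% r == if t then r.-1 else 1)%N)
    (index_iota (2 ^ (10 * j)).+1 (2 ^ j ^ 9).+1).

Definition bad_primes t j :=
  [seq r <- index_iota (2 ^ j) (2 ^ j.+1) | prime r && ~~ has_large_prime t r j].

Lemma few_bad_primes : exists j0, forall t j, (j0 <= j)%N ->
  INR (size (bad_primes t j)) * INR j ^ 2 <= 3000000 * 2 ^ j.
Proof.
(* All error contributions except the small products are bounded by powers of x = j: 24 x^45 from
   the large sieve and 84 x^36 from type I sums, tail and prime powers. One threshold brings each
   below q = 2^j. *)
have [j1 Hj] := pow_le_exp2 84 45.
exists (maxn 4 j1) => t j; rewrite geq_max => /andP[j4 jj1].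
have {Hj jj1} big := Hj j jj1.
have x4 : 4 <= INR j by rewrite -(INR_lit 4); apply: leq_INR.
set s := bad_primes t j; set x := INR j in x4 big *; set q := 2 ^ j in big *.
(* U = T^4 / 16 makes the weight at U + 1 beat T^3 in the sieve. The errors in [E] are multiplied by
   the size of [s] times T, at most 2 q^2; Y = U^2 q^2 makes the type I terms, of order U^2 / Y up
   to a power of x, small enough for that. *)
pose T := (2 ^ j.+1)%N; pose U := (2 ^ (4 * j))%N; pose Y := (2 ^ (10 * j))%N; pose X := (2 ^ j ^ 9)%N.
pose N := (2 ^ j ^ 7)%N; pose delta := / x ^ 7; pose tau := exp (- delta * ln (INR X)).
have [l1 l2] := ln2_bounds.
have qE : q = INR (2 ^ j) by rewrite expn_INR.
have q16 : 16 <= q.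
  by rewrite qE -(INR_lit 16) -[16%N]/(2 ^ 4)%N; apply: leq_INR; rewrite leq_exp2l.
have xk0 k : 0 < x ^ k by apply: pow_lt; lra.
have xmono k l : (k <= l)%N -> x ^ k <= x ^ l by move=> kl; apply: Rle_pow; [lra|lia].
have x1 k : 1 <= x ^ k by have := xmono 0%N k isT; rewrite pow_O.
have qpow k : INR (2 ^ (k * j)) = q ^ k by rewrite mulnC expnM expn_INR -qE.
have qk0 k : 0 < q ^ k by apply: pow_lt; lra.
have TE : INR T = 2 * q by rewrite /T expnS mult_INR -qE.
have lnX : ln (INR X) = x ^ 9 * ln 2 by rewrite /X ln_exp2 expn_INR.
have lnN : ln (INR N) = x ^ 7 * ln 2 by rewrite /N ln_exp2 expn_INR.
have lnY : ln (INR Y) = 10 * x * ln 2 by rewrite /Y ln_exp2 mult_INR (INR_lit 10).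
have lnU : ln (INR U) = 4 * x * ln 2 by rewrite /U ln_exp2 mult_INR (INR_lit 4).
have X9 := x1 9%N; have X7 := x1 7%N; have X1 := x1 1%N; rewrite pow_1 in X1.
have lnXle : 0 <= ln (INR X) <= x ^ 9 by rewrite lnX; nra.
have HX : harmonic X <= 2 * x ^ 9 by have := harmonic_le X; lra.
have HX0 := harmonic_ge0 X.
have lnYle : 0 <= ln (INR Y) <= 10 * x by rewrite lnY; nra.
have HY : harmonic Y <= 11 * x by have := harmonic_le Y; lra.
have HY0 := harmonic_ge0 Y.
have d0 : 0 <= delta by apply: Rinv_ge0.
have Y0 : (0 < Y)%N by rewrite expn_gt0.
have N0 : (0 < N)%N by rewrite expn_gt0.
have U0 : (0 < U)%N by rewrite expn_gt0.
have X0 : (0 < X)%N by rewrite expn_gt0.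
have jp k l : (k <= l)%N -> (j ^ k <= j ^ l)%N by move=> kl; rewrite leq_pexp2l //; lia.
have YX : (Y <= X)%N.
  rewrite /Y /X leq_exp2l //; apply: leq_trans (jp 3%N 9%N isT); rewrite !expnS expn0.
  by have := leq_mul j4 j4; nia.
have NX : (N <= X)%N by rewrite /N /X leq_exp2l // jp.
have UY : (3 * U <= Y)%N.
  apply: (@leq_trans (2 ^ 2 * U)); first by rewrite leq_mul2r orbT.
  by rewrite /U /Y -expnD leq_exp2l //; lia.
have YL : (Y.+1 < 2 ^ (10 * j).+1)%N.
  rewrite expnS mul2n -addnn -[_.+2]addn2 leq_add2l -[2%N]/(2 ^ 1)%N leq_exp2l //; lia.
have rP r : r \in s -> [/\ prime r, (2 ^ j <= r)%N, (r < T)%N & ~~ has_large_prime t r j].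
  by rewrite mem_filter mem_index_iota => /andP[/andP[pr nh] /andP[r1 r2]].
have sP r : r \in s -> prime r && (r <= T)%N by case/rP => -> _ /ltnW ->.
have us : uniq s by apply: filter_uniq; exact: iota_uniq.
have s1 : (size s <= 2 ^ j)%N.
  by rewrite size_filter; apply: leq_trans (count_size _ _) _; rewrite size_iota expnS mul2n -addnn addnK.
have sT : (2 * size s <= T)%N by rewrite /T expnS leq_mul2l.
(* (ln N) / 2 exceeds x^7 / 4; half of this pays for the subtracted terms once x >= 4. *)
pose M0 := x ^ 7 / 8.
have HM r : r \in s ->
  M0 <= \sum_(Y.+1 <= n < X.+1) (if (r %| n)%N then 0 else mangoldt n * power_weight delta n).
  case/rP => pr r1 r2 _.
  apply: Rle_trans (mangoldt_main_term d0 pr YX Y0 N0 NX _); last first.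
    by rewrite lnN /delta; field; have := xk0 7%N; lra.
  have lr : ln (INR r) / INR r <= 2 * x / q.
    have rq : q <= INR r by rewrite qE; exact: leq_INR.
    apply: Rmult_le_compat; [exact: ln_INR_ge0| | |].
    - by apply: Rinv_ge0; lra.
    - apply: (Rle_trans _ (ln (INR T))); first by apply: ln_mono; [lra|apply: leq_INR; exact: ltnW].
      by rewrite /T ln_exp2 S_INR -/x; nra.
    - by apply: Rinv_le_contravar; lra.
  have B3 : ln (INR r) / INR r * harmonic X <= 1.
    apply: (Rle_trans _ (2 * x / q * (2 * x ^ 9))).
      apply: Rmult_le_compat => //; apply: Rmult_le_pos; first exact: ln_INR_ge0.
      by [].
    apply: (Rmult_le_reg_r q); first lra.
    have -> : 2 * x / q * (2 * x ^ 9) * q = 4 * x ^ 10 by field; lra.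
    have := xmono 10%N 45%N isT; have := xk0 45%N; lra.
  have B2 : ln (INR Y) * harmonic Y <= 10 * x * (11 * x) by apply: Rmult_le_compat; lra.
  have B2' : ln (INR Y) * harmonic Y <= 100 * x ^ 2 + 10 * x.
    apply: (Rle_trans _ (10 * x * (1 + 10 * x))); last by right; ring.
    by apply: Rmult_le_compat; have := harmonic_le Y; lra.
  have X5 : 1024 * x ^ 2 <= x ^ 7.
    have -> : x ^ 7 = x ^ 5 * x ^ 2 by ring.
    apply: Rmult_le_compat_r; first by have := xk0 2%N; lra.
    have -> : 1024 = 4 ^ 5 by ring.
    by apply: pow_incr; lra.
  have X2 : 4 * x <= x ^ 2 by nra.
  rewrite /M0 lnN; nra.
have bad r p : r \in s -> prime p -> (Y < p)%N -> (p <= X)%N ->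
    (p %% r != (if t then r.-1 else 1))%N.
  case/rP => pr _ _ /hasPn H pp Yp pX; have := H p; rewrite mem_index_iota ltnS Yp pX pp.
  by apply.
have wT : power_weight delta U.+1 * (2 * INR T + INR T ^ 3) <= 1.
  have UE : q ^ 4 <= INR U.+1 by rewrite -qpow; apply: leq_INR; exact: leqnSn.
  apply: (Rle_trans _ (/ q ^ 4 * (2 * INR T + INR T ^ 3))).
    apply: Rmult_le_compat_r.
      by have := pos_INR T; have := pow_le _ 3 (pos_INR T); lra.
    apply: Rle_trans (power_weight_le d0 (ltn0Sn U)) _.
    by apply: Rinv_le_contravar.
  apply: (Rmult_le_reg_l (q ^ 4)) => //.
  rewrite -Rmult_assoc Rinv_r ?Rmult_1_l ?Rmult_1_r; last by have := qk0 4%N; lra.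
  rewrite TE; have -> : 2 * (2 * q) + (2 * q) ^ 3 = 4 * q + 8 * q ^ 3 by ring.
  have -> : q ^ 4 = q * q ^ 3 by ring.
  have : q <= q ^ 3 by have := Rle_pow q 1 3; rewrite pow_1; apply; [lra|lia].
  by have := qk0 3%N; nra.
have M00 : 0 <= M0 by have := xk0 7%N; rewrite /M0; lra.
have := bad_primes_bound us sP sT U0 UY YX YL (power_weight_ge0 delta) (@power_weightM delta)
  (power_weight_le d0) (power_weight_decr d0) (ln_power_weight_decr d0)
  (fun n => power_weight_tail d0 X0 (n:=n)) wT bad HM M00.
rewrite -/tau; set W := \sum_(1 <= n < X.+1) power_weight delta n.
have W0 : 0 <= W by apply: sumR_ge0 => n _ _; exact: power_weight_ge0.
have WX : W <= 2 * x ^ 9.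
  apply: Rle_trans HX; apply: sumR_le_nat => n n0 _ _.
  exact: power_weight_le.
set PP := nonprime_powers Y X.
have qle k : (2 <= k)%N -> q ^ 2 <= q ^ k by move=> k2; apply: Rle_pow; [lra|lia].
have div_q2 a k : 0 <= a -> (2 <= k)%N -> a / q ^ k <= a / q ^ 2.
  move=> a0 k2; apply: Rmult_le_compat_l => //; apply: Rinv_le_contravar => //; exact: qle.
have YE : INR Y = q ^ 10 by exact: qpow.
have UE : INR U = q ^ 4 by exact: qpow.
have PPb : PP <= 4 * x ^ 27 / q ^ 2.
  have YY : Y = (2 ^ (5 * j) * 2 ^ (5 * j))%N by rewrite /Y -expnD; congr (_ ^ _)%N; lia.
  have XK : (X < 2 ^ (j ^ 9).+1)%N by rewrite ltn_exp2l.
  rewrite /PP YY; apply: Rle_trans (nonprime_powers_tail _ X0 XK) _; first by rewrite expn_gt0.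
  rewrite qpow S_INR expn_INR -/x.
  apply: (Rle_trans _ (4 * x ^ 27 / q ^ 5)); last by apply: div_q2 => //; have := xk0 27%N; lra.
  apply: Rmult_le_compat_r; first by apply: Rinv_ge0.
  have -> : 4 * x ^ 27 = (2 * x ^ 9 * x ^ 9) * (2 * x ^ 9) by ring.
  apply: Rmult_le_compat => //; first by apply: Rmult_le_pos; lra.
  by apply: Rmult_le_compat; lra.
have Ab : 2 * INR U * ln (INR Y.+1) / INR Y <= 22 * x / q ^ 2.
  have L : ln (INR Y.+1) <= 11 * x.
    apply: (Rle_trans _ (ln (2 * INR Y))).
      by apply: ln_mono; [exact: INR_gt0|rewrite S_INR; have := INR_ge1 Y0; lra].
    by rewrite ln_mult; [lra|lra|exact: INR_gt0].
  rewrite UE YE; apply: (Rle_trans _ (22 * x / q ^ 6)); last by apply: div_q2 => //; lra.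
  have -> : 22 * x / q ^ 6 = 2 * q ^ 4 * (11 * x) / q ^ 10 by field; lra.
  apply: Rmult_le_compat_r; first by apply: Rinv_ge0.
  by apply: Rmult_le_compat_l => //; have := qk0 4%N; lra.
have Bb : 2 * INR U ^ 2 * ln (INR U) / INR Y <= 8 * x / q ^ 2.
  have L : ln (INR U) <= 4 * x by rewrite lnU; nra.
  rewrite UE in L *; rewrite YE; have -> : 8 * x / q ^ 2 = 2 * (q ^ 4) ^ 2 * (4 * x) / q ^ 10 by field; lra.
  apply: Rmult_le_compat_r; first by apply: Rinv_ge0.
  by apply: Rmult_le_compat_l => //; apply: Rmult_le_pos; [lra|exact: pow2_ge_0].
have Tb : tau * ln (INR X) * harmonic X ^ 3 <= 8 * x ^ 36 / q ^ 2.
  have tE : tau = / 2 ^ (j * j).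
    rewrite -[2 ^ (j * j)]exp_ln; last by apply: pow_lt; lra.
    rewrite -exp_Ropp /tau ln_pow; last lra.
    rewrite lnX mult_INR -/x /delta; congr exp; field; lra.
  have tq : tau <= / q ^ 2.
    rewrite tE; apply: Rinv_le_contravar => //.
    by rewrite /q -pow_mult; apply: Rle_pow; [lra|nia].
  have -> : 8 * x ^ 36 / q ^ 2 = / q ^ 2 * x ^ 9 * (2 * x ^ 9) ^ 3 by field; lra.
  have t0 : 0 <= tau by exact: Rlt_le (exp_pos _).
  apply: Rmult_le_compat; [by apply: Rmult_le_pos; lra|exact: pow_le| |by apply: pow_incr].
  by apply: Rmult_le_compat; lra.
set E := PP + _ + _ + _.
have s1' : INR (size s) <= q by rewrite qE; exact: leq_INR.
have s0 := pos_INR (size s).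
have Eb : INR (size s) * INR T * E <= q.
  have EE : E <= 42 * x ^ 36 / q ^ 2.
    have -> : 42 * x ^ 36 / q ^ 2 = (4 * x ^ 36 + 22 * x ^ 36 + 8 * x ^ 36 + 8 * x ^ 36) / q ^ 2.
      by field; lra.
    have q2 : 0 < / q ^ 2 by apply: Rinv_0_lt_compat.
    have := xmono 27%N 36%N isT; have := xmono 1%N 36%N isT; rewrite pow_1 => G1 G2.
    have := Rmult_le_compat_r _ _ _ (Rlt_le _ _ q2) G1.
    have := Rmult_le_compat_r _ _ _ (Rlt_le _ _ q2) G2.
    rewrite /E /Rdiv; rewrite /Rdiv in PPb Ab Bb Tb; lra.
  apply: (Rle_trans _ (q * (2 * q) * (42 * x ^ 36 / q ^ 2))).
    rewrite TE; apply: (Rle_trans _ (INR (size s) * (2 * q) * (42 * x ^ 36 / q ^ 2))).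
      by apply: Rmult_le_compat_l => //; apply: Rmult_le_pos; lra.
    apply: Rmult_le_compat_r.
      apply: Rmult_le_pos; first by have := xk0 36%N; lra.
      by apply: Rinv_ge0.
    by apply: Rmult_le_compat_r; lra.
  have -> : q * (2 * q) * (42 * x ^ 36 / q ^ 2) = 84 * x ^ 36 by field; lra.
  by have := xmono 36%N 45%N isT; lra.
have Sb : INR T * (INR (10 * j).+1 + 1) * ln (INR Y) * harmonic Y ^ 3 <= 319440 * q * x ^ 5.
  rewrite TE S_INR mult_INR (INR_lit 10) -/x /=.
  have -> : 319440 * q * x ^ 5 = 2 * q * (12 * x) * (10 * x) * (11 * x) ^ 3 by ring.
  have P0 : 0 <= 2 * q * (10 * x + 1 + 1) by apply: Rmult_le_pos; lra.
  apply: Rmult_le_compat; [by apply: Rmult_le_pos; lra|exact: pow_le| |by apply: pow_incr].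
  apply: Rmult_le_compat; [lra|lra| |lra].
  by apply: Rmult_le_compat_l; lra.
have Wb : W * (W + 1) * W * (1 + ln (INR X) ^ 2) <= q.
  apply: (Rle_trans _ (2 * x ^ 9 * (3 * x ^ 9) * (2 * x ^ 9) * (2 * x ^ 18))).
    have L2 : ln (INR X) ^ 2 <= x ^ 18.
      have -> : x ^ 18 = (x ^ 9) ^ 2 by ring.
      by apply: pow_incr; lra.
    have L20 := pow2_ge_0 (ln (INR X)); have := x1 18%N => X18.
    apply: Rmult_le_compat; [by apply: Rmult_le_pos; [apply: Rmult_le_pos; lra|lra]|lra| |lra].
    apply: Rmult_le_compat; [by apply: Rmult_le_pos; lra|lra| |lra].
    by apply: Rmult_le_compat; lra.
  have -> : 2 * x ^ 9 * (3 * x ^ 9) * (2 * x ^ 9) * (2 * x ^ 18) = 24 * x ^ 45 by ring.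
  by have := xk0 45%N; lra.
rewrite /M0 => H.
have x5 := x1 5%N; have X5 := xk0 5%N.
(* The small products give 319440 = 2 * 12 * 10 * 11^3, the other two terms at most q each, and 8 *
   319442 is below 3000000. *)
apply: (Rmult_le_reg_r (x ^ 5 / 8)); first lra.
have -> : INR (size s) * x ^ 2 * (x ^ 5 / 8) = INR (size s) * (x ^ 7 / 8) by field.
have : q <= q * x ^ 5 by rewrite -{1}[q]Rmult_1_r; apply: Rmult_le_compat_l; lra.
lra.
Qed.

(** * Mertens' theorems *)

Definition chebyshev_psi N := \sum_(1 <= n < N.+1) mangoldt n.

Lemma sum_ln_double N : \sum_(1 <= n < (2 * N).+1) ln (INR n) <=
  2 * \sum_(1 <= n < N.+1) ln (INR n) + 2 * INR N * ln 2.
Proof.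
elim: N => [|N IH]; first by rewrite muln0 big_geq // INR_0; lra.
rewrite mulnS add2n big_nat_recr //= big_nat_recr //= [X in _ <= 2 * X + _]big_nat_recr //=.
have P1 := INR_gt0 (ltn0Sn N); have P2 := INR_gt0 (ltn0Sn (2 * N)); have P3 := INR_gt0 (ltn0Sn (2 * N).+1).
have H : ln (INR (2 * N).+1) + ln (INR (2 * N).+2) <= 2 * ln (INR N.+1) + 2 * ln 2.
  have -> : 2 * ln (INR N.+1) + 2 * ln 2 = (ln (INR N.+1) + ln 2) + (ln (INR N.+1) + ln 2) by ring.
  rewrite -!ln_mult //; try lra; apply: ln_mono; first exact: Rmult_lt_0_compat.
  rewrite (S_INR (2 * N).+1) (S_INR (2 * N)) mult_INR (S_INR N) (INR_lit 2) /=.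
  by have := pos_INR N; nra.
have -> : 2 * INR N.+1 * ln 2 = 2 * INR N * ln 2 + 2 * ln 2 by rewrite S_INR; ring.
lra.
Qed.

(** Chebyshev's argument with the central binomial coefficient: in ln (2N)! - 2 ln N! the value
    Lambda(d) is multiplied by floor(2N/d) - 2 floor(N/d), which is nonnegative and at least 1 for N
    < d <= 2N. *)
Lemma chebyshev_psi_double N : chebyshev_psi (2 * N) <= chebyshev_psi N + 2 * INR N * ln 2.
Proof.
have NN : (N <= 2 * N)%N by lia.
have := sum_ln_double N; rewrite -!sum_mangoldt_floor.
rewrite /chebyshev_psi (@sum_split mangoldt xpredT 1 N.+1 (2 * N).+1) //.
rewrite (@sum_split (fun d => mangoldt d * INR ((2 * N) %/ d)) xpredT 1 N.+1 (2 * N).+1) //.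
have H1 : 2 * \sum_(1 <= n < N.+1) (mangoldt n * INR (N %/ n)) <=
    \sum_(1 <= i < N.+1) (mangoldt i * INR ((2 * N) %/ i)).
  rewrite -sumR_scal; apply: sumR_le_nat => d d0 _ _.
  have : INR (2 * (N %/ d)) <= INR ((2 * N) %/ d).
    by apply: leq_INR; rewrite leq_divRL // -mulnA leq_mul2l leq_divM orbT.
  by rewrite mult_INR (INR_lit 2) /=; have := mangoldt_ge0 d; nra.
have H2 : \sum_(N.+1 <= i < (2 * N).+1) mangoldt i <=
    \sum_(N.+1 <= i < (2 * N).+1) (mangoldt i * INR ((2 * N) %/ i)).
  apply: sumR_le_nat => d dN d2 _.
  have : 1 <= INR ((2 * N) %/ d) by apply: INR_ge1; rewrite divn_gt0 //; lia.
  by have := mangoldt_ge0 d; nra.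
lra.
Qed.

Lemma chebyshev_psi_le N : chebyshev_psi N <= 4 * INR N.
Proof.
have [_ l2] := ln2_bounds.
have H k : chebyshev_psi (2 ^ k) <= 2 * INR (2 ^ k).
  elim: k => [|k IH]; first by rewrite /chebyshev_psi big_nat1 mangoldt1 INR_1; lra.
  rewrite expnS; have := chebyshev_psi_double (2 ^ k); rewrite mult_INR (INR_lit 2) /=.
  by have := pos_INR (2 ^ k); nra.
case: N => [|N]; first by rewrite /chebyshev_psi big_geq // INR_0; lra.
pose k := trunc_log 2 N.+1; have /andP[k1 k2] := trunc_log_bounds (ltnSn 1) (ltn0Sn N).
apply: (Rle_trans _ (chebyshev_psi (2 ^ k.+1))).
  apply: (sum_range_le (P := predT)) => // [|i _ _]; [exact: ltnW|exact: mangoldt_ge0].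
apply: Rle_trans (H _) _; rewrite expnS mult_INR (INR_lit 2) /=.
by have := leq_INR k1; rewrite -/k; lra.
Qed.

Lemma sum_mangoldt_div_le N : (0 < N)%N ->
  \sum_(1 <= n < N.+1) (mangoldt n / INR n) <= ln (INR N) + 4.
Proof.
move=> N0; have N0' := INR_gt0 N0; apply: (Rmult_le_reg_l (INR N)) => //.
apply: (Rle_trans _ (\sum_(1 <= d < N.+1) (mangoldt d * INR (N %/ d) + mangoldt d))).
  rewrite -sumR_scal; apply: sumR_le_nat => d d0 _ _.
  have -> : INR N * (mangoldt d / INR d) = mangoldt d * (INR N / INR d).
    by field; have := INR_gt0 d0; lra.
  have -> : mangoldt d * INR (N %/ d) + mangoldt d = mangoldt d * INR (N %/ d).+1.
    by rewrite S_INR; ring.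
  apply: Rmult_le_compat_l; first exact: mangoldt_ge0.
  apply: (Rmult_le_reg_r (INR d)); first exact: INR_gt0.
  rewrite -mult_INR /Rdiv Rmult_assoc Rinv_l ?Rmult_1_r; last by have := INR_gt0 d0; lra.
  by apply: leq_INR; rewrite ltnW // ltn_ceil.
rewrite big_split /= sum_mangoldt_floor -/(chebyshev_psi N).
by have := sum_ln_le N; have := chebyshev_psi_le N; lra.
Qed.

Lemma sum_ln_div_square_le N : \sum_(2 <= n < N.+1) (ln (INR n) / (INR n * INR n.-1)) <= 2.
Proof.
(* The drop of [g] from n to n + 1 dominates the corresponding term, and [g] at 1 is the bound 2. *)
pose g n := (ln (INR n) + 2) / INR n.
have step n : (0 < n)%N -> ln (INR n.+1) / (INR n.+1 * INR n) <= g n - g n.+1.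
  move=> n0; have P := INR_gt0 n0; have P' := INR_gt0 (ltn0Sn n).
  apply: (Rmult_le_reg_r (INR n.+1 * INR n)); first exact: Rmult_lt_0_compat.
  have -> : (g n - g n.+1) * (INR n.+1 * INR n) =
    INR n.+1 * (ln (INR n) + 2) - INR n * (ln (INR n.+1) + 2) by rewrite /g; field; lra.
  have -> : ln (INR n.+1) / (INR n.+1 * INR n) * (INR n.+1 * INR n) = ln (INR n.+1) by field; lra.
  have H := Rmult_le_compat_l _ _ _ (Rlt_le _ _ P') (ln_succ_sub n0).
  have N1 := INR_ge1 n0.
  have : INR n.+1 * / INR n <= 2.
    by rewrite S_INR Rmult_plus_distr_r Rinv_r; [have := Rinv_le_contravar _ _ Rlt_0_1 N1; rewrite Rinv_1; lra|lra].
  rewrite (S_INR n) in H *; lra.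
case: N => [|N]; first by rewrite big_geq //; lra.
rewrite big_add1 /=.
apply: (Rle_trans _ (\sum_(1 <= n < N.+1) - (g n.+1 - g n))).
  apply: sumR_le_nat => n n0 _ _.
  by have := step n n0; lra.
rewrite sumR_opp sum_telescope //.
have -> : g 1%N = 2 by rewrite /g INR_1 ln_1; field.
have : 0 <= g N.+1; last lra.
apply: Rmult_le_pos; first by have := ln_INR_ge0 N.+1; lra.
by [].
Qed.

Lemma sum_prime_le_range (F : nat -> R) N : (forall n, (1 < n)%N -> 0 <= F n) ->
  \sum_(1 <= p < N.+1 | prime p) F p <= \sum_(2 <= n < N.+1) F n.
Proof.
move=> F0; rewrite (@big_nat_widenl _ _ _ 2 1) //; apply: sumR_subset => n _ /=.
  by move=> n1; exact: F0.
exact: prime_gt1.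
Qed.

Lemma geometric_tail_le (x : R) K : 0 <= x -> x < 1 -> \sum_(2 <= k < K) x ^ k <= x ^ 2 / (1 - x).
Proof.
move=> x0 x1; apply: (Rmult_le_reg_r (1 - x)); first lra.
have -> : x ^ 2 / (1 - x) * (1 - x) = x ^ 2 by field; lra.
case: (leqP 2 K) => K2; last first.
  by rewrite big_geq ?Rmult_0_l; [exact: pow2_ge_0|exact: ltnW].
rewrite big_distrl /=.
rewrite (eq_bigr (fun k => - (x ^ k.+1 - x ^ k))) => [|k _]; last by rewrite -tech_pow_Rmult; ring.
by rewrite sumR_opp sum_telescope //; have := pow_le _ K x0; lra.
Qed.

Definition mertens_sum N := \sum_(1 <= p < N.+1 | prime p) (ln (INR p) / INR p).

Lemma mertens_first N : (0 < N)%N -> Rabs (mertens_sum N - ln (INR N)) <= 4.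
Proof.
move=> N0; pose G n := / INR n.
have G0 n : 0 <= G n by exact: inv_INR_ge0.
have E : \sum_(1 <= n < N.+1) (mangoldt n / INR n) =
   mertens_sum N + \sum_(1 <= n < N.+1 | ~~ prime n) (mangoldt n * G n).
  rewrite (bigID prime) /=; congr (_ + _); apply: eq_bigr => p pp.
  by rewrite -{1}(expn1 p) mangoldt_pow.
have H1 := sum_mangoldt_div_le N0; have H2 := sum_mangoldt_div_ge N0.
have P0 : 0 <= \sum_(1 <= n < N.+1 | ~~ prime n) (mangoldt n * G n).
  by apply: sumR_ge0 => n _ _; apply: Rmult_le_pos => //; exact: mangoldt_ge0.
have P2 : \sum_(1 <= n < N.+1 | ~~ prime n) (mangoldt n * G n) <= 2.
  apply: Rle_trans (sum_nonprime_powers G0 (ltn_expl N (ltnSn 1))) _.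
  apply: Rle_trans (sum_ln_div_square_le N).
  apply: Rle_trans (sum_prime_le_range _ _); last first.
    move=> n n1; apply: Rmult_le_pos; first exact: ln_INR_ge0.
    by apply: Rinv_ge0; rewrite -mult_INR; apply: INR_gt0; rewrite muln_gt0; case: n n1 => [|[]].
  apply: sumR_le => p _ pp; rewrite sumR_scal; apply: Rmult_le_compat_l; first exact: ln_INR_ge0.
  have p2 : 2 <= INR p by rewrite -(INR_lit 2); apply: leq_INR; exact: prime_gt1.
  rewrite (eq_bigr (fun k => (/ INR p) ^ k)) => [|k _]; last by rewrite /G expn_INR pow_inv.
  have i1 : / INR p <= / 2 by apply: Rinv_le_contravar; lra.
  have i0 : 0 < / INR p by apply: Rinv_0_lt_compat; lra.
  apply: Rle_trans (geometric_tail_le N _ _) _; [lra|lra|].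
  have -> : INR p.-1 = INR p - 1 by rewrite -{2}(prednK (prime_gt0 pp)) S_INR; ring.
  by right; field; lra.
apply: Rabs_le; lra.
Qed.

(** Both g and e + g are nonincreasing and bounded below, the latter by the first value of the
    nondecreasing e - g. So e is a difference of convergent sequences. *)
Lemma ex_lim_of_telescoping_bound (e g : nat -> R) n0 :
  (forall n, (n0 <= n)%N -> Rabs (e n.+1 - e n) <= g n - g n.+1) ->
  (forall n, (n0 <= n)%N -> 0 <= g n) -> ex_finite_lim_seq e.
Proof.
move=> eg g0; suff [l H] : ex_finite_lim_seq (fun n => e (n + n0)%coq_nat).
  by exists l; apply/(is_lim_seq_incr_n e n0).
have H n : Rabs (e (n.+1 + n0)%coq_nat - e (n + n0)%coq_nat) <= g (n + n0)%N - g (n + n0).+1.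
  by rewrite !plusE; apply: eg; rewrite leq_addl.
have lg : ex_finite_lim_seq (fun n => g (n + n0)%N).
  apply: (ex_finite_lim_seq_decr _ 0) => n; last by apply: g0; rewrite leq_addl.
  by rewrite addSn; have := H n; have := Rabs_pos (e (n.+1 + n0)%coq_nat - e (n + n0)%coq_nat); lra.
have ls : ex_finite_lim_seq (fun n => e (n + n0)%coq_nat + g (n + n0)%N).
  apply: (ex_finite_lim_seq_decr _ (e n0 - g n0)) => n.
    by rewrite addSn; have /Rabs_le_between := H n; lra.
  suff : e n0 - g n0 <= e (n + n0)%coq_nat - g (n + n0)%N.
    by have := g0 (n + n0)%N (leq_addl _ _); lra.
  elim: n => [|n IH]; first by rewrite plusE add0n; lra.
  by rewrite addSn; have /Rabs_le_between := H n; lra.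
case: lg => l1 lg; case: ls => l2 ls; exists (l2 - l1).
apply: (is_lim_seq_ext (fun n => (e (n + n0)%coq_nat + g (n + n0)%N) - g (n + n0)%N)).
  by move=> n; ring.
exact: is_lim_seq_minus'.
Qed.

Definition log_mertens N := \sum_(1 <= p < N.+1 | prime p) - ln (1 - / INR p).

Lemma ln_gt0 n : (1 < n)%N -> 0 < ln (INR n).
Proof. by move=> n1; rewrite -ln_1; apply: ln_increasing; [lra|rewrite -INR_1; exact: ltn_INR]. Qed.

Lemma mertens_converges : ex_finite_lim_seq (fun N => log_mertens N - ln (ln (INR N))).
Proof.
pose S N := \sum_(1 <= p < N.+1 | prime p) / INR p.
pose Rm N := mertens_sum N - ln (INR N).
(* Partial summation from ln p / p to 1/p: after subtracting [Rm N / ln (INR N)], the remainder of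
   the first theorem enters the increments only as [Rm n * (/ a - / b)]. *)
pose e N := S N - ln (ln (INR N)) - Rm N / ln (INR N).
have step N (F : nat -> R) : \sum_(1 <= p < N.+2 | prime p) F p =
    \sum_(1 <= p < N.+1 | prime p) F p + (if prime N.+1 then F N.+1 else 0).
  by rewrite big_mkcond big_nat_recr //= -big_mkcond.
have [l1 c1] : ex_finite_lim_seq e.
  (* 5 = 4 + 1: 4 bounds [Rm], and 1 covers the error of replacing 1 - a/b by ln b - ln a. *)
  apply: (@ex_lim_of_telescoping_bound e (fun n => 5 * / ln (INR n)) 2) => n n2; last first.
    apply: Rmult_le_pos; first lra.
    by apply: Rinv_ge0; exact: ln_gt0.
  have n0 : (0 < n)%N by lia.
  have a0 := ln_gt0 n2; have b0 : 0 < ln (INR n.+1) by apply: ln_gt0; lia.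
  have D0 := ln_succ_sub_ge n0; have D1 := ln_succ_sub n0.
  have n1 := INR_ge1 n0.
  have i1 : / INR n <= 1 by have := Rinv_le_contravar _ _ Rlt_0_1 n1; rewrite Rinv_1.
  have i0 : 0 < / INR n.+1 by apply: Rinv_0_lt_compat; exact: INR_gt0.
  have RR := mertens_first n0; rewrite -/(Rm n) in RR.
  set a := ln (INR n) in a0 D0 D1 *; set b := ln (INR n.+1) in b0 D0 D1 *.
  have ab : a <= b by lra.
  have E : e n.+1 - e n = Rm n * (/ a - / b) - ((ln b - ln a) - (1 - a / b)).
    have SE : S n.+1 - S n = (Rm n.+1 + b - Rm n - a) / b.
      have -> : Rm n.+1 + b - Rm n - a = mertens_sum n.+1 - mertens_sum n by rewrite /Rm /a /b; ring.
      have P := INR_gt0 (ltn0Sn n).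
      by rewrite /S /mertens_sum !step -/b; case: ifP => _; field; lra.
    have -> : e n.+1 - e n = (S n.+1 - S n) - (ln b - ln a) - Rm n.+1 / b + Rm n / a.
      by rewrite /e /a /b; ring.
    by rewrite SE; field; lra.
  have d1 : 0 <= (ln b - ln a) - (1 - a / b).
    have := ln_ge_sub1 (Rdiv_lt_0_compat _ _ b0 a0); rewrite ln_div // Rinv_div; lra.
  have d2 : (ln b - ln a) - (1 - a / b) <= / a - / b.
    have := ln_le_sub1 (Rdiv_lt_0_compat _ _ b0 a0); rewrite ln_div // => H.
    have : (b / a - 1) - (1 - a / b) = (b - a) * (b - a) * / a * / b by field; lra.
    have : / a - / b = (b - a) * 1 * / a * / b by field; lra.
    have : (b - a) * (b - a) * / a * / b <= (b - a) * 1 * / a * / b.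
      have ia := Rinv_0_lt_compat _ a0; have ib := Rinv_0_lt_compat _ b0.
      do 2 (apply: Rmult_le_compat_r; first lra).
      by apply: Rmult_le_compat_l; lra.
    lra.
  have i : 0 <= / a - / b by lra.
  rewrite E; apply: Rle_trans (Rabs_triang _ _) _.
  rewrite Rabs_Ropp Rabs_mult (Rabs_pos_eq _ i) (Rabs_pos_eq _ d1).
  have := Rmult_le_compat_r _ _ _ i RR; lra.
have [l2 c2] : ex_finite_lim_seq (fun N => log_mertens N - S N).
  apply: (@ex_lim_of_telescoping_bound _ (fun n => / INR n) 1) => n n1; last first.
    by [].
  have P := INR_ge1 n1; have i0 : 0 <= / INR n - / INR n.+1.
    have : / INR n.+1 <= / INR n by apply: Rinv_le_contravar; [lra|exact: leq_INR].
    lra.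
  rewrite /log_mertens /S !step; case: ifP => _; last by rewrite (_ : _ - _ = 0) ?Rabs_R0 //; ring.
  set x := / INR n.+1; have xE : 1 - x = INR n / INR n.+1 by rewrite /x S_INR; field; lra.
  have x1 : 0 < 1 - x by rewrite xE; apply: Rdiv_lt_0_compat; [lra|exact: INR_gt0].
  rewrite (_ : _ - _ = - ln (1 - x) - x); last ring.
  have H1 := ln_le_sub1 x1; have H2 := ln_ge_sub1 x1.
  rewrite Rabs_pos_eq; last lra.
  have : / (1 - x) = 1 + / INR n by rewrite xE Rinv_div S_INR; field; lra.
  rewrite -/x; lra.
exists (l1 + l2 + 0).
have c3 : is_lim_seq (fun N => Rm N / ln (INR N)) 0.
  have li : is_lim_seq (fun N => / ln (INR N)) 0.
    apply: (is_lim_seq_inv _ p_infty) => //.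
    apply: (is_lim_comp_seq ln INR p_infty p_infty); [exact: is_lim_ln_p| |exact: is_lim_seq_INR].
    by exists 0%N.
  apply/is_lim_seq_abs_0; apply: (is_lim_seq_le_le_loc (fun _ => 0) _ (fun N => 4 * / ln (INR N))).
  - exists 2%N => n /leP n2; have n0 : (0 < n)%N by lia.
    split; first exact: Rabs_pos.
    have H := mertens_first n0; have L := Rinv_0_lt_compat _ (ln_gt0 n2).
    rewrite /Rdiv Rabs_mult (Rabs_pos_eq (/ _)); last lra.
    by apply: Rmult_le_compat_r; [lra|].
  - exact: is_lim_seq_const.
  - by have := is_lim_seq_scal_l _ 4 _ li; rewrite /= Rmult_0_r.
apply: (is_lim_seq_ext (fun N => e N + (log_mertens N - S N) + Rm N / ln (INR N))).
  by move=> n; rewrite /e; ring.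
by apply: is_lim_seq_plus' => //; exact: is_lim_seq_plus'.
Qed.

(** * Euler products and the Basel sum *)

Section EulerProduct.
Variable f : nat -> R.
Hypotheses (fM : forall m n, (0 < m)%N -> (0 < n)%N -> f (m * n)%N = f m * f n).
Hypotheses (f0 : forall n, 0 <= f n) (f1 : f 1%N = 1) (fp : forall p, prime p -> f p < 1).

Let smooth (s : seq nat) n := all (mem s) (primes n).
Let S s N := \sum_(1 <= n < N.+1 | smooth s n) f n.

Let S_mono s M N : (M <= N)%N -> S s M <= S s N.
Proof. by move=> MN; apply: sum_range_le. Qed.

Let S_cons p s N : prime p -> p \notin s -> S (p :: s) N = S s N + f p * S (p :: s) (N %/ p).
Proof.
move=> pp ps; have p0 := prime_gt0 pp; rewrite /S (bigID (fun n => p %| n)) /= Rplus_comm.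
congr (_ + _).
  rewrite big_nat_cond [RHS]big_nat_cond; apply: eq_bigl => n; case: (leqP 1 n) => //= n0.
  case: (n < N.+1)%N => //=; apply/andP/idP => [[/allP H pn]|/allP H].
    apply/allP => q qn; have := H q qn; rewrite /= inE => /orP[/eqP E|//].
    by move: qn; rewrite E mem_primes (negPf pn) !andbF.
  split; first by apply/allP => q /H /= qs; rewrite inE qs orbT.
  by apply: contra ps => pn; apply: H; rewrite mem_primes pp n0.
rewrite (eq_bigl (fun n => (p %| n)%N && smooth (p :: s) n)) => [|n]; last by rewrite andbC.
rewrite big_mkcondr /= (@sum_multiples (fun n => if smooth (p :: s) n then f n else 0)) //.
rewrite -sumR_scal (eq_bigl (fun k => k < (N %/ p).+1)%N) => [|k]; last by rewrite ltnS leq_divRL // mulnC.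
rewrite -(@big_nat_widen _ _ _ 1 (N %/ p).+1 N.+1 predT); last by rewrite ltnS leq_div.
rewrite [RHS]big_mkcond; apply: eq_big_nat => k /andP[k0 _].
have -> : smooth (p :: s) (p * k)%N = smooth (p :: s) k.
  apply/allP/allP => H q; last by rewrite primesM // primes_prime // inE => /orP[/eqP ->|/H //]; rewrite /= inE eqxx.
  by move=> qk; apply: H; rewrite primesM // qk orbT.
by case: ifP => _ //; rewrite fM.
Qed.

Let S_nil N : (0 < N)%N -> S [::] N = 1.
Proof.
move=> N0; rewrite /S big_mkcond (eq_big_nat _ _ (F2 := fun n => if n == 1%N then f n else 0)).
  by rewrite -big_mkcond big_nat1_eq /= ltnS N0 f1.
move=> n /andP[n0 _]; case: (eqVneq n 1%N) => [->|n1] //.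
case: ifP => // /allP/(_ (pdiv n)); rewrite mem_primes pdiv_dvd n0 pdiv_prime; last by lia.
by move/(_ isT).
Qed.

(** Only finitely many primes enter. Sorting by divisibility by p gives [S_cons], which first bounds
    the partial sums and then, in the limit, reads l = Q + f(p) l. *)
Let smooth_lim s : uniq s -> all prime s ->
  is_lim_seq (S s) (\prod_(p <- s) / (1 - f p)).
Proof.
elim: s => [|p s IH] /=.
  move=> _ _; rewrite big_nil; apply: (is_lim_seq_ext_loc (fun _ => 1)); last exact: is_lim_seq_const.
  by exists 1%N => n /leP n0; rewrite S_nil.
move=> /andP[ps us] /andP[pp sp]; have L := IH us sp; have p1 := fp pp; have fp0 := f0 p.
set Q := \prod_(p <- s) / (1 - f p) in L.
have Sb N : S (p :: s) N <= Q / (1 - f p).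
  apply: (Rmult_le_reg_r (1 - f p)); first lra.
  have -> : Q / (1 - f p) * (1 - f p) = Q by field; lra.
  apply: (Rle_trans _ (S s N)).
    have := S_cons N pp ps; have := S_mono (p :: s) (leq_div N p).
    move=> H; have := Rmult_le_compat_l _ _ _ fp0 H.
    by move: (S _ N) (S _ (N %/ p)) (S s N) => a b c; lra.
  have := is_lim_seq_incr_compare (S s) Q L; apply => n; exact: S_mono.
have [l Ll] : ex_finite_lim_seq (S (p :: s)).
  by apply: (ex_finite_lim_seq_incr _ (Q / (1 - f p))) => // n; exact: S_mono.
have Lp : is_lim_seq (fun N => S (p :: s) (N %/ p)) l.
  apply: (is_lim_seq_subseq _ _ (fun N => (N %/ p)%N)) => // P [n0 Hn0].
  exists (n0 * p)%N => n /leP nn; apply: Hn0; apply/leP.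
  by rewrite leq_divRL // prime_gt0.
have E : l = Q + f p * l.
  have := is_lim_seq_plus' _ _ _ _ L (is_lim_seq_scal_l _ (f p) _ Lp).
  move/(is_lim_seq_ext _ (S (p :: s)) _ (fun n => esym (S_cons n pp ps)))/is_lim_seq_unique.
  by rewrite (is_lim_seq_unique _ _ Ll) /= => -[].
have -> : \prod_(q <- p :: s) / (1 - f q) = l; last exact: Ll.
rewrite big_cons -/Q (_ : Q = l * (1 - f p)); [field|]; lra.
Qed.

Definition primes_upto N := [seq p <- index_iota 1 N.+1 | prime p].

Lemma primes_upto_uniq N : uniq (primes_upto N).
Proof. by apply: filter_uniq; exact: iota_uniq. Qed.

Lemma mem_primes_upto N p : (p \in primes_upto N) = prime p && (p <= N)%N.
Proof.
rewrite mem_filter mem_index_iota ltnS; case: (boolP (prime p)) => //= pp.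
by rewrite prime_gt0.
Qed.

Lemma euler_product_ge N : \sum_(1 <= n < N.+1) f n <= \prod_(p <- primes_upto N) / (1 - f p).
Proof.
have sp : all prime (primes_upto N) by exact: filter_all.
have L := smooth_lim (primes_upto_uniq N) sp.
apply: (Rle_trans _ (S (primes_upto N) N)); last first.
  by have := is_lim_seq_incr_compare _ _ L; apply => n; exact: S_mono.
rewrite big_nat_cond /S [X in _ <= X]big_nat_cond; right; apply: eq_bigl => n.
case: (boolP (0 < n < N.+1)%N) => //= /andP[n0 nN]; apply/esym/allP => p.
rewrite mem_primes => /and3P[pp _ pn]; rewrite /= mem_primes_upto pp -ltnS.
by apply: leq_ltn_trans nN; exact: dvdn_leq.
Qed.

Lemma euler_product_le N B : (forall M, \sum_(1 <= n < M.+1) f n <= B) ->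
  \prod_(p <- primes_upto N) / (1 - f p) <= B.
Proof.
move=> HB; have sp : all prime (primes_upto N) by exact: filter_all.
have L := smooth_lim (primes_upto_uniq N) sp.
apply: (is_lim_seq_le (S (primes_upto N)) (fun _ => B) (Finite _) (Finite B) _ L (is_lim_seq_const B)).
move=> M; apply: Rle_trans (HB M); apply: sumR_subset => //.
Qed.

End EulerProduct.

(** The integral comparison in discrete form: from n to n + 1, n^-d drops by at least d (n +
    1)^(-1-d). *)
Lemma power_weight_sum_le d N : 0 < d -> \sum_(1 <= n < N.+1) power_weight d n <= 1 + / d.
Proof.
move=> d0; pose e n := exp (- d * ln (INR n)).
have step n : (0 < n)%N -> d * power_weight d n.+1 <= e n - e n.+1.
  move=> n0; rewrite power_weightE // -/(e n.+1).
  have -> : e n = e n.+1 * exp (d * (ln (INR n.+1) - ln (INR n))).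
    by rewrite /e -exp_plus; congr exp; ring.
  have e0 : 0 < e n.+1 := exp_pos _.
  have H := exp_ineq1_le (d * (ln (INR n.+1) - ln (INR n))).
  have H2 := Rmult_le_compat_l _ _ _ (Rlt_le _ _ d0) (ln_succ_sub_ge n0).
  have : d * / INR n.+1 <= exp (d * (ln (INR n.+1) - ln (INR n))) - 1 by lra.
  by move/(Rmult_le_compat_l _ _ _ (Rlt_le _ _ e0)); rewrite /Rdiv; lra.
have di : 0 < / d by apply: Rinv_0_lt_compat.
case: N => [|N]; first by rewrite big_geq //; lra.
rewrite big_nat_recl // {1}/power_weight INR_1 ln_1 Rmult_0_r exp_0.
apply: Rplus_le_compat_l; apply: (Rmult_le_reg_l d) => //; rewrite Rinv_r; last lra.
rewrite -sumR_scal; apply: (Rle_trans _ (\sum_(1 <= n < N.+1) - (e n.+1 - e n))).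
  by apply: sumR_le_nat => n n0 _ _; have := step n n0; lra.
rewrite sumR_opp sum_telescope // {2}/e INR_1 ln_1 Rmult_0_r exp_0.
by have := exp_pos (- d * ln (INR N.+1)); rewrite -/(e N.+1); lra.
Qed.

Lemma power_weight_sum_ge d N : 0 < d ->
  (1 - exp (- d * ln (INR N.+1))) / d <= \sum_(1 <= n < N.+1) power_weight d n.
Proof.
move=> d0; pose e n := exp (- d * ln (INR n)).
have step n : (0 < n)%N -> e n - e n.+1 <= d * power_weight d n.
  move=> n0; rewrite power_weightE // -/(e n).
  have -> : e n.+1 = e n * exp (- (d * (ln (INR n.+1) - ln (INR n)))).
    by rewrite /e -exp_plus; congr exp; ring.
  have e0 : 0 < e n := exp_pos _.
  have H := exp_ineq1_le (- (d * (ln (INR n.+1) - ln (INR n)))).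
  have H2 := Rmult_le_compat_l _ _ _ (Rlt_le _ _ d0) (ln_succ_sub n0).
  have : 1 - exp (- (d * (ln (INR n.+1) - ln (INR n)))) <= d * / INR n by lra.
  by move/(Rmult_le_compat_l _ _ _ (Rlt_le _ _ e0)); rewrite /Rdiv; lra.
apply: (Rmult_le_reg_l d) => //; rewrite -sumR_scal.
have -> : d * ((1 - exp (- d * ln (INR N.+1))) / d) = \sum_(1 <= n < N.+1) - (e n.+1 - e n).
  rewrite sumR_opp sum_telescope // /e INR_1 ln_1 Rmult_0_r exp_0; field; lra.
by apply: sumR_le_nat => n n0 _ _; have := step n n0; lra.
Qed.

(* sin^-2 x = (sin^-2 (x/2) + sin^-2 ((pi - x)/2)) / 4 doubles the number of sample points. *)
Lemma csc2_double x : 0 < x -> x < PI ->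
  / sin x ^ 2 = (/ sin (x / 2) ^ 2 + / sin ((PI - x) / 2) ^ 2) / 4.
Proof.
move=> x0 x1; have s0 : 0 < sin (x / 2) by apply: sin_gt_0; lra.
have c0 : 0 < cos (x / 2) by apply: cos_gt_0; lra.
have -> : sin ((PI - x) / 2) = cos (x / 2).
  by rewrite -cos_shift; congr cos; field.
have -> : sin x = 2 * sin (x / 2) * cos (x / 2) by rewrite -sin_2a; congr sin; field.
have := sin2_cos2 (x / 2); rewrite /Rsqr => E.
have -> : / (2 * sin (x / 2) * cos (x / 2)) ^ 2 =
  (sin (x / 2) * sin (x / 2) + cos (x / 2) * cos (x / 2)) / (2 * sin (x / 2) * cos (x / 2)) ^ 2.
  by rewrite E; field; lra.
by field; lra.
Qed.

(** The midpoints of the 2^n equal parts of (0, PI/2); their inverse squares are proportional to the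
    1/(2k+1)^2. *)
Definition csc_sample n k := INR (2 * k).+1 * PI / INR (2 ^ n.+2).

Lemma INR_exp2_gt0 n : 0 < INR (2 ^ n).
Proof. by apply: INR_gt0; rewrite expn_gt0. Qed.

Lemma csc_sample_bounds n k : (k < 2 ^ n)%N -> 0 < csc_sample n k < PI / 2.
Proof.
move=> kn; have P := INR_exp2_gt0 n.+2; have pi0 := PI_RGT_0.
have H : INR (2 * k).+1 < INR (2 ^ n.+1) by apply: ltn_INR; rewrite expnS; lia.
have E : INR (2 ^ n.+2) = 2 * INR (2 ^ n.+1) by rewrite [in LHS]expnS mult_INR (INR_lit 2).
have K0 := INR_gt0 (ltn0Sn (2 * k)).
split; first by apply: Rdiv_lt_0_compat => //; exact: Rmult_lt_0_compat.
apply: (Rmult_lt_reg_r (INR (2 ^ n.+2))) => //.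
have -> : csc_sample n k * INR (2 ^ n.+2) = INR (2 * k).+1 * PI by rewrite /csc_sample; field; lra.
rewrite E; have := Rmult_lt_compat_r _ _ _ pi0 H; lra.
Qed.

(** Duplication sends each point x to x/2 and (PI - x)/2. These are all the points of the next
    level, the second kind filling the upper half in reverse order. *)
Lemma csc2_sum n : \sum_(0 <= k < 2 ^ n) / sin (csc_sample n k) ^ 2 = 2 * 4 ^ n.
Proof.
elim: n => [|n IH].
  rewrite expn0 big_nat1 /csc_sample muln0 INR_1 (INR_lit (2 ^ 2)) /= Rmult_1_l sin_PI4 pow_O.
  have s2 := Rlt_sqrt2_0; have E : sqrt 2 ^ 2 = 2 by rewrite pow2_sqrt; lra.
  by rewrite /Rdiv Rpow_mult_distr pow_inv E pow1; field.
have P := INR_exp2_gt0 n.+2; have P' := INR_exp2_gt0 n.+3.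
have E : INR (2 ^ n.+3) = 2 * INR (2 ^ n.+2) by rewrite [in LHS]expnS mult_INR (INR_lit 2).
rewrite expnS mul2n -addnn (@sum_split _ _ 0 (2 ^ n)) ?leq_addr // (sum_shift _ (2 ^ n)).
rewrite [X in _ + X]big_nat_rev /= -big_split /=.
have -> : 2 * 4 ^ n.+1 = 4 * (2 * 4 ^ n) by rewrite -tech_pow_Rmult; ring.
rewrite -IH -sumR_scal; apply: eq_big_nat => k /andP[_ kn].
have [s0 s1] := csc_sample_bounds kn; rewrite (csc2_double s0); last by have := PI_RGT_0; lra.
have -> : csc_sample n k / 2 = csc_sample n.+1 k by rewrite /csc_sample E; field; lra.
have -> : (PI - csc_sample n k) / 2 = csc_sample n.+1 (2 ^ n + (0 + 2 ^ n - k.+1)).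
  have F : INR (2 * (2 ^ n + (0 + 2 ^ n - k.+1))).+1 = INR (2 ^ n.+2) - INR (2 * k).+1.
    have -> : (2 ^ n.+2 = (2 * (2 ^ n + (0 + 2 ^ n - k.+1))).+1 + (2 * k).+1)%N by rewrite !expnS; lia.
    by rewrite plus_INR; ring.
  by rewrite /csc_sample F E; field; lra.
lra.
Qed.

(** The inequalities sin x <= x <= tan x squared, with sin^-2 - 1 = cot^2. *)
Lemma csc2_inverse_square x : 0 < x < PI / 2 -> / sin x ^ 2 - 1 <= / x ^ 2 <= / sin x ^ 2.
Proof.
move=> [x0 x1]; have s0 : 0 < sin x by apply: sin_gt_0; lra.
have c0 : 0 < cos x by apply: cos_gt_0; lra.
have sx : sin x < x by exact: sin_lt_x.
have cx : x * cos x <= sin x.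
  pose g y := sin y - y * cos y.
  have [c [c1 c2]] : exists c, (Rmin 0 x <= c <= Rmax 0 x) /\ g x - g 0 = c * sin c * (x - 0).
    apply: (MVT_gen g 0 x (fun c => c * sin c)).
      by move=> y _; rewrite /g; auto_derive => //; ring.
    move=> y _; apply: continuity_pt_minus; first exact: continuity_sin.
    apply: continuity_pt_mult; [exact: continuity_pt_id|exact: continuity_cos].
  move: c1 c2; rewrite Rmin_left ?Rmax_right; try lra.
  move=> [c1 c1'] c2; have := sin_ge_0 c c1 => sc.
  have : 0 <= c * sin c * (x - 0) by apply: Rmult_le_pos; [apply: Rmult_le_pos => //; apply: sc|]; lra.
  by rewrite -c2 /g sin_0; lra.
have s2 : 0 < sin x ^ 2 by exact: pow_lt.
split; last first.
  by apply: Rinv_le_contravar => //; apply: pow_incr; lra.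
have -> : / sin x ^ 2 - 1 = (cos x / sin x) ^ 2.
  have := sin2_cos2 x; rewrite /Rsqr => E.
  by rewrite (_ : / sin x ^ 2 = (sin x * sin x + cos x * cos x) / sin x ^ 2); [field|rewrite E; field]; lra.
rewrite -pow_inv; apply: pow_incr; split.
  by apply: Rlt_le; exact: Rdiv_lt_0_compat.
apply: (Rmult_le_reg_r (x * sin x)); first exact: Rmult_lt_0_compat.
have -> : cos x / sin x * (x * sin x) = x * cos x by field; lra.
by have -> : / x * (x * sin x) = sin x by field; lra.
Qed.

Definition odd_zeta2 N := \sum_(0 <= k < N) / INR (2 * k).+1 ^ 2.
Definition zeta2 N := \sum_(1 <= n < N.+1) / INR n ^ 2.

Lemma odd_zeta2_bounds n : PI ^ 2 / 8 - PI ^ 2 / 16 * (/ 2) ^ n <= odd_zeta2 (2 ^ n) <= PI ^ 2 / 8.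
Proof.
have pi0 := PI_RGT_0; have q0 := INR_exp2_gt0 n.
have qE : INR (2 ^ n.+2) = 4 * INR (2 ^ n) by rewrite !expnS !mult_INR (INR_lit 2) /=; ring.
have E k : / INR (2 * k).+1 ^ 2 = PI ^ 2 / (16 * INR (2 ^ n) ^ 2) * / csc_sample n k ^ 2.
  rewrite /csc_sample qE; have := INR_gt0 (ltn0Sn (2 * k)) => P; field; lra.
have C := csc2_sum n; have four : 4 ^ n = INR (2 ^ n) ^ 2.
  rewrite expn_INR (INR_lit 2) /= (_ : 4 = 2 * 2); last lra.
  by rewrite Rpow_mult_distr; ring.
rewrite four in C.
have B : INR (2 ^ n) ^ 2 * 2 - INR (2 ^ n) <= \sum_(0 <= k < 2 ^ n) / csc_sample n k ^ 2 <= INR (2 ^ n) ^ 2 * 2.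
  split.
    have -> : INR (2 ^ n) ^ 2 * 2 - INR (2 ^ n) = \sum_(0 <= k < 2 ^ n) (/ sin (csc_sample n k) ^ 2 - 1).
      by rewrite sumR_sub C sumR_const count_predT size_iota subn0; ring.
    apply: sumR_le_nat => k _ kn _.
    by have [] := csc2_inverse_square (csc_sample_bounds kn).
  rewrite Rmult_comm -C; apply: sumR_le_nat => k _ kn _.
  by have [] := csc2_inverse_square (csc_sample_bounds kn).
rewrite /odd_zeta2; under eq_bigr do rewrite E.
rewrite sumR_scal; set c := PI ^ 2 / (16 * _); have c0 : 0 <= c.
  apply: Rlt_le; apply: Rdiv_lt_0_compat; first exact: pow_lt.
  by apply: Rmult_lt_0_compat; [lra|exact: pow_lt].
have -> : PI ^ 2 / 8 = c * (INR (2 ^ n) ^ 2 * 2) by rewrite /c; field; lra.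
have -> : PI ^ 2 / 16 * (/ 2) ^ n = c * INR (2 ^ n).
  rewrite pow_inv -(_ : INR (2 ^ n) = 2 ^ n); last by rewrite expn_INR.
  by rewrite /c; field; lra.
by rewrite -Rmult_minus_distr_l; split; apply: Rmult_le_compat_l; lra.
Qed.

Lemma zeta2_le N : zeta2 N <= 2.
Proof.
case: N => [|N]; first by rewrite /zeta2 big_geq //; lra.
rewrite /zeta2 big_nat_recl // INR_1 pow1.
apply: (Rle_trans _ (/ 1 + \sum_(1 <= n < N.+1) - (/ INR n.+1 - / INR n))).
  apply: Rplus_le_compat_l; apply: sumR_le_nat => n n0 _ _.
  have P := INR_gt0 n0; rewrite S_INR.
  have -> : - (/ (INR n + 1) - / INR n) = / (INR n * (INR n + 1)) by field; lra.
  by apply: Rinv_le_contravar; nra.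
rewrite sumR_opp sum_telescope // INR_1.
by have := Rinv_0_lt_compat _ (INR_gt0 (ltn0Sn N)); lra.
Qed.

Lemma zeta2S N : zeta2 N.+1 = zeta2 N + / INR N.+1 ^ 2.
Proof. by rewrite /zeta2 big_nat_recr. Qed.

Lemma zeta2_double N : zeta2 (2 * N) = odd_zeta2 N + zeta2 N / 4.
Proof.
elim: N => [|N IH]; first by rewrite /zeta2 /odd_zeta2 muln0 !big_geq //; lra.
rewrite mulnS add2n !zeta2S IH /odd_zeta2 big_nat_recr //=.
have -> : INR (2 * N).+2 = 2 * INR N.+1.
  by rewrite (S_INR (2 * N).+1) (S_INR (2 * N)) mult_INR (S_INR N) (INR_lit 2) /=; ring.
by have := INR_gt0 (ltn0Sn N) => P; field; have := INR_gt0 (ltn0Sn (2 * N)); lra.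
Qed.

Lemma basel : is_lim_seq zeta2 (PI ^ 2 / 6).
Proof.
have inv0 n : 0 <= / INR n ^ 2.
  case: n => [|n]; first by rewrite INR_0 pow_i ?Rinv_0; [lra|lia].
  by apply: Rinv_ge0; apply: pow_lt; exact: INR_gt0.
have [z Lz] : ex_finite_lim_seq zeta2.
  apply: (ex_finite_lim_seq_incr _ 2) => n; last exact: zeta2_le.
  by apply: sum_range_le => // i _ _.
have sub (u : nat -> nat) : (forall n, (n <= u n)%N) -> is_lim_seq (fun n => zeta2 (u n)) z.
  move=> un; apply: (is_lim_seq_subseq _ _ u) => // P [n0 Hn0].
  by exists n0 => n /leP nn; apply: Hn0; apply/leP; exact: leq_trans nn (un n).
have le2 n : (n <= 2 ^ n)%N by rewrite ltnW // ltn_expl.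
have L1 := sub (fun n => 2 ^ n)%N le2.
have L2 := sub (fun n => 2 * 2 ^ n)%N (fun n => leq_trans (le2 n) (leq_pmull (2 ^ n) (ltn0Sn 1))).
have L3 : is_lim_seq (fun n => odd_zeta2 (2 ^ n)) (PI ^ 2 / 8).
  apply: (is_lim_seq_le_le _ _ _ _ odd_zeta2_bounds); last exact: is_lim_seq_const.
  have -> : Finite (PI ^ 2 / 8) = Finite (PI ^ 2 / 8 - PI ^ 2 / 16 * 0) by congr Finite; ring.
  apply: is_lim_seq_minus'; first exact: is_lim_seq_const.
  apply: (is_lim_seq_scal_l _ _ 0); apply: is_lim_seq_geom; rewrite Rabs_pos_eq; lra.
have L4 := is_lim_seq_plus' _ _ _ _ L3 (is_lim_seq_scal_l _ (/ 4) _ L1).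
have E : z = PI ^ 2 / 8 + / 4 * z.
  have H n : odd_zeta2 (2 ^ n) + / 4 * zeta2 (2 ^ n) = zeta2 (2 * 2 ^ n).
    by rewrite zeta2_double; lra.
  have := is_lim_seq_unique _ _ (is_lim_seq_ext _ _ _ H L4).
  by rewrite (is_lim_seq_unique _ _ L2) => -[].
have <- : z = PI ^ 2 / 6 by lra.
exact: Lz.
Qed.

Lemma prime_product_zeta2 :
  is_lim_seq (fun N => \prod_(p <- primes_upto N) (1 - / INR p ^ 2)) (6 / PI ^ 2).
Proof.
pose f n := / INR n ^ 2; have pi0 := PI_RGT_0.
have f0 n : 0 <= f n.
  case: n => [|n]; first by rewrite /f INR_0 pow_i ?Rinv_0; [lra|lia].
  by apply: Rinv_ge0; apply: pow_lt; exact: INR_gt0.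
have fM m n : (0 < m)%N -> (0 < n)%N -> f (m * n)%N = f m * f n.
  by move=> m0 n0; rewrite /f mult_INR Rpow_mult_distr Rinv_mult.
have f1 : f 1%N = 1 by rewrite /f INR_1 pow1 Rinv_1.
have fp p : prime p -> f p < 1.
  move=> pp; have p2 : 2 <= INR p by rewrite -(INR_lit 2); apply: leq_INR; exact: prime_gt1.
  have : / INR p ^ 2 <= / 2 ^ 2 by apply: Rinv_le_contravar; [lra|apply: pow_incr; lra].
  by rewrite /f; lra.
have zb M : zeta2 M <= PI ^ 2 / 6.
  have := is_lim_seq_incr_compare _ _ basel; apply => n.
  by apply: sum_range_le => // i _ _; exact: f0.
have L : is_lim_seq (fun N => \prod_(p <- primes_upto N) / (1 - f p)) (PI ^ 2 / 6).
  apply: (is_lim_seq_le_le zeta2 _ (fun _ => PI ^ 2 / 6)); [|exact: basel|exact: is_lim_seq_const].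
  by move=> N; split; [exact: euler_product_ge|exact: euler_product_le].
apply: (is_lim_seq_ext (fun N => / \prod_(p <- primes_upto N) / (1 - f p))).
  move=> N; rewrite prodR_inv; apply: eq_bigr => p _; exact: Rinv_inv.
have -> : Finite (6 / PI ^ 2) = Rbar_inv (PI ^ 2 / 6) by rewrite /=; congr Finite; field; lra.
apply: is_lim_seq_inv => //; case; have := pow_lt _ 2 pi0; lra.
Qed.

(** * The constant in Mertens' third theorem *)

Lemma harmonic_ln_lim : is_lim_seq (fun n => harmonic n - ln (INR n)) euler_gamma.
Proof.
have [l L] : ex_finite_lim_seq (fun n => harmonic n - ln (INR n)).
  apply: (@ex_lim_of_telescoping_bound _ (fun n => / INR n) 1) => n n1; last first.
    by [].
  have H1 := ln_succ_sub n1; have H2 := ln_succ_sub_ge n1.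
  rewrite (_ : harmonic n.+1 = harmonic n + / INR n.+1); last by rewrite /harmonic big_nat_recr.
  by apply: Rabs_le; lra.
suff -> : euler_gamma = l by [].
(* In the definition of [euler_gamma] the index starts at 0, so its N-th term is the harmonic
   expression at N + 1. *)
rewrite /euler_gamma (Lim_seq_ext _ (fun n => harmonic (n + 1)%coq_nat - ln (INR (n + 1)%coq_nat))).
  by rewrite (is_lim_seq_unique _ _ (proj1 (is_lim_seq_incr_n _ 1 _) L)).
move=> n; rewrite plusE addn1; congr (_ - _).
elim: n => [|n IH]; first by rewrite /harmonic big_nat1.
by rewrite /= IH /harmonic [RHS]big_nat_recr.
Qed.

(** Abel's theorem for finite K: summation by parts leaves a last term and an average of d(k) - l
    with weights (1 - y) y^k. The first n0 terms carry weight at most 1 - y each, and all later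
    deviations are below eps/2. *)
Lemma abel_mean (d : nat -> R) (l : R) : d 0%N = 0 -> is_lim_seq d l -> forall eps, 0 < eps ->
  exists2 eta, 0 < eta & forall y, 1 - eta < y -> 0 < y < 1 ->
  exists K0, forall K, (K0 <= K)%N ->
  Rabs (\sum_(1 <= k < K.+1) ((d k - d k.-1) * y ^ k) - l) <= eps.
Proof.
move=> d0 dl eps e0; have e2 : 0 < eps / 2 by lra.
have [n0 Hn0] := proj2 (is_lim_seq_spec _ _) dl (mkposreal _ e2).
pose B := \sum_(0 <= k < n0) Rabs (d k - l).
have B0 : 0 <= B by apply: sumR_ge0 => *; exact: Rabs_pos.
exists (eps / (2 * (B + 1))); first by apply: Rdiv_lt_0_compat; lra.
move=> y y1 [y0 y2]; exists n0 => K n0K.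
have E : \sum_(1 <= k < K.+1) ((d k - d k.-1) * y ^ k) - l =
    (d K - l) * y ^ K + \sum_(0 <= k < K) ((d k - l) * ((1 - y) * y ^ k)).
  elim: K {n0K} => [|K IH]; first by rewrite !big_geq // d0 pow_O; ring.
  rewrite [X in X - l = _]big_nat_recr //= [X in _ = _ + X]big_nat_recr //=.
  by rewrite -!tech_pow_Rmult; lra.
have yk k : 0 < (1 - y) * y ^ k by apply: Rmult_lt_0_compat; [lra|exact: pow_lt].
rewrite E; apply: Rle_trans (Rabs_triang _ _) _.
have H1 : Rabs ((d K - l) * y ^ K) <= eps / 2 * y ^ K.
  have yK := pow_lt y K y0.
  rewrite Rabs_mult (Rabs_pos_eq (y ^ K)); last lra.
  apply: Rmult_le_compat_r; first lra.
  by apply: Rlt_le; apply: Hn0; apply/leP.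
have H2 : Rabs (\sum_(0 <= k < K) ((d k - l) * ((1 - y) * y ^ k))) <=
   B * (1 - y) + \sum_(n0 <= k < K) (eps / 2 * ((1 - y) * y ^ k)).
  apply: Rle_trans (sumR_abs _ _ _) _; rewrite (@sum_split _ _ 0 n0) //; apply: Rplus_le_compat.
    rewrite /B big_distrl /=; apply: sumR_le => k _ _; rewrite Rabs_mult (Rabs_pos_eq (_ * _)); last by have := yk k; lra.
    apply: Rmult_le_compat_l; first exact: Rabs_pos.
    have := pow_incr y 1 k; rewrite pow1 => H; have := H (conj (Rlt_le _ _ y0) (Rlt_le _ _ y2)).
    by have := pow_lt y k y0; nra.
  apply: sumR_le_nat => k nk _ _.
  rewrite Rabs_mult (Rabs_pos_eq (_ * _)); last by have := yk k; lra.
  apply: Rmult_le_compat_r; first by have := yk k; lra.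
  by apply: Rlt_le; apply: Hn0; apply/leP.
have H3 : \sum_(n0 <= k < K) (eps / 2 * ((1 - y) * y ^ k)) = eps / 2 * (y ^ n0 - y ^ K).
  rewrite sumR_scal (eq_bigr (fun k => - (y ^ k.+1 - y ^ k))) => [|k _].
    by rewrite sumR_opp sum_telescope //; ring.
  by rewrite -tech_pow_Rmult; ring.
have H4 : y ^ n0 <= 1.
  by have := pow_incr y 1 n0; rewrite pow1; apply; lra.
have H5 : B * (1 - y) <= eps / 2.
  have H6 : 1 - y <= eps / (2 * (B + 1)) by lra.
  have := Rmult_le_compat_l _ _ _ B0 H6.
  have : B * (eps / (2 * (B + 1))) <= eps / 2.
    have -> : B * (eps / (2 * (B + 1))) = eps / 2 * (B / (B + 1)) by field; lra.
    rewrite -[X in _ <= X]Rmult_1_r; apply: Rmult_le_compat_l; first lra.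
    by apply: (Rmult_le_reg_r (B + 1)); [lra|rewrite /Rdiv Rmult_assoc Rinv_l; lra].
  lra.
have : eps / 2 * y ^ n0 <= eps / 2 * 1 by apply: Rmult_le_compat_l; lra.
rewrite H3 in H2; lra.
Qed.

(** The truncation error has derivative t^K / (1 - t), and the mean value theorem bounds it. *)
Lemma log_series_bounds y K : 0 < y < 1 ->
  - ln (1 - y) - y ^ K.+1 / (1 - y) <= \sum_(1 <= k < K.+1) (/ INR k * y ^ k) <= - ln (1 - y).
Proof.
move=> [y0 y1]; pose s t := \sum_(1 <= k < K.+1) (/ INR k * t ^ k).
have ds N t : is_derive (fun u => \sum_(1 <= k < N.+1) (/ INR k * u ^ k)) t (\sum_(0 <= k < N) t ^ k).
  elim: N => [|k IH].
    rewrite big_geq //; apply: (is_derive_ext (fun _ => 0)); first by move=> u; rewrite big_geq.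
    exact: is_derive_const.
  rewrite big_nat_recr //=; apply: (is_derive_ext (fun t => \sum_(1 <= i < k.+1) (/ INR i * t ^ i) + / INR k.+1 * t ^ k.+1)).
    by move=> u; rewrite [RHS]big_nat_recr.
  apply: is_derive_plus => //; auto_derive => //; have := INR_gt0 (ltn0Sn k) => P.
  by rewrite /=; field; lra.
have [c [c1 c2]] : exists c, (Rmin 0 y <= c <= Rmax 0 y) /\
    (- ln (1 - y) - s y) - (- ln (1 - 0) - s 0) = (/ (1 - c) - \sum_(0 <= k < K) c ^ k) * (y - 0).
  apply: (MVT_gen (fun t => - ln (1 - t) - s t) 0 y (fun c => / (1 - c) - \sum_(0 <= k < K) c ^ k)).
    move=> t; rewrite Rmin_left ?Rmax_right; [|lra|lra] => Ht; apply: is_derive_minus; last exact: ds.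
    by auto_derive; [lra|field; lra].
  move=> t; rewrite Rmin_left ?Rmax_right; [|lra|lra] => Ht.
  apply: continuity_pt_minus.
    apply/continuity_pt_filterlim; apply: (ex_derive_continuous (fun t => - ln (1 - t))).
    by auto_derive; lra.
  apply/continuity_pt_filterlim; apply: (ex_derive_continuous s); eexists; exact: ds.
rewrite Rmin_left ?Rmax_right in c1; try lra.
have s0 : s 0 = 0.
  by rewrite /s big_nat big1 // => k /andP[k0 _]; rewrite pow_i; [ring|lia].
have G : / (1 - c) - \sum_(0 <= k < K) c ^ k = c ^ K / (1 - c).
  have : (1 - c) * \sum_(0 <= k < K) c ^ k = 1 - c ^ K.
    elim: (K) => [|k IH]; first by rewrite big_geq // pow_O; ring.
    by rewrite big_nat_recr //= Rmult_plus_distr_l IH -tech_pow_Rmult; ring.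
  move=> E; have -> : \sum_(0 <= k < K) c ^ k = (1 - c ^ K) / (1 - c) by rewrite -E; field; lra.
  by field; lra.
move: c2; rewrite s0 G !Rminus_0_r ln_1 => c2.
have H0 : 0 <= c ^ K / (1 - c).
  by apply: Rmult_le_pos; [apply: pow_le; lra|apply: Rinv_ge0; lra].
have H1 : c ^ K / (1 - c) <= y ^ K / (1 - y).
  apply: Rmult_le_compat; [apply: pow_le; lra|apply: Rinv_ge0; lra| |].
    by apply: pow_incr; lra.
  by apply: Rinv_le_contravar; lra.
have H2 : y ^ K.+1 / (1 - y) = y ^ K / (1 - y) * y by rewrite -tech_pow_Rmult; field; lra.
have H3 : c ^ K / (1 - c) * y <= y ^ K / (1 - y) * y by apply: Rmult_le_compat_r; lra.
have H4 : 0 <= c ^ K / (1 - c) * y by apply: Rmult_le_pos; lra.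
rewrite -/(s y); lra.
Qed.

(** Both logarithms have the same first-order term p^(-1-d), so the difference is of second order in
    1/p and carries a factor d. Summed over all primes it is O(d). *)
Lemma local_factor_bound d p : 0 <= d -> prime p ->
  Rabs (- ln (1 - / INR p) * exp (- d * ln (INR p)) - - ln (1 - power_weight d p))
  <= 2 * d * (ln (INR p) / (INR p * INR p.-1)).
Proof.
move=> d0 pp; have p0 := prime_gt0 pp.
have p2 : 2 <= INR p by rewrite -(INR_lit 2); apply: leq_INR; exact: prime_gt1.
have pE : INR p.-1 = INR p - 1 by rewrite -{2}(prednK p0) S_INR; ring.
rewrite power_weightE // /Rdiv pE; set x := / INR p; set y := exp _.
have x2 : 0 < x <= / 2.
  by split; [apply: Rinv_0_lt_compat|apply: Rinv_le_contravar]; lra.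
have L0 := ln_INR_ge0 p.
have y1 : 0 < y <= 1.
  split; first exact: exp_pos.
  by rewrite -exp_0; apply: exp_mono; have := Rmult_le_pos _ _ d0 L0; lra.
have yd : 1 - y <= d * ln (INR p).
  by have := exp_ineq1_le (- d * ln (INR p)); rewrite -/y; lra.
have a0 : 0 < 1 - x by lra.
have b0 : 0 < 1 - y * x by nra.
have xx : x * x / (1 - x) = / (INR p * (INR p - 1)) by rewrite /x; field; lra.
have D : ln (1 - y * x) - ln (1 - x) = ln ((1 - y * x) / (1 - x)) by rewrite ln_div.
have U := ln_le_sub1 (Rdiv_lt_0_compat _ _ b0 a0); rewrite -D in U.
have V := ln_ge_sub1 (Rdiv_lt_0_compat _ _ b0 a0); rewrite -D Rinv_div in V.
have W1 := ln_le_sub1 a0; have W2 := ln_ge_sub1 a0.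
have K0 : 0 <= x * x / (1 - x).
  by apply: Rmult_le_pos; [nra|apply: Rinv_ge0; lra].
have bound : (1 - y) * (x * x / (1 - x)) <= d * ln (INR p) * (x * x / (1 - x)).
  by apply: Rmult_le_compat_r.
have xE : x / (1 - x) = x + x * x / (1 - x) by field; lra.
have iE : / (1 - x) = 1 + x / (1 - x) by field; lra.
have Z : 0 <= d * ln (INR p) * (x * x / (1 - x)) by apply: Rmult_le_pos => //; exact: Rmult_le_pos.
have -> : - ln (1 - x) * y - - ln (1 - y * x) = (ln (1 - y * x) - ln (1 - x)) + (1 - y) * ln (1 - x) by ring.
have -> : 2 * d * (ln (INR p) * / (INR p * (INR p - 1))) = 2 * (d * ln (INR p) * (x * x / (1 - x))).
  by rewrite xx; ring.
have U' : (1 - y * x) / (1 - x) - 1 = (1 - y) * (x / (1 - x)) by field; lra.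
have V' : 1 - (1 - x) / (1 - y * x) = (1 - y) * x / (1 - y * x) by field; lra.
have V2 : (1 - y) * x <= (1 - y) * x / (1 - y * x).
  rewrite -[X in X <= _]Rmult_1_r /Rdiv; apply: Rmult_le_compat_l; first nra.
  by rewrite -Rinv_1; apply: Rinv_le_contravar; nra.
have M1 : (1 - y) * ln (1 - x) <= (1 - y) * (- x) by apply: Rmult_le_compat_l; lra.
have M2 : (1 - y) * (- (x / (1 - x))) <= (1 - y) * ln (1 - x) by apply: Rmult_le_compat_l; lra.
rewrite xE in U' M2.
apply: Rabs_le; lra.
Qed.

Lemma sum_local_factor_bound d N : 0 <= d ->
  Rabs (\sum_(1 <= p < N.+1 | prime p) (- ln (1 - / INR p) * exp (- d * ln (INR p)))
    - \sum_(1 <= p < N.+1 | prime p) - ln (1 - power_weight d p)) <= 4 * d.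
Proof.
move=> d0; rewrite -sumR_sub; apply: Rle_trans (sumR_abs _ _ _) _.
apply: (Rle_trans _ (\sum_(1 <= p < N.+1 | prime p) (2 * d * (ln (INR p) / (INR p * INR p.-1))))).
  by apply: sumR_le => p _ pp; exact: local_factor_bound.
rewrite sumR_scal; have := sum_ln_div_square_le N.
have := @sum_prime_le_range (fun n => ln (INR n) / (INR n * INR n.-1)) N.
set A := \sum_(1 <= p < N.+1 | prime p) _; set B := \sum_(2 <= n < N.+1) _ => H H2.
have : A <= B; last by nra.
apply: H => n n1; apply: Rmult_le_pos; first exact: ln_INR_ge0.
apply: Rinv_ge0; rewrite -mult_INR; apply: INR_gt0.
by rewrite muln_gt0; case: n n1 => [|[]].
Qed.

Lemma log_zeta_bounds d N : 0 < d ->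
  ln (\sum_(1 <= n < N.+2) power_weight d n) <=
    \sum_(1 <= p < N.+2 | prime p) - ln (1 - power_weight d p) <= ln (1 + / d).
Proof.
move=> d0; have d0' := Rlt_le _ _ d0.
have w1 : power_weight d 1 = 1 by rewrite /power_weight INR_1 ln_1 Rmult_0_r exp_0.
have wp p : prime p -> power_weight d p < 1.
  move=> pp; apply: Rle_lt_trans (power_weight_le d0' (prime_gt0 pp)) _.
  have p1 : 1 < INR p by rewrite -INR_1; apply: ltn_INR; exact: prime_gt1.
  by rewrite -[X in _ < X]Rinv_1; apply: Rinv_lt_contravar; lra.
have E : \sum_(1 <= p < N.+2 | prime p) - ln (1 - power_weight d p) =
    ln (\prod_(p <- primes_upto N.+1) / (1 - power_weight d p)).
  rewrite ln_prodR => [|p]; last first.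
    by rewrite mem_primes_upto => /andP[/wp H _] _; apply: Rinv_0_lt_compat; lra.
  rewrite /primes_upto big_filter; apply: eq_bigr => p /wp H; rewrite ln_Rinv //; lra.
have S1 : 0 < \sum_(1 <= n < N.+2) power_weight d n.
  rewrite big_nat_recl // w1; have : 0 <= \sum_(1 <= i < N.+1) power_weight d i.+1; last lra.
  by apply: sumR_ge0 => *; exact: power_weight_ge0.
have wM := @power_weightM d; have w0 := power_weight_ge0 d.
have L := euler_product_ge wM w0 w1 wp N.+1.
have U := @euler_product_le _ wM w0 w1 wp N.+1 _ (fun M => power_weight_sum_le M d0).
rewrite E; split; apply: ln_mono; lra.
Qed.

(** A prime in (2^(k-1), 2^k] has p^-d between y^k and y^(k-1), so replacing p^-d by y^k on each
    block costs at most a factor y. *)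
Lemma log_mertens_dyadic d K (y := exp (- d * ln 2)) : 0 < d ->
  let Z := \sum_(1 <= p < (2 ^ K).+1 | prime p) (- ln (1 - / INR p) * exp (- d * ln (INR p))) in
  y * Z <= \sum_(1 <= k < K.+1) ((log_mertens (2 ^ k) - log_mertens (2 ^ k.-1)) * y ^ k) <= Z.
Proof.
move=> d0 /=; have [l1 l2] := ln2_bounds.
have yk k : y ^ k = exp (- d * ln (INR (2 ^ k))).
  by rewrite ln_exp2 /y; elim: k => [|k IH]; [rewrite pow_O INR_0 !(Rmult_0_l, Rmult_0_r) exp_0
    |rewrite -tech_pow_Rmult IH -exp_plus S_INR; congr exp; ring].
elim: K => [|K [IH1 IH2]].
  rewrite expn0 [X in _ <= X <= _]big_geq //.
  by rewrite big_mkcond big_nat1 /=; lra.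
have K2 : (2 ^ K <= 2 ^ K.+1)%N by rewrite leq_exp2l.
rewrite [X in _ <= X <= _]big_nat_recr //= (@sum_split _ prime 1 (2 ^ K).+1) //.
rewrite /log_mertens (@sum_split (fun p => - ln (1 - / INR p)) prime 1 (2 ^ K).+1 (2 ^ K.+1).+1) //.
rewrite -!/(log_mertens _).
set G := \sum_(1 <= k < K.+1) _ in IH1 IH2 *; set Z := \sum_(1 <= p < (2 ^ K).+1 | prime p) _ in IH1 IH2 *.
set A := \sum_((2 ^ K).+1 <= i < (2 ^ K.+1).+1 | prime i) _; set B := \sum_(_ <= i < _ | prime i) - _.
have -> : log_mertens (2 ^ K) + B - log_mertens (2 ^ K) = B by ring.
have y0 : 0 < y := exp_pos _.
have g0 p : prime p -> 0 <= - ln (1 - / INR p).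
  move=> pp; have p2 : 2 <= INR p by rewrite -(INR_lit 2); apply: leq_INR; exact: prime_gt1.
  have i2 : / INR p <= / 2 by apply: Rinv_le_contravar; lra.
  have i0 : 0 < / INR p by apply: Rinv_0_lt_compat; lra.
  by have := @ln_le_sub1 (1 - / INR p); lra.
have H1 : B * y ^ K.+1 <= A.
  rewrite /B big_distrl /=; apply: sumR_le_nat => p p1 p2 pp.
  apply: Rmult_le_compat_l; first exact: g0.
  rewrite yk; apply: exp_mono; have : ln (INR p) <= ln (INR (2 ^ K.+1)).
    by apply: leq_ln_INR => //; exact: prime_gt0.
  nra.
have H2 : y * A <= B * y ^ K.+1.
  rewrite /B big_distrl /= -sumR_scal; apply: sumR_le_nat => p p1 p2 pp.
  rewrite -Rmult_assoc (Rmult_comm y) Rmult_assoc; apply: Rmult_le_compat_l; first exact: g0.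
  rewrite -tech_pow_Rmult; apply: Rmult_le_compat_l; first lra.
  rewrite yk; apply: exp_mono; have : ln (INR (2 ^ K)) <= ln (INR p).
    by apply: ln_mono; [apply: INR_gt0; rewrite expn_gt0|apply: leq_INR; exact: ltnW].
  nra.
lra.
Qed.

(** Both parts behave like - ln d: the first is close to ln zeta(1 + d), the second to - ln (1 -
    2^-d), where 1 - 2^-d is close to d ln 2; the difference leaves ln ln 2. The dyadic blocks cost
    d ln(1/d), and d = s^2 makes this at most 2 s. *)
Lemma abel_mean_bounds s eps (d := s * s) (y := exp (- d * ln 2)) : 0 < s < 1 -> 0 < eps ->
  exists K0, forall K, (K0 <= K)%N ->
  Rabs (\sum_(1 <= k < K.+1) ((log_mertens (2 ^ k) - log_mertens (2 ^ k.-1) - / INR k) * y ^ k)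
   - ln (ln 2)) <= 7 * s + eps.
Proof.
move=> [s0 s1] e0; have [l1 l2] := ln2_bounds; have d0 : 0 < d by apply: Rmult_lt_0_compat.
have ds : d <= s by rewrite /d; nra.
have dl0 : 0 < d * ln 2 by apply: Rmult_lt_0_compat; lra.
have y0 : 0 < y := exp_pos _.
have yE : y * (1 + d * ln 2) <= 1.
  apply: (Rle_trans _ (y * exp (d * ln 2))).
    by apply: Rmult_le_compat_l; [lra|exact: exp_ineq1_le].
  by rewrite /y -exp_plus -[X in _ <= X]exp_0; right; congr exp; ring.
have yge : 1 - y <= d * ln 2.
  by have := exp_ineq1_le (- d * ln 2); rewrite -/y; lra.
have y1 : 0 < 1 - y by nra.
have lnd : ln d <= 0 by rewrite -ln_1; apply: ln_mono => //; lra.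
have lny1 : ln (1 - y) <= ln d + ln (ln 2).
  by rewrite -ln_mult; [apply: ln_mono|lra|lra].
have lny2 : ln d + ln (ln 2) - d <= ln (1 - y).
  have : ln (d * ln 2) <= ln ((1 - y) * (1 + d * ln 2)).
    by apply: ln_mono => //; lra.
  rewrite !ln_mult; try lra.
  have := @ln_le_sub1 (1 + d * ln 2); have : d * ln 2 <= d by nra.
  lra.
have dlnd : d * (- ln d) <= 2 * s.
  have -> : ln d = 2 * ln s by rewrite /d ln_mult //; ring.
  have := ln_ge_sub1 s0 => H; have : s * (- ln s) <= 1.
    have := Rmult_le_compat_l s _ _ (Rlt_le _ _ s0) H.
    by rewrite Rmult_minus_distr_l Rinv_r; lra.
  by rewrite /d; nra.
(* With d fixed, K is taken so large that y^K is small against eps and, for the tail of the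
   logarithmic series, against eps (1 - y). *)
pose t0 := Rmin (eps * (1 - y)) (Rmin (1 / 2) (eps / 2)).
have t0p : 0 < t0 by rewrite /t0; do ![apply: Rmin_glb_lt]; try lra; apply: Rmult_lt_0_compat.
have [K0 HK] := pow_lt_1_zero y (ltac:(rewrite Rabs_pos_eq; lra)) t0 t0p.
exists K0 => K /leP KK; have {HK KK} := HK K KK.
have yK0 := pow_lt y K y0; rewrite Rabs_pos_eq; last lra.
set t := y ^ K in yK0 * => tt0.
have [t1 [t2 t3]] : t < eps * (1 - y) /\ t < 1 / 2 /\ t < eps / 2.
  have := Rmin_l (eps * (1 - y)) (Rmin (1 / 2) (eps / 2)); have := Rmin_r (eps * (1 - y)) (Rmin (1 / 2) (eps / 2)).
  by have := Rmin_l (1 / 2) (eps / 2); have := Rmin_r (1 / 2) (eps / 2); rewrite -/t0; lra.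
have -> : \sum_(1 <= k < K.+1) ((log_mertens (2 ^ k) - log_mertens (2 ^ k.-1) - / INR k) * y ^ k) =
   \sum_(1 <= k < K.+1) ((log_mertens (2 ^ k) - log_mertens (2 ^ k.-1)) * y ^ k)
   - \sum_(1 <= k < K.+1) (/ INR k * y ^ k).
  by rewrite -sumR_sub; apply: eq_bigr => k _; ring.
have [G1 G2] := log_mertens_dyadic K d0; rewrite -/y in G1 G2.
have [S1 S2] := @log_series_bounds y K ltac:(lra).
have := sum_local_factor_bound (2 ^ K) (Rlt_le _ _ d0).
have [N EN] : exists N, (2 ^ K = N.+1)%N by exists (2 ^ K).-1; rewrite prednK // expn_gt0.
have := log_zeta_bounds N d0; rewrite -EN.
have ZL : (1 - t) / d <= \sum_(1 <= n < (2 ^ K).+1) power_weight d n.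
  apply: Rle_trans (power_weight_sum_ge _ d0); apply: Rmult_le_compat_r.
    by apply: Rinv_ge0.
  suff : exp (- d * ln (INR (2 ^ K).+1)) <= t by lra.
  have -> : t = exp (- d * ln (INR (2 ^ K))).
    rewrite ln_exp2 /t /y; elim: (K) => [|k IH].
      by rewrite pow_O INR_0 !(Rmult_0_l, Rmult_0_r) exp_0.
    by rewrite -tech_pow_Rmult IH -exp_plus S_INR; congr exp; ring.
  apply: exp_mono; have : ln (INR (2 ^ K)) <= ln (INR (2 ^ K).+1).
    by apply: ln_mono; [apply: INR_gt0; rewrite expn_gt0|exact: leq_INR].
  nra.
move: ZL G1 G2 S1 S2.
set G := \sum_(1 <= k < K.+1) _; set S := \sum_(1 <= k < K.+1) _.
set Z := \sum_(1 <= p < _ | prime p) (_ * _); set E := \sum_(1 <= p < _ | prime p) - _.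
set W := \sum_(1 <= n < _) _.
move=> ZL G1 G2 S1 S2 [E1 E2] /Rabs_le_between [Z1 Z2].
have lnW : - ln d - eps <= ln W.
  have d1 : 0 < (1 - t) / d by apply: Rdiv_lt_0_compat; lra.
  apply: Rle_trans (ln_mono d1 ZL); rewrite ln_div; [|lra|lra].
  have H := @ln_ge_sub1 (1 - t) ltac:(lra).
  have : / (1 - t) <= 1 + 2 * t.
    apply: (Rmult_le_reg_r (1 - t)); first lra.
    by rewrite Rinv_l; [nra|lra].
  lra.
have lnid : ln (1 + / d) <= d - ln d.
  have -> : 1 + / d = (1 + d) / d by field; lra.
  by rewrite ln_div; [have := @ln_le_sub1 (1 + d); lra|lra|lra].
have tail : y ^ K.+1 / (1 - y) <= eps.
  apply: (Rmult_le_reg_r (1 - y)) => //.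
  have -> : y ^ K.+1 / (1 - y) * (1 - y) = y * t by rewrite -tech_pow_Rmult /t; field; lra.
  nra.
have low : y * Z >= - ln d - eps - d * (- ln d) - 4 * d.
  have Zl : - ln d - eps - 4 * d <= Z by lra.
  have := Rmult_le_compat_l _ _ _ (Rlt_le _ _ y0) Zl.
  have : (1 - y) * (- ln d) <= d * (- ln d) by apply: Rmult_le_compat_r; nra.
  have : 0 <= (1 - y) * eps by apply: Rmult_le_pos; lra.
  have : 0 <= (1 - y) * (4 * d) by apply: Rmult_le_pos; lra.
  lra.
by apply: Rabs_le; lra.
Qed.

(* The limit c of log_mertens N - ln ln N is identified by summing
   log_mertens (2^k) - harmonic k, which tends to c + ln ln 2 - gamma, by Abel means:
   the first part gives ln zeta(1 + d), the second one - ln (1 - 2^-d). *)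
Lemma mertens_third : is_lim_seq (fun N => log_mertens N - ln (ln (INR N))) euler_gamma.
Proof.
have [c Lc] := mertens_converges; suff -> : euler_gamma = c by [].
have [l1 l2] := ln2_bounds.
pose D k := log_mertens (2 ^ k) - harmonic k.
have D0 : D 0%N = 0.
  rewrite /D /log_mertens expn0 big_mkcond big_nat1 /= /harmonic big_geq //; ring.
have LD : is_lim_seq D (c + ln (ln 2) - euler_gamma).
  have L2 : is_lim_seq (fun k => log_mertens (2 ^ k) - ln (ln (INR (2 ^ k)))) c.
    apply: (is_lim_seq_subseq _ _ (fun k => 2 ^ k)%N) Lc => P [n0 Hn0].
    by exists n0 => n /leP nn; apply: Hn0; apply/leP; apply: leq_trans nn _; rewrite ltnW // ltn_expl.
  apply: (is_lim_seq_ext_loc (fun k => (log_mertens (2 ^ k) - ln (ln (INR (2 ^ k)))) + ln (ln 2)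
      - (harmonic k - ln (INR k)))).
    exists 1%N => k /leP k0; rewrite /D ln_exp2 ln_mult; [ring|exact: INR_gt0|lra].
  apply: is_lim_seq_minus'; last exact: harmonic_ln_lim.
  by apply: is_lim_seq_plus' => //; exact: is_lim_seq_const.
set l := c + _ - _ in LD.
(* 9 eps: 7 s + eps from [abel_mean_bounds] with s <= eps, and eps from [abel_mean]. *)
suff H eps : 0 < eps -> eps < 1 -> Rabs (l - ln (ln 2)) <= 9 * eps.
  have : Rabs (l - ln (ln 2)) <= 0.
    apply: Rnot_lt_le => P; have := H (Rmin (1 / 2) (Rabs (l - ln (ln 2)) / 10)).
    have := Rmin_l (1 / 2) (Rabs (l - ln (ln 2)) / 10); have := Rmin_r (1 / 2) (Rabs (l - ln (ln 2)) / 10).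
    have : 0 < Rmin (1 / 2) (Rabs (l - ln (ln 2)) / 10) by apply: Rmin_glb_lt; lra.
    by move=> q1 q2 q3 q4; have := q4 q1 ltac:(lra); lra.
  by move/Rabs_le_between; rewrite /l; lra.
move=> e0 e1; have [eta eta0 Heta] := abel_mean D0 LD e0.
pose s := Rmin eps (Rmin (eta / 2) (1 / 2)).
have s0 : 0 < s by rewrite /s; do ![apply: Rmin_glb_lt]; lra.
have [s1 [s2 s3]] : s <= eps /\ s <= eta / 2 /\ s <= 1 / 2.
  have := Rmin_l eps (Rmin (eta / 2) (1 / 2)); have := Rmin_r eps (Rmin (eta / 2) (1 / 2)).
  by have := Rmin_l (eta / 2) (1 / 2); have := Rmin_r (eta / 2) (1 / 2); rewrite -/s; lra.
pose y := exp (- (s * s) * ln 2).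
have ss : 0 < s * s <= s by split; nra.
have y1 : 1 - y <= s.
  by have := exp_ineq1_le (- (s * s) * ln 2); rewrite -/y; nra.
have y0 : 0 < y < 1.
  split; first exact: exp_pos.
  by rewrite -exp_0; apply: exp_increasing; have : 0 < s * s * ln 2 by [apply: Rmult_lt_0_compat; lra]; lra.
have [K1 HK1] := Heta y ltac:(lra) y0.
have [K2 HK2] := @abel_mean_bounds s eps ltac:(lra) e0.
have := HK1 (maxn K1 K2) (leq_maxl _ _); have := HK2 (maxn K1 K2) (leq_maxr _ _).
rewrite -/y; set K := maxn K1 K2.
have -> : \sum_(1 <= k < K.+1) ((D k - D k.-1) * y ^ k) =
  \sum_(1 <= k < K.+1) ((log_mertens (2 ^ k) - log_mertens (2 ^ k.-1) - / INR k) * y ^ k).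
  apply: eq_big_nat => k /andP[k0 _]; congr (_ * _); rewrite /D.
  have -> : harmonic k = harmonic k.-1 + / INR k by case: k k0 => // k _; rewrite /harmonic big_nat_recr.
  ring.
move/Rabs_le_between => H1 /Rabs_le_between H2; apply: Rabs_le; lra.
Qed.

(** * The upper bound *)

Definition log_plus_sum N := \sum_(1 <= p < N.+1 | prime p) ln (1 + / INR p).

Lemma prime_INR_ge2 p : prime p -> 2 <= INR p.
Proof. by move=> pp; rewrite -(INR_lit 2); apply: leq_INR; exact: prime_gt1. Qed.

Lemma ln_factor_bounds p : prime p ->
  0 <= ln (1 + / INR p) <= / INR p /\ 0 <= - ln (1 - / INR p) <= 2 * / INR p.
Proof.
move=> /prime_INR_ge2 p2; set x := / INR p.
have x2 : x <= / 2 by apply: Rinv_le_contravar; lra.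
have x0 : 0 < x by apply: Rinv_0_lt_compat; lra.
have H1 := @ln_le_sub1 (1 + x) ltac:(lra); have H2 := @ln_ge_sub1 (1 + x) ltac:(lra).
have H3 := @ln_le_sub1 (1 - x) ltac:(lra); have H4 := @ln_ge_sub1 (1 - x) ltac:(lra).
have : / (1 + x) <= 1 by rewrite -[X in _ <= X]Rinv_1; apply: Rinv_le_contravar; lra.
have : / (1 - x) <= 1 + 2 * x.
  by apply: (Rmult_le_reg_r (1 - x)); [lra|rewrite Rinv_l; [nra|lra]].
lra.
Qed.

Lemma log_plus_sumE N :
  log_plus_sum N = log_mertens N + ln (\prod_(p <- primes_upto N) (1 - / INR p ^ 2)).
Proof.
have F p : prime p -> 0 < 1 - / INR p /\ 1 - / INR p ^ 2 = (1 - / INR p) * (1 + / INR p).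
  move=> /prime_INR_ge2 p2; have x2 : / INR p <= / 2 by apply: Rinv_le_contravar; lra.
  by split; [lra|field; lra].
have pos p : prime p -> 0 < 1 + / INR p.
  by move=> /prime_INR_ge2 p2; have : 0 < / INR p by [apply: Rinv_0_lt_compat; lra]; lra.
rewrite ln_prodR => [|p]; last first.
  rewrite mem_primes_upto => /andP[pp _] _; have [f1 ->] := F p pp.
  by apply: Rmult_lt_0_compat => //; exact: pos.
rewrite /log_plus_sum /log_mertens /primes_upto big_filter -big_split /=.
apply: eq_bigr => p pp; have [f1 ->] := F p pp.
by rewrite ln_mult //; [ring|exact: pos].
Qed.

Lemma log_plus_sum_lim : is_lim_seq (fun N => log_plus_sum N - ln (ln (INR N)))
  (euler_gamma + ln (6 / PI ^ 2)).
Proof.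
have pi2 : 0 < 6 / PI ^ 2 by apply: Rdiv_lt_0_compat; [lra|apply: pow_lt; exact: PI_RGT_0].
apply: (is_lim_seq_ext (fun N => (log_mertens N - ln (ln (INR N))) +
   ln (\prod_(p <- primes_upto N) (1 - / INR p ^ 2)))).
  by move=> N; rewrite log_plus_sumE; ring.
apply: is_lim_seq_plus'; first exact: mertens_third.
apply: is_lim_seq_continuous; last exact: prime_product_zeta2.
by apply: derivable_continuous_pt; exists (/ (6 / PI ^ 2)); exact: derivable_pt_lim_ln.
Qed.

Lemma sum_uniq_subset (s t : seq nat) (F : nat -> R) : uniq s -> uniq t -> {subset s <= t} ->
  (forall i, i \in t -> 0 <= F i) -> \sum_(i <- s) F i <= \sum_(i <- t) F i.
Proof.
move=> us ut st F0; have P : perm_eq s (filter (mem s) t).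
  apply: uniq_perm => //; first exact: filter_uniq.
  by move=> i; rewrite mem_filter /=; case: (boolP (i \in s)) => // /st ->.
rewrite (perm_big _ P) big_filter; apply: (sumR_subset (Q := xpredT)) => // i it _.
exact: F0.
Qed.

Lemma primes_filter_gt_bound (m N : nat) : (0 < m)%N -> (0 < N)%N ->
  (N ^ count (fun p => N < p) (primes m) <= m)%N.
Proof.
move=> m0 N0; rewrite [X in (_ <= X)%N](prod_prime_decomp m0) prime_decompE big_map /=.
rewrite -sum1_count big_mkcond /=.
have -> : (N ^ (\sum_(i <- primes m) (if N < i then 1 else 0)) =
  \prod_(i <- primes m) N ^ (if N < i then 1 else 0))%N.
  by elim: (primes m) => [|p s IH]; rewrite ?big_nil // !big_cons expnD IH.
rewrite big_seq [X in (_ <= X)%N]big_seq.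
elim/big_ind2: _ => // [x y z t|p pm]; first exact: leq_mul.
have lp : (0 < logn p m)%N by rewrite logn_gt0.
have p0 : (0 < p)%N by move: pm; rewrite mem_primes => /andP[/prime_gt0].
case: ltnP => Np; last by rewrite expn0 expn_gt0 p0.
by rewrite expn1; apply: leq_trans (ltnW Np) _; rewrite -{1}(expn1 p) leq_pexp2l.
Qed.

(* The primes dividing m are compared with the primes up to N >= ln m: at most N / ln N of
   them exceed N. *)
Lemma sum_primes_div_le (h : nat -> R) m N :
  (forall p, prime p -> 0 <= h p <= 2 * / INR p) -> (0 < m)%N -> (1 < N)%N -> ln (INR m) <= INR N ->
  \sum_(p <- primes m) h p <= \sum_(1 <= p < N.+1 | prime p) h p + 2 / ln (INR N).
Proof.
move=> hb m0 N1 mN; have N0 : (0 < N)%N by apply: ltnW.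
have lN := ln_gt0 N1; have N0' := INR_gt0 N0.
rewrite (bigID (fun p => (p <= N)%N)) /=; apply: Rplus_le_compat.
  rewrite -big_filter -[X in _ <= X]big_filter -/(primes_upto N).
  apply: sum_uniq_subset; [exact: filter_uniq (primes_uniq m)|exact: primes_upto_uniq| |].
    by move=> p; rewrite mem_filter mem_primes mem_primes_upto => /andP[-> /andP[->]].
  by move=> p; rewrite mem_primes_upto => /andP[pp _]; case: (hb p pp).
apply: (Rle_trans _ (\sum_(p <- primes m | ~~ (p <= N)%N) (2 * / INR N))).
  apply: sumR_le => p; rewrite mem_primes -ltnNge => /andP[pp _] Np; have [_ H] := hb p pp.
  apply: Rle_trans H _; apply: Rmult_le_compat_l; first lra.
  by apply: Rinv_le_contravar => //; apply: leq_INR; exact: ltnW.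
rewrite sumR_const; set k := count _ _.
have kE : k = count (fun p => N < p)%N (primes m) by apply: eq_count => p; rewrite -ltnNge.
have : INR k * ln (INR N) <= INR N.
  apply: Rle_trans mN; rewrite -ln_pow // -expn_INR; apply: ln_mono.
    by apply: INR_gt0; rewrite expn_gt0 N0.
  by apply: leq_INR; rewrite kE; exact: primes_filter_gt_bound.
move=> H; apply: (Rmult_le_reg_r (INR N * ln (INR N))); first exact: Rmult_lt_0_compat.
have -> : INR k * (2 * / INR N) * (INR N * ln (INR N)) = 2 * (INR k * ln (INR N)) by field; lra.
have -> : 2 / ln (INR N) * (INR N * ln (INR N)) = 2 * INR N by field; lra.
lra.
Qed.

Lemma prod_primes_dvdn n : (0 < n)%N -> (\prod_(p <- primes n) p %| n)%N.
Proof.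
move=> n0; rewrite [X in (_ %| X)%N](prod_prime_decomp n0) prime_decompE big_map /=.
rewrite big_seq [X in (_ %| X)%N]big_seq; elim/big_ind2: _ => // [x y z t|p pn]; first exact: dvdn_mul.
by apply: dvdn_exp; rewrite // logn_gt0.
Qed.

Lemma prod_primes_gt0 n : (0 < \prod_(p <- primes n) p)%N.
Proof.
rewrite big_seq; elim/big_ind: _ => // [x y x0 y0|p]; first by rewrite muln_gt0 x0.
by rewrite mem_primes => /andP[/prime_gt0].
Qed.

Lemma dedekind_psiE n : (0 < n)%N ->
  dedekind_psi n = (n %/ \prod_(p <- primes n) p * \prod_(p <- primes n) p.+1)%N.
Proof.
move=> n0; rewrite /dedekind_psi; have /dvdnP[m E] := prod_primes_dvdn n0.
have P0 := prod_primes_gt0 n.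
move: E P0; move: (\prod_(p <- primes n) p)%N (\prod_(p <- primes n) p.+1)%N => P B -> P0.
by rewrite mulnK // mulnAC mulnK.
Qed.

Lemma dedekind_psi_gt0 n : (0 < n)%N -> (0 < dedekind_psi n)%N.
Proof.
move=> n0; rewrite dedekind_psiE // muln_gt0 divn_gt0 ?prod_primes_gt0 // dvdn_leq ?prod_primes_dvdn //=.
by elim/big_ind: _ => // x y x0 y0; rewrite muln_gt0 x0.
Qed.

Lemma ln_dedekind_psi n : (0 < n)%N ->
  ln (INR (dedekind_psi n)) = ln (INR n) + \sum_(p <- primes n) ln (1 + / INR p).
Proof.
move=> n0; have P0 := prod_primes_gt0 n; have pos p : p \in primes n -> 0 < INR p.
  by rewrite mem_primes => /andP[/prime_gt0 p0 _]; exact: INR_gt0.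
have E : INR (dedekind_psi n) = INR n * \prod_(p <- primes n) (1 + / INR p).
  rewrite dedekind_psiE // mult_INR.
  have -> : INR n = INR (n %/ \prod_(p <- primes n) p) * \prod_(p <- primes n) INR p.
    by rewrite -INR_prod -mult_INR multE divnK // prod_primes_dvdn.
  rewrite Rmult_assoc -big_split INR_prod; congr (_ * _); apply: eq_big_seq => p /pos p0 /=.
  by rewrite S_INR; field; lra.
have pos' p : p \in primes n -> 0 < 1 + / INR p.
  by move=> /pos p0; have : 0 < / INR p by [exact: Rinv_0_lt_compat]; lra.
rewrite E ln_mult; [|exact: INR_gt0|by apply: prodR_gt0 => p /pos'].
by rewrite ln_prodR // => p /pos'.
Qed.

Lemma ln_totient n : (0 < n)%N ->
  ln (INR (totient n)) = ln (INR n) - \sum_(p <- primes n) - ln (1 - / INR p).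
Proof.
move=> n0; have pos p : p \in primes n -> 0 < INR p /\ 0 < 1 - / INR p.
  rewrite mem_primes => /andP[/prime_INR_ge2 p2 _]; split; first lra.
  by have : / INR p <= / 2 by [apply: Rinv_le_contravar; lra]; lra.
have E : INR (totient n) = INR n * \prod_(p <- primes n) (1 - / INR p).
  have nE : INR n = \prod_(p <- primes n) INR (p ^ logn p n).
    by rewrite -INR_prod; congr INR; rewrite [LHS](prod_prime_decomp n0) prime_decompE big_map.
  rewrite totientE // INR_prod nE -big_split /=.
  apply: eq_big_seq => p pn; have [p0 _] := pos p pn.
  have pp : prime p by move: pn; rewrite mem_primes => /andP[].
  have lp : (0 < logn p n)%N by rewrite logn_gt0.
  rewrite mult_INR -[in RHS](prednK lp) expnS mult_INR.
  have -> : INR p.-1 = INR p - 1 by rewrite -{2}(prednK (prime_gt0 pp)) S_INR; ring.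
  by field; lra.
rewrite E ln_mult; [|exact: INR_gt0|by apply: prodR_gt0 => p /pos[]].
by rewrite ln_prodR => [|p /pos[]] //; rewrite sumR_opp /Rminus Ropp_involutive.
Qed.

Lemma ln_I_ratio n : (0 < n)%N -> 0 < I_ratio n /\
  ln (I_ratio n) = \sum_(q <- primes (totient n)) ln (1 + / INR q)
   + \sum_(q <- primes (dedekind_psi n)) - ln (1 - / INR q)
   - (\sum_(p <- primes n) - ln (1 - / INR p) + \sum_(p <- primes n) ln (1 + / INR p)).
Proof.
move=> n0; have t0 : (0 < totient n)%N by rewrite totient_gt0.
have p0 := dedekind_psi_gt0 n0.
have P1 : 0 < INR (dedekind_psi (totient n)) by apply: INR_gt0; exact: dedekind_psi_gt0.
have P2 : 0 < INR (totient (dedekind_psi n)) by apply: INR_gt0; rewrite totient_gt0.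
split; first exact: Rdiv_lt_0_compat.
rewrite /I_ratio ln_div // (ln_dedekind_psi t0) (ln_totient p0) ln_totient // ln_dedekind_psi //.
ring.
Qed.

(** 1 + 1/p <= p, and the product of the primes dividing n is at most n. A factor 2 in ln n does not
    affect the asymptotics. *)
Lemma ln_dedekind_psi_le n : (0 < n)%N -> ln (INR (dedekind_psi n)) <= 2 * ln (INR n).
Proof.
move=> n0; rewrite ln_dedekind_psi //.
have pos p : p \in primes n -> 2 <= INR p by rewrite mem_primes => /andP[/prime_INR_ge2].
have -> : 2 * ln (INR n) = ln (INR n) + ln (INR n) by ring.
apply: Rplus_le_compat_l; apply: (Rle_trans _ (ln (INR (\prod_(p <- primes n) p)))).
  rewrite INR_prod ln_prodR => [|p /pos ? _]; last lra.
  apply: sumR_le => p /pos p2 _; apply: ln_mono.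
    by have : 0 < / INR p by [apply: Rinv_0_lt_compat; lra]; lra.
  by have : / INR p <= / 2 by [apply: Rinv_le_contravar; lra]; lra.
apply: ln_mono; first by apply: INR_gt0; exact: prod_primes_gt0.
by apply: leq_INR; apply: dvdn_leq => //; exact: prod_primes_dvdn.
Qed.

Lemma ln_I_ratio_le n N : (0 < n)%N -> (1 < N)%N -> 2 * ln (INR n) <= INR N ->
  ln (I_ratio n) <= log_plus_sum N + log_mertens N + 4 / ln (INR N).
Proof.
move=> n0 N1 nN; have [_ ->] := ln_I_ratio n0.
have t0 : (0 < totient n)%N by rewrite totient_gt0.
have L0 := ln_INR_ge0 n.
have S0 : 0 <= \sum_(p <- primes n) - ln (1 - / INR p) + \sum_(p <- primes n) ln (1 + / INR p).
  by apply: Rplus_le_le_0_compat; apply: sumR_ge0 => p; rewrite mem_primes => /andP[/ln_factor_bounds H _] _; lra.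
have tN : ln (INR (totient n)) <= INR N.
  rewrite ln_totient //; have : 0 <= \sum_(p <- primes n) - ln (1 - / INR p); last lra.
  by apply: sumR_ge0 => p; rewrite mem_primes => /andP[/ln_factor_bounds H _] _; lra.
have pN : ln (INR (dedekind_psi n)) <= INR N by have := ln_dedekind_psi_le n0; lra.
have H1 := @sum_primes_div_le (fun p => ln (1 + / INR p)) _ N _ t0 N1 tN.
have H2 := @sum_primes_div_le (fun p => - ln (1 - / INR p)) _ N _ (dedekind_psi_gt0 n0) N1 pN.
have {}H1 := H1 ltac:(move=> p pp; have := ln_factor_bounds pp;
   have := Rinv_0_lt_compat _ (INR_gt0 (prime_gt0 pp)); lra).
have {}H2 := H2 ltac:(move=> p pp; have := ln_factor_bounds pp; lra).
rewrite -/(log_plus_sum N) in H1; rewrite -/(log_mertens N) in H2.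
have -> : 4 / ln (INR N) = 2 / ln (INR N) + 2 / ln (INR N) by field; have := ln_gt0 N1; lra.
lra.
Qed.

Definition log_limit := 2 * euler_gamma + ln (6 / PI ^ 2).

Lemma ln_INR_lim : is_lim_seq (fun N => ln (INR N)) p_infty.
Proof.
apply: (is_lim_comp_seq ln INR p_infty p_infty); [exact: is_lim_ln_p| |exact: is_lim_seq_INR].
by exists 0%N.
Qed.

Lemma mertens_sums_lim : is_lim_seq
  (fun N => log_plus_sum N + log_mertens N - 2 * ln (ln (INR N))) log_limit.
Proof.
apply: (is_lim_seq_ext (fun N => (log_plus_sum N - ln (ln (INR N))) + (log_mertens N - ln (ln (INR N))))).
  by move=> N; ring.
rewrite (_ : log_limit = euler_gamma + ln (6 / PI ^ 2) + euler_gamma); last by rewrite /log_limit; ring.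
by apply: is_lim_seq_plus'; [exact: log_plus_sum_lim|exact: mertens_third].
Qed.

(** The first conjunct guards against the convention that [ln] is 0 at nonpositive reals: it makes
    the iterated logarithms genuine and the denominator positive. *)
Lemma I_ratio_upper eps : 0 < eps -> exists n0, forall n, (n0 <= n)%N ->
  1 < ln (ln (INR n)) /\ ln (I_ratio n) - 2 * ln (ln (ln (INR n))) <= log_limit + eps.
Proof.
move=> e0; have e3 : 0 < eps / 3 by lra.
have [N1 H1] := proj2 (is_lim_seq_spec _ _) mertens_sums_lim (mkposreal _ e3).
(* The threshold 12 / eps makes 4 / ln N and 4 / ln ln n at most eps / 3 each. *)
have [N2 H2] := proj2 (is_lim_seq_spec _ _) ln_INR_lim (12 / eps).
pose M := Rmax (INR N1 + INR N2 + 2) (exp (exp (12 / eps + 1))).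
have [n1 Hn1] := INR_unbounded (exp M).
have M1 : INR N1 + INR N2 + 2 <= M by exact: Rmax_l.
have M2 : exp (exp (12 / eps + 1)) <= M by exact: Rmax_r.
have ie : 0 < 12 / eps by apply: Rdiv_lt_0_compat; lra.
exists n1 => n nn; have nM : exp M < INR n by have := leq_INR nn; lra.
have n0 : (0 < n)%N by case: n nM {nn} => //; rewrite INR_0; have := exp_pos M; lra.
have l1 : M < ln (INR n) by rewrite -(ln_exp M); apply: ln_increasing => //; exact: exp_pos.
set x := ln (INR n) in l1 *.
have l2 : exp (12 / eps + 1) < ln x.
  rewrite -(ln_exp (exp _)); apply: ln_increasing; [exact: exp_pos|lra].
have l3 : 12 / eps + 1 + 1 < ln x by have := exp_ineq1_le (12 / eps + 1); lra.
have lx0 : 0 < ln x by lra.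
have x2 : 2 <= x by have := pos_INR N1; have := pos_INR N2; lra.
(* N lies between 2 ln n and 4 ln n, so ln ln N exceeds ln ln ln n by at most 2 / ln ln n. *)
pose N := Z.to_nat (up (2 * x)).
have [u1 u2] := archimed (2 * x).
have NE : INR N = IZR (up (2 * x)).
  by rewrite INR_IZR_INZ /N Znat.Z2Nat.id //; apply: le_IZR; lra.
have [g1 g2] : 2 * x <= INR N /\ INR N <= 4 * x by rewrite NE; lra.
have NN : (N1 + N2 + 2 <= N)%N.
  by apply/leP; apply: INR_le; rewrite !plus_INR; have -> : INR 2 = 2 by []; lra.
split; first lra.
have := ln_I_ratio_le n0 (_ : (1 < N)%N) g1; move/(_ ltac:(lia)).
have := H1 N ltac:(lia); move/Rabs_lt_between => /=.
have := H2 N ltac:(lia) => G [_ H] K.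
have lN : ln (INR N) <= ln x + 2.
  apply: (Rle_trans _ (ln (4 * x))); first by apply: ln_mono; lra.
  rewrite ln_mult; [|lra|lra].
  have -> : 4 = 2 * 2 by lra.
  by rewrite ln_mult; [have := ln2_bounds; lra|lra|lra].
have llN : ln (ln (INR N)) <= ln (ln x) + 2 / ln x.
  apply: (Rle_trans _ (ln (ln x + 2))); first by apply: ln_mono; lra.
  have -> : ln x + 2 = ln x * (1 + 2 / ln x) by field; lra.
  have i0 : 0 < 2 / ln x by apply: Rdiv_lt_0_compat; lra.
  rewrite ln_mult; [|lra|lra].
  by have := @ln_le_sub1 (1 + 2 / ln x); lra.
have small y : 12 / eps < y -> 4 / y <= eps / 3.
  move=> yy; have y0 : 0 < y by lra.
  apply: (Rmult_le_reg_r y) => //; have -> : 4 / y * y = 4 by field; lra.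
  have := Rmult_lt_compat_l _ _ _ e3 yy; have -> : eps / 3 * (12 / eps) = 4 by field; lra.
  lra.
have S1 := small _ G; have S2 := small (ln x) ltac:(lra).
have E4 : 4 / ln x = 2 * (2 / ln x) by field; lra.
rewrite E4 in S2.
lra.
Qed.

(** * The lower bound *)

Lemma finite_choice (s : seq nat) (P : nat -> nat -> Prop) :
  (forall r, r \in s -> exists p, P r p) -> exists f : nat -> nat, forall r, r \in s -> P r (f r).
Proof.
elim: s => [|r s IH] H; first by exists id.
have [f Hf] := IH (fun q qs => H q (mem_behead (s := r :: s) qs)).
have [p Hp] := H r (mem_head _ _).
exists (fun q => if q == r then p else f q) => q; rewrite inE; case: eqP => [-> //|_] /= qs.
exact: Hf.
Qed.

Definition shifted (t : bool) p := if t then p.+1 else p.-1.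

(** The bound M depends only on m and B, so J can be chosen afterwards with ln M <= J^9. *)
Lemma primes_shifted_multiple m B : exists M, forall t r, prime r -> (r < m)%N ->
  exists p, [/\ prime p, (B < p)%N, (p <= M)%N & (r %| shifted t p)%N].
Proof.
elim: m => [|m [M IH]]; first by exists 0%N.
case: (boolP (prime m)) => [pm|npm]; last first.
  exists M => t r pr; rewrite ltnS leq_eqVlt => /orP[/eqP E|]; last exact: IH.
  by rewrite -E pr in npm.
have [p1 [pp1 b1 d1]] := PrimesPlusMinusOne.prime_1_mod B pm.
have [p2 [pp2 b2 d2]] := PrimesPlusMinusOne.prime_m1_mod B pm.
exists (M + p1 + p2)%N => t r pr; rewrite ltnS leq_eqVlt => /orP[/eqP ->|rm].
  by case: t; [exists p2|exists p1]; split=> //; lia.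
by have [p [pp Bp pM d]] := IH t r pr rm; exists p; split=> //; lia.
Qed.

Section SquarefreeProduct.
Variable S : seq nat.
Hypotheses (uS : uniq S) (pS : all prime S).
Let n := (\prod_(p <- S) p)%N.

Lemma squarefree_product_gt0 : (0 < n)%N.
Proof.
rewrite /n big_seq; elim/big_ind: _ => // [x y x0 y0|p /(allP pS)/prime_gt0 //].
by rewrite muln_gt0 x0.
Qed.

Lemma perm_primes_squarefree_product : perm_eq (primes n) S.
Proof.
apply: uniq_perm; [exact: primes_uniq|by []|move=> q].
rewrite mem_primes squarefree_product_gt0 /=; apply/andP/idP => [[pq]|qS].
  rewrite /n => d; have : has (fun p => q %| p) S.
    rewrite -[has _ _]negbK; apply/negP => /hasPn H.
    have : coprime q (\prod_(p <- S) p).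
      rewrite big_seq; elim/big_ind: _ => [|x y|p /H]; first exact: coprimen1.
        by rewrite coprimeMr => -> ->.
      by rewrite prime_coprime.
    by rewrite prime_coprime // d.
  by case/hasP => p pin; rewrite dvdn_prime2 // ?(allP pS p pin) // => /eqP ->.
split; first exact: (allP pS).
by rewrite /n (big_rem q) //= dvdn_mulr.
Qed.

Lemma shifted_dvdn_totient p : p \in S -> (p.-1 %| totient n)%N.
Proof.
rewrite -(perm_mem perm_primes_squarefree_product) => pn.
by rewrite totientE ?squarefree_product_gt0 // (big_rem p) //= -mulnA dvdn_mulr.
Qed.

Lemma shifted_dvdn_dedekind_psi p : p \in S -> (p.+1 %| dedekind_psi n)%N.
Proof.
rewrite -(perm_mem perm_primes_squarefree_product) => pn.
by rewrite dedekind_psiE ?squarefree_product_gt0 // [X in (_ * X)%N](big_rem p) //= mulnCA dvdn_mulr.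
Qed.

End SquarefreeProduct.

Lemma sum_undup_le (s : seq nat) (F : nat -> R) : (forall i, 0 <= F i) ->
  \sum_(i <- undup s) F i <= \sum_(i <- s) F i.
Proof.
move=> F0; elim: s => [|a s IH] /=; first by rewrite !big_nil; lra.
rewrite [X in _ <= X]big_cons; case: ifP => _; last by rewrite big_cons; exact: Rplus_le_compat_l.
by apply: Rle_trans IH _; have := F0 a; lra.
Qed.

Lemma sum_inverse_square_le m N : (1 < m)%N ->
  \sum_(m <= r < N.+1) / INR r ^ 2 <= 2 / INR m.
Proof.
move=> m1; have m2 : 2 <= INR m by rewrite -(INR_lit 2); apply: leq_INR.
case: (leqP N.+1 m) => mN.
  by rewrite big_geq //; apply: Rlt_le; apply: Rdiv_lt_0_compat; lra.
apply: (Rle_trans _ (\sum_(m <= r < N.+1) - (/ INR r - / INR r.-1))).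
  apply: sumR_le_nat => r mr _ _.
  have r2 : 2 <= INR r by rewrite -(INR_lit 2); apply: leq_INR; exact: leq_trans mr.
  have -> : INR r.-1 = INR r - 1 by rewrite -{2}(@prednK r) ?S_INR; [ring|lia].
  have -> : - (/ INR r - / (INR r - 1)) = / (INR r * (INR r - 1)) by field; lra.
  by apply: Rinv_le_contravar; nra.
rewrite sumR_opp.
have [k Ek] : exists k, m = k.+1 by exists m.-1; lia.
rewrite Ek big_add1 /= (@sum_telescope (fun r => / INR r)); last by lia.
have kE : INR k = INR m - 1 by rewrite Ek S_INR; ring.
have : 0 < / INR N by apply: Rinv_0_lt_compat; apply: INR_gt0; lia.
have : / INR k <= 2 / INR m.
  rewrite kE; apply: (Rmult_le_reg_r (INR m * (INR m - 1))); first nra.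
  have -> : / (INR m - 1) * (INR m * (INR m - 1)) = INR m by field; lra.
  by have -> : 2 / INR m * (INR m * (INR m - 1)) = 2 * (INR m - 1) by [field; lra]; lra.
rewrite Ek; lra.
Qed.

Section Construction.
Variables (j0 j1 J B M : nat).
Hypothesis few : forall t j, (j0 <= j)%N -> INR (size (bad_primes t j)) * INR j ^ 2 <= 3000000 * 2 ^ j.
Hypotheses (j01 : (j0 <= j1)%N) (j12 : (2 <= j1)%N) (jJ : (j1 <= J)%N) (B4 : (4 ^ j1 <= B)%N).
Hypothesis small_primes : forall t r, prime r -> (r < 2 ^ j1)%N ->
  exists p, [/\ prime p, (B < p)%N, (p <= M)%N & (r %| shifted t p)%N].
Hypothesis MJ : ln (INR M) <= INR J ^ 9.

Let N := (2 ^ J)%N.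
Let is_good t r := (r < 2 ^ j1)%N || has_large_prime t r (trunc_log 2 r).
Let good t := [seq r <- primes_upto N | is_good t r].
Let bad t := [seq r <- primes_upto N | ~~ is_good t r].

(** The lower bounds B and r^2 on p keep the sum of 1/p over the chosen primes small. For r in [2^j,
    2^(j+1)) the second follows from p > 2^(10 j). *)
Let good_spec t r : r \in good t -> exists p,
  [/\ prime p, (r %| shifted t p)%N, (if r < 2 ^ j1 then B < p else r * r <= p)%N & ln (INR p) <= INR J ^ 9].
Proof.
rewrite mem_filter mem_primes_upto => /andP[gr /andP[pr rN]].
case: (ltnP r (2 ^ j1)) gr => [rj _|rj].
  have [p [pp Bp pM d]] := small_primes t pr rj; exists p; split=> //.
  by apply: Rle_trans MJ; apply: leq_ln_INR => //; exact: prime_gt0.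
rewrite /is_good ltnNge rj /= => /hasP[p]; rewrite mem_index_iota => /andP[p1 p2] /andP[pp /eqP pE].
have r1 := prime_gt1 pr; set j := trunc_log 2 r in p1 p2.
have /andP[b1 b2] : (2 ^ j <= r < 2 ^ j.+1)%N by apply: trunc_log_bounds => //; exact: prime_gt0.
have jj : (j <= J)%N by rewrite -(@leq_exp2l 2) //; apply: leq_trans b1 rN.
have j1' : (0 < j)%N by rewrite /j trunc_log_gt0.
exists p; split=> //.
- move: pE; rewrite /shifted; case: t => pE.
    by rewrite /dvdn -addn1 -modnDml pE addn1 prednK ?modnn // prime_gt0.
  rewrite -subn1 -eqn_mod_dvd ?prime_gt0 //; by rewrite pE modn_small.
- apply: leq_trans (ltnW p1); apply: (@leq_trans (2 ^ j.+1 * 2 ^ j.+1)).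
    by apply: leq_mul; apply: ltnW.
  by rewrite -expnD leq_exp2l //; lia.
- apply: (Rle_trans _ (ln (INR (2 ^ j ^ 9)))).
    by apply: ln_mono; [apply: INR_gt0; exact: prime_gt0|apply: leq_INR].
  rewrite ln_exp2 expn_INR; have [_ l2] := ln2_bounds.
  have H : INR j ^ 9 <= INR J ^ 9 by apply: pow_incr; split; [exact: pos_INR|exact: leq_INR].
  by have := pow_le _ 9 (pos_INR j); nra.
Qed.

(** Block j holds at most 3000000 2^j / j^2 bad primes, each at least 2^j, and the sum of 1/j^2 from
    j1 on is at most 2 / j1. *)
Let bad_sum t : \sum_(r <- bad t) / INR r <= 6000000 / INR j1.
Proof.
have inv0 := inv_INR_ge0.
have in_block r : r \in bad t -> let j := trunc_log 2 r in (j1 <= j < J.+1)%N && (r \in bad_primes t j).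
  rewrite mem_filter mem_primes_upto negb_or -leqNgt => /andP[/andP[rj nl] /andP[pr rN]] /=.
  set j := trunc_log 2 r in nl *.
  have /andP[b1 b2] : (2 ^ j <= r < 2 ^ j.+1)%N by apply: trunc_log_bounds => //; exact: prime_gt0.
  rewrite mem_filter mem_index_iota pr nl b1 b2 !andbT.
  rewrite -(ltnS j1) -(@ltn_exp2l 2 j1) // (leq_ltn_trans rj b2) /=.
  by rewrite ltnS -(@leq_exp2l 2) // (leq_trans b1).
apply: (Rle_trans _ (\sum_(r <- bad t) \sum_(j1 <= j < J.+1) (if r \in bad_primes t j then / INR r else 0))).
  apply: sumR_le => r rb _; have /andP[jr rj] := in_block r rb.
  apply: Rle_trans (sumR_term (i := trunc_log 2 r) (P := xpredT) _ _ _ _) => //.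
  - by rewrite rj; right.
  - by move=> j _ _; case: ifP => _ //; lra.
  - exact: iota_uniq.
  - by rewrite mem_index_iota.
rewrite exchange_big /=.
apply: (Rle_trans _ (\sum_(j1 <= j < J.+1) (3000000 * / INR j ^ 2))).
  apply: sumR_le_nat => j jj _ _.
  rewrite -big_mkcond -big_filter.
  apply: (Rle_trans _ (\sum_(r <- bad_primes t j) / INR r)).
    apply: sum_uniq_subset => //.
    - by do 2 apply: filter_uniq; exact: primes_upto_uniq.
    - by apply: filter_uniq; exact: iota_uniq.
    - by move=> r; rewrite mem_filter => /andP[].
  have j0' : 0 < INR j by apply: INR_gt0; apply: leq_trans jj; apply: leq_trans j12.
  have q0 : 0 < 2 ^ j by apply: pow_lt; lra.
  apply: (Rle_trans _ (\sum_(r <- bad_primes t j) / 2 ^ j)).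
    apply: sumR_le => r; rewrite mem_filter mem_index_iota => /andP[_ /andP[r1 _]] _.
    apply: Rinv_le_contravar => //.
    by have := leq_INR r1; rewrite expn_INR (INR_lit 2).
  rewrite sumR_const count_predT.
  apply: (Rmult_le_reg_r (2 ^ j * INR j ^ 2)); first by apply: Rmult_lt_0_compat => //; exact: pow_lt.
  have -> : INR (size (bad_primes t j)) * / 2 ^ j * (2 ^ j * INR j ^ 2) =
    INR (size (bad_primes t j)) * INR j ^ 2 by field; lra.
  have -> : 3000000 * / INR j ^ 2 * (2 ^ j * INR j ^ 2) = 3000000 * 2 ^ j by field; lra.
  by apply: few; exact: leq_trans j01 jj.
rewrite sumR_scal; have := @sum_inverse_square_le j1 J j12.
have -> : 6000000 / INR j1 = 3000000 * (2 / INR j1).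
  by field; have := INR_gt0 (leq_trans (ltn0Sn 1) j12); lra.
lra.
Qed.

(** The loss in units of 1/j1 is 6000000 from the missing ln(1 + 1/q), twice that from - ln(1 - 1/q)
    <= 2/q, and at most 18 from the ratio phi(n) / psi(n). *)
Lemma I_ratio_construction : exists n, [/\ (B < n)%N,
  ln (INR n) <= 2 * 2 ^ J * INR J ^ 9 &
  log_plus_sum N + log_mertens N - 20000000 / INR j1 <= ln (I_ratio n)].
Proof.
have [f0 Hf0] := finite_choice (@good_spec false).
have [f1 Hf1] := finite_choice (@good_spec true).
pose L := [seq f0 r | r <- good false] ++ [seq f1 r | r <- good true].
(* One prime may serve several r; removing repetitions makes n squarefree with exactly these prime
   factors. *)
pose S := undup L; have uS : uniq S := undup_uniq _.
have LP p : p \in L -> prime p /\ ln (INR p) <= INR J ^ 9.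
  by rewrite mem_cat => /orP[] /mapP[r rg ->]; [case: (Hf0 r rg)|case: (Hf1 r rg)].
have pS : all prime S by apply/allP => p; rewrite mem_undup => /LP[].
pose n := (\prod_(p <- S) p)%N; have n0 : (0 < n)%N := squarefree_product_gt0 pS.
have Pn := perm_primes_squarefree_product uS pS.
have p2N : (1 < 2 ^ j1)%N by rewrite -{1}(expn0 2) ltn_exp2l // ltnW.
exists n; split.
(* The prime chosen for r = 2 divides n and already exceeds B. *)
- have g2 : 2%N \in good false.
    rewrite mem_filter mem_primes_upto /is_good (_ : 2 < 2 ^ j1)%N /=; last first.
      by rewrite -{1}(expn1 2) ltn_exp2l.
    by rewrite -{1}(expn1 2) leq_exp2l // ltnW // (leq_trans j12).
  have [pp _ H _] := Hf0 2%N g2; move: H; rewrite ifT; last by rewrite -{1}(expn1 2) ltn_exp2l.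
  move=> Bp; apply: leq_trans Bp _; apply: dvdn_leq => //.
  have /(big_rem (f0 2%N)) E : f0 2%N \in S by rewrite mem_undup mem_cat map_f.
  by rewrite /n E dvdn_mulr.
- have LS p : p \in S -> 0 < INR p by move=> /(allP pS)/prime_gt0; exact: INR_gt0.
  have -> : ln (INR n) = \sum_(p <- S) ln (INR p).
    by rewrite INR_prod ln_prodR // => p /LS.
  apply: (Rle_trans _ (\sum_(p <- S) INR J ^ 9)).
    by apply: sumR_le => p; rewrite mem_undup => /LP[].
  rewrite sumR_const count_predT; apply: Rmult_le_compat_r; first by apply: pow_le; exact: pos_INR.
  have sg t : (size (good t) <= N)%N.
    rewrite size_filter; apply: leq_trans (count_size _ _) _; rewrite size_filter.
    by apply: leq_trans (count_size _ _) _; rewrite size_iota subn1.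
  have : (size S <= 2 * N)%N.
    apply: leq_trans (size_undup _) _; rewrite size_cat !size_map mul2n -addnn.
    by apply: leq_add; exact: sg.
  by move=> /leq_INR; rewrite mult_INR expn_INR (INR_lit 2).
have [_ ->] := ln_I_ratio n0.
have t0 : (0 < totient n)%N by rewrite totient_gt0.
have psi0 := dedekind_psi_gt0 n0.
have sub0 : {subset good false <= primes (totient n)}.
  move=> r rg; have [pp d _ _] := Hf0 r rg.
  have fS : f0 r \in S by rewrite mem_undup mem_cat map_f.
  rewrite mem_primes t0 (dvdn_trans d (shifted_dvdn_totient uS pS fS)).
  by move: rg; rewrite mem_filter mem_primes_upto => /andP[_ /andP[->]].
have sub1 : {subset good true <= primes (dedekind_psi n)}.
  move=> r rg; have [pp d _ _] := Hf1 r rg.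
  have fS : f1 r \in S by rewrite mem_undup mem_cat map_f ?orbT.
  rewrite mem_primes psi0 (dvdn_trans d (shifted_dvdn_dedekind_psi uS pS fS)).
  by move: rg; rewrite mem_filter mem_primes_upto => /andP[_ /andP[->]].
have ug t : uniq (good t) by apply: filter_uniq; exact: primes_upto_uniq.
have H0 : log_plus_sum N - 6000000 / INR j1 <= \sum_(q <- primes (totient n)) ln (1 + / INR q).
  apply: (Rle_trans _ (\sum_(q <- good false) ln (1 + / INR q))); last first.
    apply: sum_uniq_subset => //; first exact: primes_uniq.
    by move=> q; rewrite mem_primes => /andP[/ln_factor_bounds H _]; lra.
  have -> : log_plus_sum N = \sum_(q <- good false) ln (1 + / INR q) + \sum_(q <- bad false) ln (1 + / INR q).
    by rewrite /log_plus_sum -big_filter -/(primes_upto N) (bigID (is_good false)) /=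
      -[X in X + _]big_filter -[X in _ + X]big_filter.
  have : \sum_(q <- bad false) ln (1 + / INR q) <= \sum_(q <- bad false) / INR q; last by have := bad_sum false; lra.
  apply: sumR_le => q; rewrite mem_filter mem_primes_upto => /andP[_ /andP[/ln_factor_bounds H _]] _; lra.
have H1 : log_mertens N - 12000000 / INR j1 <= \sum_(q <- primes (dedekind_psi n)) - ln (1 - / INR q).
  apply: (Rle_trans _ (\sum_(q <- good true) - ln (1 - / INR q))); last first.
    apply: sum_uniq_subset => //; first exact: primes_uniq.
    by move=> q; rewrite mem_primes => /andP[/ln_factor_bounds H _]; lra.
  have -> : log_mertens N = \sum_(q <- good true) - ln (1 - / INR q) + \sum_(q <- bad true) - ln (1 - / INR q).
    by rewrite /log_mertens -big_filter -/(primes_upto N) (bigID (is_good true)) /=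
      -[X in X + _]big_filter -[X in _ + X]big_filter.
  have : \sum_(q <- bad true) - ln (1 - / INR q) <= \sum_(q <- bad true) (2 * / INR q).
    apply: sumR_le => q; rewrite mem_filter mem_primes_upto => /andP[_ /andP[/ln_factor_bounds H _]] _; lra.
  rewrite sumR_scal; have := bad_sum true.
  have -> : 12000000 / INR j1 = 2 * (6000000 / INR j1) by rewrite /Rdiv; ring.
  lra.
have j1' : 2 <= INR j1 by rewrite -(INR_lit 2); apply: leq_INR.
pose m := INR (2 ^ j1).
have m0 : 0 < m by apply: INR_gt0; rewrite expn_gt0.
have jm : INR j1 <= m by apply: leq_INR; rewrite ltnW // ltn_expl.
(* Fewer than m = 2^j1 moduli lie below 2^j1; their primes exceed m^2 and contribute at most 1/m.
   The remaining ones contribute at most the sum of 1/r^2 from m on, which is at most 2/m. *)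
have fsum t f : (forall r, r \in good t -> [/\ prime (f r), (r %| shifted t (f r))%N,
    (if r < 2 ^ j1 then B < f r else r * r <= f r)%N & ln (INR (f r)) <= INR J ^ 9]) ->
    \sum_(r <- good t) / INR (f r) <= 3 / m.
  move=> Hf; pose b r := if (r < 2 ^ j1)%N then / (m * m) else / INR r ^ 2.
  have b0 r : (0 < r)%N -> 0 <= b r.
    move=> r0; rewrite /b; case: ifP => _; apply: Rinv_ge0.
      exact: Rmult_lt_0_compat.
    by apply: pow_lt; exact: INR_gt0.
  apply: (Rle_trans _ (\sum_(r <- good t) b r)).
    apply: sumR_le => r rg _; have [pp _ H _] := Hf r rg; rewrite /b.
    have r0 : (0 < r)%N by move: rg; rewrite mem_filter mem_primes_upto => /andP[_ /andP[/prime_gt0]].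
    move: H; case: ifP => _ H; apply: Rinv_le_contravar.
    - exact: Rmult_lt_0_compat.
    - have := leq_INR (leq_trans B4 (ltnW H)); rewrite -[4%N]/(2 * 2)%N expnMn mult_INR.
      by rewrite -/m.
    - by apply: pow_lt; exact: INR_gt0.
    - by have := leq_INR H; rewrite mult_INR -Rsqr_pow2.
  apply: (Rle_trans _ (\sum_(1 <= r < N.+1) b r)).
    apply: sum_uniq_subset => //; first exact: iota_uniq.
      by move=> r; rewrite !mem_filter => /andP[_ /andP[_]].
    by move=> r; rewrite mem_index_iota => /andP[r0 _]; exact: b0.
  have NJ : (2 ^ j1 <= N.+1)%N by apply: leqW; rewrite leq_exp2l.
  rewrite (@sum_split _ _ 1 (2 ^ j1)) ?expn_gt0 //.
  have -> : \sum_(1 <= r < 2 ^ j1) b r = INR (2 ^ j1 - 1) * / (m * m).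
    rewrite (eq_big_nat _ _ (F2 := fun _ => / (m * m))) => [|r /andP[_ rj]]; last by rewrite /b rj.
    by rewrite sumR_const count_predT size_iota.
  have -> : \sum_(2 ^ j1 <= r < N.+1) b r = \sum_(2 ^ j1 <= r < N.+1) / INR r ^ 2.
    by apply: eq_big_nat => r /andP[rj _]; rewrite /b ltnNge rj.
  have := @sum_inverse_square_le (2 ^ j1) N p2N; rewrite -/m => K.
  have K2 : INR (2 ^ j1 - 1) <= m by apply: leq_INR; rewrite leq_subr.
  have mm : 0 < / (m * m) by apply: Rinv_0_lt_compat; exact: Rmult_lt_0_compat.
  have := Rmult_le_compat_r _ _ _ (Rlt_le _ _ mm) K2.
  have -> : m * / (m * m) = 1 / m by field; lra.
  have -> : 3 / m = 1 / m + 2 / m by field; lra.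
  lra.
have HS : \sum_(p <- primes n) / INR p <= 6 / m.
  rewrite (perm_big _ Pn) /S; apply: Rle_trans (sum_undup_le _ inv_INR_ge0) _.
  rewrite big_cat !big_map /=; have := fsum false f0 Hf0; have := fsum true f1 Hf1.
  have -> : 6 / m = 3 / m + 3 / m by field; lra.
  lra.
have H2 : \sum_(p <- primes n) - ln (1 - / INR p) + \sum_(p <- primes n) ln (1 + / INR p) <=
    3 * \sum_(p <- primes n) / INR p.
  rewrite -big_split -sumR_scal; apply: sumR_le => p.
  by rewrite mem_primes => /andP[/ln_factor_bounds H _] _ /=; lra.
have H3 : 6 / m <= 6 / INR j1.
  by apply: Rmult_le_compat_l; [lra|apply: Rinv_le_contravar; lra].
have i0 : 0 < / INR j1 by apply: Rinv_0_lt_compat; lra.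
rewrite /Rdiv in H0 H1 H3 HS *; lra.
Qed.

End Construction.

Lemma ln_nonpos x : x <= 0 -> ln x = 0.
Proof. by move=> x0; rewrite /ln; case: Rlt_dec => // H; case: (Rlt_not_le _ _ H). Qed.

Lemma I_ratio_lower eps n0 : 0 < eps -> exists n, (n0 <= n)%N /\
  log_limit - eps <= ln (I_ratio n) - 2 * ln (ln (ln (INR n))).
Proof.
move=> e0; have e3 : 0 < eps / 3 by lra.
(* Only ln ln n > 1 for large n is taken from the upper bound. *)
have [n1 Hn1] := I_ratio_upper e0.
have [j0 few] := few_bad_primes.
have [k0 Hk0] := INR_unbounded (60000000 / eps).
pose j1 := (j0 + k0 + 2)%N.
have j1e : 20000000 / INR j1 <= eps / 3.
  have P : 60000000 / eps < INR j1 by apply: Rlt_le_trans Hk0 _; apply: leq_INR; rewrite /j1; lia.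
  have P0 : 0 < 60000000 / eps by apply: Rdiv_lt_0_compat; lra.
  apply: (Rmult_le_reg_r (INR j1)); first lra.
  have -> : 20000000 / INR j1 * INR j1 = 20000000 by field; lra.
  have := Rmult_lt_compat_l _ _ _ e3 P; have -> : eps / 3 * (60000000 / eps) = 20000000 by field; lra.
  lra.
pose B := (4 ^ j1 + n0 + n1)%N.
have [M HM] := primes_shifted_multiple (2 ^ j1) B.
have [k1 Hk1] := INR_unbounded (ln (INR M)).
have [N1 H1] := proj2 (is_lim_seq_spec _ _) mertens_sums_lim (mkposreal _ e3).
have lnJ : is_lim_seq (fun J => ln (INR J) / INR J) 0.
  apply: (is_lim_comp_seq (fun y => ln y / y) INR p_infty 0); [exact: is_lim_div_ln_p| |exact: is_lim_seq_INR].
  by exists 0%N.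
have e300 : 0 < eps / 300 by lra.
have [N2 H2] := proj2 (is_lim_seq_spec _ _) lnJ (mkposreal _ e300).
have [k2 Hk2] := INR_unbounded (60 / eps).
pose J := (j1 + k1 + k2 + N1 + N2)%N.
have J1 : 1 <= INR J by apply: INR_ge1; rewrite /J /j1; lia.
have MJ : ln (INR M) <= INR J ^ 9.
  apply: (Rle_trans _ (INR J)).
    by apply: Rlt_le; apply: Rlt_le_trans Hk1 _; apply: leq_INR; rewrite /J; lia.
  by have := Rle_pow (INR J) 1 9 J1; rewrite pow_1; apply; lia.
have [n [Bn lnn low]] := @I_ratio_construction j0 j1 J B M few ltac:(rewrite /j1; lia)
  ltac:(rewrite /j1; lia) ltac:(rewrite /J; lia) ltac:(rewrite /B; lia) HM MJ.
exists n; split; first by rewrite /B in Bn; lia.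
have [L1 _] := Hn1 n ltac:(rewrite /B in Bn; lia).
have NN : (N1 <= 2 ^ J)%N by apply: (@leq_trans J); [rewrite /J; lia|rewrite ltnW // ltn_expl].
have := H1 _ (elimT leP NN) => /=; move/Rabs_lt_between => [H _].
have [l1 l2] := ln2_bounds.
have := H2 J ltac:(rewrite /J; lia) => /=; move/Rabs_lt_between; rewrite Rminus_0_r => -[_ G].
set u := ln (INR (2 ^ J)) in H; have uE : u = INR J * ln 2 by rewrite /u ln_exp2.
have u0 : 0 < u by rewrite uE; apply: Rmult_lt_0_compat; lra.
(* ln n <= 2 * 2^J J^9 gives ln ln n <= u + 1 + 9 ln J with u = ln 2^J. The correction relative to u
   tends to 0, so ln ln ln n hardly exceeds ln u. *)
have ll : ln (ln (INR n)) <= u * (1 + (1 + 9 * ln (INR J)) * / u).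
  have -> : u * (1 + (1 + 9 * ln (INR J)) * / u) = u + 1 + 9 * ln (INR J) by field; lra.
  have ln0 : 0 < ln (INR n).
    by apply: Rnot_le_lt => /ln_nonpos E; move: L1; rewrite E; lra.
  apply: Rle_trans (ln_mono ln0 lnn) _.
  have P2 : 0 < 2 ^ J by apply: pow_lt; lra.
  have P9 : 0 < INR J ^ 9 by apply: pow_lt; lra.
  rewrite ln_mult; [|lra|lra]; rewrite ln_mult; [|lra|lra].
  rewrite ln_pow; [|lra]; rewrite ln_pow; [|lra]; rewrite uE (INR_lit 9) /=; lra.
have lJ := ln_INR_ge0 J; have iu : 0 < / u by apply: Rinv_0_lt_compat.
have c0 : 0 <= (1 + 9 * ln (INR J)) * / u by apply: Rmult_le_pos; lra.
have lll : ln (ln (ln (INR n))) <= ln u + (1 + 9 * ln (INR J)) * / u.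
  apply: (Rle_trans _ (ln (u * (1 + (1 + 9 * ln (INR J)) * / u)))); first by apply: ln_mono; lra.
  by rewrite ln_mult; [have := @ln_le_sub1 (1 + (1 + 9 * ln (INR J)) * / u) ltac:(lra); lra|lra|lra].
have iu2 : / u <= 2 * / INR J.
  rewrite uE Rinv_mult Rmult_comm; apply: Rmult_le_compat_r.
    by apply: Rinv_ge0; lra.
  by have := @Rinv_le_contravar (/ 2) (ln 2); rewrite Rinv_inv; apply; lra.
have iJ : / INR J <= eps / 60.
  have P : 60 / eps < INR J by apply: Rlt_le_trans Hk2 _; apply: leq_INR; rewrite /J; lia.
  have -> : eps / 60 = / (60 / eps) by field; lra.
  by apply: Rinv_le_contravar; [apply: Rdiv_lt_0_compat; lra|lra].
have : (1 + 9 * ln (INR J)) * / u <= eps / 6.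
  apply: (Rle_trans _ ((1 + 9 * ln (INR J)) * (2 * / INR J))).
    by apply: Rmult_le_compat_l; lra.
  rewrite /Rdiv in G; lra.
rewrite /N -/u in low; lra.
Qed.

Theorem theorem1p1 :
  LimSup_seq (fun n : nat => (I_ratio n / (ln (ln (INR n)) * ln (ln (INR n))))%R)
  = Finite (6 / (PI * PI) * exp (2 * euler_gamma))%R.
Proof.
set l := 6 / (PI * PI) * exp (2 * euler_gamma).
have pi0 := PI_RGT_0.
have p0 : 0 < 6 / PI ^ 2 by apply: Rdiv_lt_0_compat; [lra|exact: pow_lt].
have lE : l = exp log_limit.
  rewrite /log_limit exp_plus exp_ln // /l Rmult_comm; congr (_ * (_ / _)); ring.
have l0 : 0 < l by rewrite lE; exact: exp_pos.
have ratioE n : (0 < n)%N -> 1 < ln (ln (INR n)) ->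
    I_ratio n / (ln (ln (INR n)) * ln (ln (INR n))) =
    exp (ln (I_ratio n) - 2 * ln (ln (ln (INR n)))).
  move=> n0 L; have [I0 _] := ln_I_ratio n0; have L0 : 0 < ln (ln (INR n)) by lra.
  have -> : 2 * ln (ln (ln (INR n))) = ln (ln (ln (INR n))) + ln (ln (ln (INR n))) by ring.
  by rewrite /Rminus exp_plus exp_Ropp exp_plus !exp_ln.
apply: is_LimSup_seq_unique => eps; have e0 := cond_pos eps.
split=> [N|].
  (* l exp(-d) >= l (1 - d) = l - eps/2. *)
  pose d := eps / (2 * l); have d0 : 0 < d by apply: Rdiv_lt_0_compat; lra.
  have [n1 H1] := I_ratio_upper d0.
  have [n [nn H]] := I_ratio_lower (N + n1 + 1) d0.
  exists n; split; first by lia.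
  have [L _] := H1 n ltac:(lia); rewrite ratioE //; last by lia.
  apply: (Rlt_le_trans _ (exp (log_limit - d))); last exact: exp_mono.
  have := exp_ineq1_le (- d); rewrite /Rminus exp_plus -lE => K.
  have := Rmult_le_compat_l _ _ _ (Rlt_le _ _ l0) K.
  have -> : l * (1 + - d) = l - eps / 2 by rewrite /d; field; lra.
  lra.
(* Half of the logarithmic gap, so that l exp(d) stays strictly below l + eps. *)
pose d := (ln (l + eps) - ln l) / 2.
have ll : ln l < ln (l + eps) by apply: ln_increasing; lra.
have [n1 H1] := @I_ratio_upper d ltac:(rewrite /d; lra).
exists n1.+1 => n /leP nn; have [L H] := H1 n (ltnW nn).
rewrite ratioE //; last by lia.
apply: (Rle_lt_trans _ (exp (log_limit + d))); first exact: exp_mono.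
rewrite -[X in _ < X]exp_ln; last lra.
apply: exp_increasing; move: ll; rewrite /d lE ln_exp; lra.
Qed.
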